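(* Let $n\in\mathbb{N}$, $1<p<\infty$, and let $q$ be defined by $\frac1p+\frac1q=1$. There is a constant $C$ depending only on $n$ and $p$ such that for every bounded domain $\Omega\subset\mathbb{R}^n$ with a comparable inscribed rectangle, $$h_k(\Omega)\leq C\,k^{\frac1n}\left(\frac{\lambda_1(p,\Omega)}{h_1(\Omega)}\right)^{\frac{q}{p}}\qquad\text{for all integers } 1\leq k<+\infty .$$
   Context: Comparable inscribed rectangle: constants $c_1,c_2>0$, independent of $\Omega$, are fixed; $\Omega$ has a comparable inscribed rectangle if there is an $n$-dimensional rectangle (box) $R\subset\Omega$ with $c_1|R|\le|\Omega|\le c_2|R|$, where $|\cdot|$ is $n$-dimensional Lebesgue measure. First eigenvalue of the Dirichlet $p$-Laplacian: $\lambda_1(p,\Omega)=\inf\left\{\frac{\int_\Omega|\nabla u|^p\,dx}{\int_\Omega|u|^p\,dx}: u\in W^{1,p}_0(\Omega)\setminus\{0\}\right\}$ (this is the case $k=1$ of the variational eigenvalues $\lambda_k(p,\Omega)=\inf_{A}\max_{u\in A}\frac{\int_\Omega|\nabla u|^p}{\int_\Omega|u|^p}$, the infimum being over symmetric sets $A\subset W^{1,p}_0(\Omega)\setminus\{0\}$ with $A\cap\{\|u\|_p=1\}$ compact and Krasnoselskii genus $\ge k$). Cheeger constants: for measurable $E\subseteq\Omega$, $|\partial E|$ denotes the perimeter $\sup\{\int_E\operatorname{div}\phi\,dx:\phi\in C_c^1(\mathbb{R}^n,\mathbb{R}^n),\ |\phi|\le 1\}$, and $\frac{|\partial E|}{|E|}:=+\infty$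 if $|E|=0$. Set $h_1(\Omega):=h(\Omega):=\inf_D\frac{|\partial D|}{|D|}$, with $D$ varying over all smooth subdomains of $\Omega$ whose boundary does not touch $\partial\Omega$. The $k$-th Cheeger constant is $$h_k(\Omega):=\inf\Big\{\lambda\in\mathbb{R}^+ : \exists\,E_1,\dots,E_k\subseteq\Omega,\ E_i\cap E_j=\emptyset\ (i\ne j),\ \max_{1\le i\le k}\tfrac{|\partial E_i|}{|E_i|}\le\lambda\Big\}.$$ *)

(* Defs.v *)
From HB Require Import structures.
From mathcomp Require Import all_boot all_order all_algebra.
From mathcomp Require Import all_classical all_reals all_analysis.

Set Implicit Arguments.
Unset Strict Implicit.
Unset Printing Implicit Defensive.

Import Order.TTheory GRing.Theory Num.Theory.
Import numFieldNormedType.Exports.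

Local Open Scope classical_set_scope.
Local Open Scope ring_scope.

(* Points of R^n are row vectors 'rV[R]_n.  The library gives them their usual
   topology (through the sup norm); it provides no measurable structure on
   them, so they get the product of the Borel sigma-algebras of R here, that
   is, the Borel sigma-algebra of R^n. *)
Definition rV_display : measure_display.
Proof. exact: default_measure_display. Qed.

Section measurable_rV.
Context (R : realType) (n : nat).

Let coors (i : 'I_n) (x : 'rV[R]_n) : measurableTypeR R := x ord0 i.

Let rV_set0 : g_sigma_preimage coors set0.
Proof. exact: sigma_algebra0. Qed.

Let rV_setC A : g_sigma_preimage coors A -> g_sigma_preimage coors (~` A).
Proof. exact: sigma_algebraC. Qed.

Let rV_bigcup (F : _^nat) : (forall i, g_sigma_preimage coors (F i)) ->
  g_sigma_preimage coors (\bigcup_i (F i)).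
Proof. exact: sigma_algebra_bigcup. Qed.

HB.instance Definition _ := @isMeasurable.Build rV_display
  'rV[R]_n (g_sigma_preimage coors) rV_set0 rV_setC rV_bigcup.

Lemma measurable_coord (i : 'I_n) :
  measurable_fun [set: 'rV[R]_n] (coors i).
Proof.
move=> _ Y mY; rewrite setTI; apply: sub_sigma_algebra => /=.
rewrite -bigcup_seq/=; exists i => /=; first by rewrite mem_index_enum.
by exists Y => //; rewrite setTI.
Qed.

Lemma measurable_fun_rV d (T : measurableType d) (f : T -> 'rV[R]_n) :
  (forall i, measurable_fun [set: T] (coors i \o f)) ->
  measurable_fun [set: T] f.
Proof.
move=> mf.
have H : g_sigma_preimage (fun i => coors i \o f) `<=` measurable.
  apply: smallest_sub; first exact: sigma_algebra_measurable.
  move=> A; rewrite -bigcup_seq/= => -[i _ [B mB <-]].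
  exact: mf.
by move=> _ A mA; apply: H; rewrite g_sigma_preimage_comp; exists A.
Qed.

End measurable_rV.

(* The library proves this but leaves the instance unreachable: inference finds
   the one for products of subprobabilities first. *)
Lemma sigma_finite_product d1 d2 (T1 : measurableType d1)
    (T2 : measurableType d2) (R : realType)
    (m1 : {sigma_finite_measure set T1 -> \bar R})
    (m2 : {sigma_finite_measure set T2 -> \bar R}) :
  sigma_finite setT (m1 \x m2)%E.
Proof.
have /sigma_finiteP[F [TF ndF Foo]] := sigma_finiteT m1.
have /sigma_finiteP[G [TG ndG Goo]] := sigma_finiteT m2.
exists (fun k => F k `*` G k).
  rewrite -setXTT TF TG predeqE => -[x y]; split.
    move=> [/= [i _ Fx] [j _ Gy]]; exists (maxn i j) => //; split.
    - by move: x Fx; exact/subsetPset/ndF/leq_maxl.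
    - by move: y Gy; exact/subsetPset/ndG/leq_maxr.
  by move=> [k _ []/= ? ?]; split; exists k.
move=> k; have [? ?] := Foo k; have [? ?] := Goo k.
split; first exact: measurableX.
by rewrite product_measure1E// lte_mul_pinfty// ge0_fin_numE.
Qed.

Section lebesgue_measure_rV.
Context (R : realType).

Definition rV_cons n (x : measurableTypeR R * 'rV[R]_n) : 'rV[R]_n.+1 :=
  @row_mx R 1 1 n x.1%:M x.2.

Lemma measurable_rV_cons n : measurable_fun [set: _] (@rV_cons n).
Proof.
apply: measurable_fun_rV => i.
have [j ij|j ij] := @fintype.splitP 1 n i.
- rewrite (_ : _ \o _ = fst); first exact: measurable_fst.
  apply/funext => x /=; rewrite /rV_cons.
  have -> : i = @lshift 1 n j by exact/val_inj.
  by rewrite (@row_mxEl R 1 1 n) (ord1 j) mxE eqxx mulr1n.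
- rewrite (_ : _ \o _ =
    (fun y : 'rV[R]_n => y ord0 j : measurableTypeR R) \o snd).
    by apply: measurableT_comp; [exact: measurable_coord|exact: measurable_snd].
  apply/funext => x /=; rewrite /rV_cons.
  have -> : i = @rshift 1 n j by exact/val_inj.
  by rewrite (@row_mxEr R 1 1 n).
Qed.

Section pushforward_rV_cons.
Local Open Scope ereal_scope.
Variables (n : nat).
Variable nu : {measure set (measurableTypeR R * 'rV[R]_n)%type -> \bar R}.

Definition pushforward_cons : set 'rV[R]_n.+1 -> \bar R :=
  pushforward nu (@rV_cons n).

Let pushforward_cons0 : pushforward_cons set0 = 0.
Proof. by rewrite /pushforward_cons /pushforward preimage_set0 measure0. Qed.

Let pushforward_cons_ge0 A : 0 <= pushforward_cons A.
Proof. by rewrite /pushforward_cons /pushforward measure_ge0. Qed.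

Let pushforward_cons_sigma_additive : semi_sigma_additive pushforward_cons.
Proof.
move=> F mF tF mUF; rewrite /pushforward_cons /pushforward preimage_bigcup.
have mcons A : measurable A -> measurable (@rV_cons n @^-1` A).
  by move=> mA; rewrite -[X in measurable X]setTI; exact: measurable_rV_cons.
apply: measure_semi_sigma_additive.
- by move=> k; exact: mcons.
- apply/trivIsetP => /= i j _ _ ij; rewrite -preimage_setI.
  by move/trivIsetP : tF => /(_ _ _ _ _ ij) ->//; rewrite preimage_set0.
- by rewrite -preimage_bigcup; exact: mcons.
Qed.

HB.instance Definition _ := isMeasure.Build _ _ _ pushforward_cons
  pushforward_cons0 pushforward_cons_ge0 pushforward_cons_sigma_additive.

End pushforward_rV_cons.

Section lebesgue_step.
Local Open Scope ereal_scope.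
Variables (n : nat) (mu : {sigma_finite_measure set 'rV[R]_n -> \bar R}).

Definition lebesgue_step : set 'rV[R]_n.+1 -> \bar R :=
  pushforward_cons (lebesgue_measure \x mu).

HB.instance Definition _ := Measure.on lebesgue_step.

Let rV_uncons (y : 'rV[R]_n.+1) : measurableTypeR R * 'rV[R]_n :=
  (y ord0 ord0, @rsubmx R 1 1 n y).

Let rV_consK : cancel (@rV_cons n) rV_uncons.
Proof.
case=> a v; rewrite /rV_uncons /rV_cons; congr pair; last exact: row_mxKr.
have -> : ord0 = @lshift 1 n ord0 by exact/val_inj.
by rewrite (@row_mxEl R 1 1 n) mxE eqxx mulr1n.
Qed.

Let measurable_rV_uncons : measurable_fun [set: _] rV_uncons.
Proof.
apply/measurable_fun_pairP; split; first exact: measurable_coord.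
apply: measurable_fun_rV => i.
rewrite (_ : _ \o _ =
  fun y : 'rV[R]_n.+1 => y ord0 (@rshift 1 n i) : measurableTypeR R).
  exact: measurable_coord.
by apply/funext => y /=; rewrite mxE.
Qed.

Let sigma_finite_step : sigma_finite setT lebesgue_step.
Proof.
have [F FT mF] := sigma_finite_product (@lebesgue_measure R) mu.
exists (fun k => rV_uncons @^-1` F k).
  by rewrite -preimage_bigcup -FT preimage_setT.
move=> k; have [mFk Fk] := mF k; split.
  by rewrite -[X in measurable X]setTI; exact: measurable_rV_uncons.
rewrite /lebesgue_step /pushforward_cons /pushforward -comp_preimage.
rewrite (_ : _ @^-1` _ = F k)//.
by apply/seteqP; split=> x; rewrite /preimage /= rV_consK.
Qed.

HB.instance Definition _ := Measure_isSigmaFinite.Build _ _ _ lebesgue_step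
  sigma_finite_step.

End lebesgue_step.

(* n-dimensional Lebesgue measure: an n-fold product of the Lebesgue measure
   of R, carried to row vectors; in dimension 0 it is the unit mass. *)
Fixpoint lebesgue_rV n : {sigma_finite_measure set 'rV[R]_n -> \bar R} :=
  match n with
  | 0%N => \d_(0 : 'rV[R]_0)
  | m.+1 => lebesgue_step (lebesgue_rV m)
  end.

End lebesgue_measure_rV.

Definition enorm (R : realType) n (v : 'rV[R]_n) : R :=
  Num.sqrt (\sum_(i < n) v ord0 i ^+ 2).

Section calculus.
Context (R : realType) (n : nat).
Implicit Types (f : 'rV[R]_n -> R) (phi : 'rV[R]_n -> 'rV[R]_n).
Implicit Types A Omega D U : set 'rV[R]_n.

Definition partial (i : 'I_n) f : 'rV[R]_n -> R := 'D_(delta_mx ord0 i) f.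

Definition grad f (x : 'rV[R]_n) : 'rV[R]_n := \row_i partial i f x.

Definition divergence phi (x : 'rV[R]_n) : R :=
  \sum_(i < n) partial i (fun y => phi y ord0 i) x.

(* C^k on the whole of R^n: all the partial derivatives of order at most k
   exist and are continuous. *)
Fixpoint Ck (k : nat) f : Prop :=
  match k with
  | 0%N => continuous f
  | m.+1 => continuous f /\
      forall i, (forall x, derivable f x (delta_mx ord0 i)) /\
                Ck m (partial i f)
  end.

Definition smooth f := forall k, Ck k f.

Definition supp (V : nmodType) (f : 'rV[R]_n -> V) : set 'rV[R]_n :=
  closure [set x | f x != 0].

Definition test_function Omega f :=
  [/\ smooth f, compact (supp f) & supp f `<=` Omega].

Definition bdry A := closure A `\` interior A.

Definition domain Omega := [/\ open Omega, connected Omega & Omega !=set0].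

(* Near each point of its boundary, D is a strict sublevel set of a smooth
   function with nonzero gradient at that point. *)
Definition smooth_boundary D := forall x, bdry D x ->
  exists (U : set 'rV[R]_n) (psi : 'rV[R]_n -> R),
    [/\ open U, U x, smooth psi, grad psi x != 0 &
        D `&` U = [set y | U y /\ psi y < 0]].

Definition smooth_subdomain Omega D :=
  [/\ domain D, smooth_boundary D, D `<=` Omega &
      bdry D `&` bdry Omega = set0].

(* The box may be rotated, and it is open: a box of any other kind contains an
   open one of the same volume. *)
Definition box A := exists (a l : 'rV[R]_n) (Q : 'M[R]_n),
  [/\ Q *m Q^T = 1%:M, forall i, 0 < l ord0 i &
      A = [set a + t *m Q | t in
             [set t : 'rV[R]_n | forall i, 0 < t ord0 i < l ord0 i]]].

End calculus.

Section cheeger.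
Context (R : realType) (n : nat).
Local Open Scope ereal_scope.
Local Notation mu := (lebesgue_rV R n).
Implicit Types Omega D E : set 'rV[R]_n.

Definition comparable_box (c1 c2 : R) Omega := exists B : set 'rV[R]_n,
  [/\ box B, B `<=` Omega, c1%:E * mu B <= mu Omega &
      mu Omega <= c2%:E * mu B].

Definition perimeter E : \bar R :=
  ereal_sup [set \int[mu]_(x in E) (divergence phi x)%:E | phi in
    [set phi : 'rV[R]_n -> 'rV[R]_n |
      [/\ forall i, Ck 1 (fun x => phi x ord0 i), compact (supp phi) &
          forall x, (enorm (phi x) <= 1)%R]]].

(* The test on |E| is needed: in \bar R, 0 / 0 = 0 * +oo = 0. *)
Definition cheeger_quotient E : \bar R :=
  if mu E == 0 then +oo else perimeter E / mu E.

Definition cheeger Omega : \bar R :=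
  ereal_inf [set cheeger_quotient D | D in smooth_subdomain Omega].

(* h_1 is the constant h, an infimum over smooth subdomains, and not the
   infimum over measurable sets that defines h_k for k > 1: the latter may be
   smaller, e.g. if Omega is a slit domain. *)
Definition cheeger_k (k : nat) Omega : \bar R :=
  if k == 1%N then cheeger Omega
  else ereal_inf [set lambda%:E | lambda in
    [set lambda : R | (0 < lambda)%R /\
      exists E : 'I_k -> set 'rV[R]_n,
        [/\ forall i, measurable (E i) /\ E i `<=` Omega,
            forall i j, i != j -> E i `&` E j = set0 &
            forall i, cheeger_quotient (E i) <= lambda%:E]]].

End cheeger.

Section sobolev.
Context (R : realType) (n : nat).
Local Open Scope ereal_scope.
Local Notation mu := (lebesgue_rV R n).
Implicit Types (p : R) (Omega : set 'rV[R]_n).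
Implicit Types (u : 'rV[R]_n -> R) (g : 'rV[R]_n -> 'rV[R]_n).

Definition in_Lp p Omega u :=
  measurable_fun Omega u /\ \int[mu]_(x in Omega) (`|u x| `^ p)%:E < +oo.

Definition weak_gradient Omega u g := forall f, test_function Omega f ->
  forall i : 'I_n,
    \int[mu]_(x in Omega) (u x * partial i f x)%:E =
    - \int[mu]_(x in Omega) (g x ord0 i * f x)%:E.

(* u belongs to W^{1,p}(Omega) and its gradient is g. *)
Definition W1p p Omega u g :=
  [/\ in_Lp p Omega u, forall i, in_Lp p Omega (fun x => g x ord0 i) &
      weak_gradient Omega u g].

(* The closure of the test functions in W^{1,p}(Omega). *)
Definition W1p0 p Omega u g := W1p p Omega u g /\
  exists f : nat -> 'rV[R]_n -> R,
    [/\ forall j, test_function Omega (f j),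
        \int[mu]_(x in Omega) (`|u x - f j x| `^ p)%:E @[j --> \oo] --> 0 &
        \int[mu]_(x in Omega) (enorm (g x - grad (f j) x)%R `^ p)%:E
          @[j --> \oo] --> 0].

Definition lambda1 p Omega : \bar R :=
  ereal_inf [set y | exists u g,
    [/\ W1p0 p Omega u g,
        ~ {ae mu, forall x, Omega x -> u x = 0%R} &
        y = (\int[mu]_(x in Omega) (enorm (g x) `^ p)%:E) /
            (\int[mu]_(x in Omega) (`|u x| `^ p)%:E)]].

End sobolev.

(* Main.v *)
(* Up to constants, both h_1 and h_k / k^(1/n) are at most lambda_1^(1/p); since
   q/p = 1/(p-1), the first bound turns the second one into the theorem.  For a
   test function f, the coarea formula with the weight t^(p-1) shows that if
   theta |{f > t}| is at most twice the "perimeter" of {f > t} for almost every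
   level t > 0, then theta^p \int |f|^p <= C \int |grad f|^p.  So it is enough
   that a level violating this inequality yields competitors for the Cheeger
   constants.  For h_k, such a superlevel set has volume at least c theta^(-n) by
   an isoperimetric (Nash) inequality, and a grid of mesh k^(-1/n)/theta in
   general position cuts it into k disjoint pieces of quotient at most
   C k^(1/n) theta.  For h_1, a small quadratic perturbation of f makes almost
   every level regular, so that its superlevel sets have finitely many components,
   which are smooth subdomains; one of them has quotient at most theta. *)
Require Import Defs.
From HB Require Import structures.
From mathcomp Require Import all_boot all_order all_algebra.
From mathcomp Require Import all_classical all_reals all_analysis.
From mathcomp Require Import measurable_realfun.
From mathcomp Require Import ring lra zify.

Set Implicit Arguments.
Unset Strict Implicit.
Unset Printing Implicit Defensive.

Import Order.TTheory GRing.Theory Num.Theory.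
Import numFieldNormedType.Exports.

Local Open Scope classical_set_scope.
Local Open Scope ring_scope.

(** * Lebesgue measure on row vectors *)

(** Two obstacles shape the proof. First, the perimeter is a supremum over test fields, with no
    boundary measure to integrate. In its place stands [m+1] times the l1-gradient mass of [F] in
    the slab [{t < F < t + 1/(m+1)}]. Fatou's lemma in t then gives an inequality of coarea type,
    while C^1 ramps across the same slab bound, by integration by parts, the perimeters of the
    superlevel set and of pieces cut out of it. A level violating the desired inequality provides a
    number [b], strictly below [theta |{F > t}|], that bounds twice the slab mass for infinitely
    many m; both constructions of competitors start from this gap. Second, h_1 only admits smooth
    subdomains. The perturbation [f - e |x|^2 - a.x] has a critical point at height t only if
    [(t, a)] lies in the image of a C^1 map from R^n to R^(n+1), a null set by counting cubes;
    Fubini's theorem then selects an [a] for which almost every t is regular. The price is an error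
    [tau] in f and its gradient, so the integral inequality is first proved with an error term and
    [tau] is then sent to 0. *)

Lemma integral_indicT d (T : measurableType d) (R : realType)
    (mu : {measure set T -> \bar R}) (A : set T) : measurable A ->
  (\int[mu]_x (\1_A x)%:E = mu A)%E.
Proof. by move=> mA; rewrite integral_indic// setIT. Qed.

Lemma measurable_EFin_comp d (T : measurableType d) (R : realType) (D : set T)
  (f : T -> R) : measurable_fun D f -> measurable_fun D (fun x => (f x)%:E).
Proof. by move=> mf; apply/measurable_EFinP. Qed.

Section rV_measure.
Context {R : realType}.

Lemma nbhs_rVP n (x : 'rV[R]_n) (A : set 'rV[R]_n) :
  nbhs x A <-> exists2 e : R, 0 < e &
    forall y : 'rV[R]_n, (forall i, `|y ord0 i - x ord0 i| < e) -> A y.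
Proof.
split.
  move=> /nbhs_ballP[e /= e0 eA]; exists e => // y xy; apply: eA.
  by split => // i j; rewrite (ord1 i) /ball/= distrC.
move=> [e e0 eA]; apply/nbhs_ballP; exists e => //= y [_ xy]; apply: eA => i.
by have := xy ord0 i; rewrite /ball/= distrC.
Qed.

Lemma measurable_coordR n (i : 'I_n) :
  measurable_fun [set: 'rV[R]_n] (fun x : 'rV[R]_n => x ord0 i).
Proof. exact: (measurable_coord i). Qed.

Lemma measurable_rV_box n (A : 'I_n -> set R) : (forall i, measurable (A i)) ->
  measurable [set x : 'rV[R]_n | forall i, A i (x ord0 i)].
Proof.
move=> mA.
rewrite (_ : [set x | _] = \bigcap_(i in [set: 'I_n])
   ((fun x : 'rV[R]_n => x ord0 i) @^-1` A i)); last first.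
  by apply/seteqP; split=> [x xA i _|x xA i]; exact: xA.
apply: fin_bigcap_measurable => [|i _]; first exact: finite_finset.
by rewrite -[X in measurable X]setTI; exact: measurable_coordR.
Qed.

(** The sigma-algebra is generated by the coordinates, so the open set is written as the union of
    the countably many cubes with rational centre and radius [1/(m+1)] that it contains. *)
Lemma open_measurable_rV n (A : set 'rV[R]_n) : open A -> measurable A.
Proof.
move=> oA.
pose B (c : 'rV[rat]_n * nat) := [set y : 'rV[R]_n | forall i,
  (`]ratr (c.1 ord0 i) - c.2.+1%:R^-1, ratr (c.1 ord0 i) + c.2.+1%:R^-1[%classic
     : set R) (y ord0 i)].
rewrite (_ : A = \bigcup_c (if `[< B c `<=` A >] then B c else set0)).
  apply: countable_bigcupT_measurable; first exact: countableP.
  move=> c; case: ifP => // _.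
  apply: (measurable_rV_box (A := fun i : 'I_n => [set` `]ratr (c.1 ord0 i) -
    c.2.+1%:R^-1, ratr (c.1 ord0 i) + c.2.+1%:R^-1[ ] : set R)) => i.
  exact: measurable_itv.
apply/seteqP; split=> [x Ax|x [c _]]; last by case: ifPn => // /asboolP cA /cA.
have /nbhs_rVP[e e0 eA] : nbhs x A by exact: open_nbhs_nbhs.
(* Half of [e]: the rational centre is within [1/(m+1)] of [x], and the cube reaches as far
   again. *)
have [m me] : exists m : nat, m.+1%:R^-1 < e / 2.
  have e20 : 0 < e / 2 by rewrite divr_gt0.
  by have [m _ /(_ m (leqnn m))] := near_infty_natSinv_lt (PosNum e20); exists m.
have /choice[q qx] : forall i, exists q : rat, `|x ord0 i - ratr q| < m.+1%:R^-1.
  move=> i; have : x ord0 i - m.+1%:R^-1 < x ord0 i + m.+1%:R^-1.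
    by rewrite ltrD2l gtrN.
  move=> /rat_in_itvoo[q]; rewrite in_itv/= => /andP[q1 q2]; exists q.
  by rewrite distrC ltr_distl q1 q2.
have ci i : (\row_i q i) ord0 i = q i by rewrite mxE.
exists (\row_i q i, m) => //; case: asboolP => [_|]; last first.
  case; move=> y /= By; apply: eA => i; have := By i; rewrite /= in_itv/= ci => /andP[y1 y2].
  by have := qx i; rewrite !ltr_norml => /andP[q1 q2]; apply/andP; split; move: me q1 q2 y1 y2;
    move: (ratr (q i)) (m.+1%:R^-1) => u v; lra.
move=> i; rewrite /= in_itv/= ci; have := qx i; rewrite !ltr_norml => /andP[q1 q2].
by apply/andP; split; move: q1 q2; move: (ratr (q i)) (m.+1%:R^-1) => u v; lra.
Qed.

Lemma continuous_measurable_rV n (f : 'rV[R]_n -> R) :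
  continuous f -> measurable_fun setT f.
Proof.
move=> cf; apply: (measurability _ (measurable_realfun.RGenOpens.measurableE R)).
move=> _ [_ [a [b ->]] <-]; rewrite setTI; apply: open_measurable_rV.
by apply: open_comp => //; exact: interval_open.
Qed.

Lemma rV_consE0 n a (y : 'rV[R]_n) : rV_cons (a, y) ord0 ord0 = a.
Proof.
rewrite /rV_cons/=; have -> : ord0 = @lshift 1 n ord0 by exact/val_inj.
by rewrite (@row_mxEl R 1 1 n) mxE eqxx mulr1n.
Qed.

Lemma rV_consES n a (y : 'rV[R]_n) i : rV_cons (a, y) ord0 (lift ord0 i) = y ord0 i.
Proof.
rewrite /rV_cons/=; have -> : lift ord0 i = @rshift 1 n i by exact/val_inj.
by rewrite (@row_mxEr R 1 1 n).
Qed.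

Local Open Scope ereal_scope.
Local Notation mu := (lebesgue_rV R).
Local Notation leb := (@lebesgue_measure R).

Lemma ge0_integral_rV_cons n (f : 'rV[R]_n.+1 -> \bar R) :
  measurable_fun [set: 'rV[R]_n.+1] f -> (forall x, 0 <= f x) ->
  \int[mu n.+1]_x f x = \int[leb \x mu n]_z f (rV_cons z).
Proof.
move=> mf f0.
have := @ge0_integral_pushforward _ _ _ _ R (@rV_cons R n) (@measurable_rV_cons R n)
  (leb \x mu n) setT f measurableT mf (fun x _ => f0 x).
by rewrite preimage_setT => <-.
Qed.

Lemma tonelli_rV1 n (f : 'rV[R]_n.+1 -> \bar R) :
  measurable_fun [set: 'rV[R]_n.+1] f -> (forall x, 0 <= f x) ->
  \int[mu n.+1]_x f x = \int[leb]_a \int[mu n]_y f (rV_cons (a, y)).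
Proof.
move=> mf f0; rewrite ge0_integral_rV_cons// fubini_tonelli1//.
by apply: measurableT_comp => //; exact: measurable_rV_cons.
Qed.

Lemma tonelli_rV2 n (f : 'rV[R]_n.+1 -> \bar R) :
  measurable_fun [set: 'rV[R]_n.+1] f -> (forall x, 0 <= f x) ->
  \int[mu n.+1]_x f x = \int[mu n]_y \int[leb]_a f (rV_cons (a, y)).
Proof.
move=> mf f0; rewrite ge0_integral_rV_cons// fubini_tonelli2//.
by apply: measurableT_comp => //; exact: measurable_rV_cons.
Qed.

Lemma integrable_rV_cons n (f : 'rV[R]_n.+1 -> \bar R) :
  (mu n.+1).-integrable setT f ->
  (leb \x mu n).-integrable setT (f \o @rV_cons R n).
Proof.
move=> /integrableP[mf fi]; apply/integrableP; split.
  by apply: measurableT_comp => //; exact: measurable_rV_cons.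
rewrite -(@ge0_integral_rV_cons n (fun x => `|f x|))//.
exact: measurableT_comp.
Qed.

Lemma integral_rV_cons n (f : 'rV[R]_n.+1 -> \bar R) :
  (mu n.+1).-integrable setT f ->
  \int[mu n.+1]_x f x = \int[leb \x mu n]_z f (rV_cons z).
Proof.
move=> fi.
have mf : measurable_fun setT f by case/integrableP : fi.
have := @integral_pushforward _ _ _ _ R (@rV_cons R n) (@measurable_rV_cons R n)
  (leb \x mu n) setT f mf.
rewrite preimage_setT => <- //; exact: integrable_rV_cons.
Qed.

Lemma fubini_rV1 n (f : 'rV[R]_n.+1 -> \bar R) :
  (mu n.+1).-integrable setT f ->
  \int[mu n.+1]_x f x = \int[leb]_a \int[mu n]_y f (rV_cons (a, y)).
Proof.
move=> fi; rewrite integral_rV_cons// -integral12_prod_meas1//.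
exact: integrable_rV_cons.
Qed.

Lemma fubini_rV2 n (f : 'rV[R]_n.+1 -> \bar R) :
  (mu n.+1).-integrable setT f ->
  \int[mu n.+1]_x f x = \int[mu n]_y \int[leb]_a f (rV_cons (a, y)).
Proof.
move=> fi; rewrite integral_rV_cons// -integral21_prod_meas1//.
exact: integrable_rV_cons.
Qed.

Lemma lebesgue_rV_box n (A : 'I_n -> set R) : (forall i, measurable (A i)) ->
  mu n [set x | forall i, A i (x ord0 i)] = \prod_(i < n) leb (A i).
Proof.
elim: n A => [A mA|n IH A mA].
  rewrite big_ord0 /= diracE [_ \in _](_ : _ = true)//.
  by apply/mem_set => -[].
pose B := [set x : 'rV[R]_n.+1 | forall i, A i (x ord0 i)]; rewrite -[X in lebesgue_rV R n.+1 X]/B.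
have mB : measurable B by exact: measurable_rV_box.
rewrite big_ord_recl -IH//.
rewrite -integral_indicT//.
rewrite tonelli_rV1//; last first.
  by apply: measurable_EFin_comp; exact: measurable_indic.
transitivity (\int[leb]_a ((\1_(A ord0) a)%:E *
   mu n [set x | forall i, A (lift ord0 i) (x ord0 i)])).
  apply: eq_integral => a _.
  have mA' : measurable [set x : 'rV[R]_n | forall i, A (lift ord0 i) (x ord0 i)].
    by apply: (measurable_rV_box (A := fun i => A (lift ord0 i))) => i.
  rewrite -integral_indicT//.
  rewrite -ge0_integralZl//; last first.
    by apply: measurable_EFin_comp; exact: measurable_indic.
  apply: eq_integral => y _; rewrite -EFinM !indicE -natrM mulnb; congr (_%:R%:E).
  congr (nat_of_bool _).
  apply/idP/andP => [/set_mem H|[/set_mem H1 /set_mem H2]].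
    split; apply/mem_set; first by have := H ord0; rewrite rV_consE0.
    by move=> i; have := H (lift ord0 i); rewrite rV_consES.
  apply/mem_set => i; case: (unliftP ord0 i) => [j ->|->].
    by rewrite rV_consES; exact: H2.
  by rewrite rV_consE0.
rewrite ge0_integralZr//; last first.
  by apply: measurable_EFin_comp; apply: measurable_indic; exact: mA.
by rewrite integral_indicT//; exact: mA.
Qed.

End rV_measure.

(** * Functions of class C^1 *)

Section calculus.
Context {R : realType}.

Definition ebase n (i : 'I_n) : 'rV[R]_n := delta_mx ord0 i.

Lemma ebaseE n (i j : 'I_n) : (ebase i) ord0 j = (j == i)%:R.
Proof. by rewrite mxE eqxx. Qed.

Lemma continuous_coord n (i : 'I_n) : continuous (fun x : 'rV[R]_n => x ord0 i).
Proof. by move=> x; exact: coord_continuous. Qed.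

Lemma continuous_rV (T : topologicalType) n (f : T -> 'rV[R]_n) :
  (forall i, continuous (fun t => f t ord0 i)) -> continuous f.
Proof.
move=> cf t A /nbhs_rVP[e e0 eA].
have H : \forall s \near t, forall i, `|f s ord0 i - f t ord0 i| < e.
  apply: filter_forall => i; have /cvgrPdist_lt/(_ e e0) := cf i t.
  by apply: filterS => s; rewrite distrC.
by apply: filterS H => s; exact: eA.
Qed.

(** Both sides have the same difference quotient. This reduces directional derivatives to one
    variable, where the chain rule and the mean value theorem are available. *)
Lemma is_derive_line n (f : 'rV[R]_n -> R) (x v : 'rV[R]_n) (s df : R) :
  is_derive (s *: v + x) v f df <->
  is_derive s (1 : R) (fun t => f (t *: v + x)) df.
Proof.
have E : (fun h : R => h^-1 *: (f (h *: v + (s *: v + x)) - f (s *: v + x))) =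
    (fun h : R => h^-1 *: (f ((h *: (1 : R) + s) *: v + x) - f (s *: v + x))).
  by apply/funext => h; rewrite scalerDl scaler1 addrA.
by split=> -[H1 H2]; split; move: H1 H2; rewrite /derivable /derive E.
Qed.

Definition C1 n (f : 'rV[R]_n -> R) := Ck 1 f.

Lemma C1P n (f : 'rV[R]_n -> R) : C1 f <-> [/\ continuous f,
  forall i x, is_derive x (ebase i) f (partial i f x) &
  forall i, continuous (partial i f)].
Proof.
split=> [[cf H]|[cf H1 H2]].
  split => // i; last by have [] := H i.
  by move=> x; apply: derivableP; have [] := H i.
split => // i; split; last exact: H2.
by move=> x; have [] := H1 i x.
Qed.

Lemma C1_of_deriv n (f : 'rV[R]_n -> R) (df : 'I_n -> 'rV[R]_n -> R) :
  continuous f -> (forall i x, is_derive x (ebase i) f (df i x)) ->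
  (forall i, continuous (df i)) -> C1 f /\ forall i x, partial i f x = df i x.
Proof.
move=> cf Hd cd.
have E i x : partial i f x = df i x by rewrite /partial derive_val.
split => //; apply/C1P; split => // i.
by rewrite (_ : partial i f = df i)//; apply/funext => x.
Qed.

Lemma C1_continuous n (f : 'rV[R]_n -> R) : C1 f -> continuous f.
Proof. by case/C1P. Qed.

Lemma C1_partial_continuous n (f : 'rV[R]_n -> R) i : C1 f -> continuous (partial i f).
Proof. by case/C1P. Qed.

Lemma C1_is_derive n (f : 'rV[R]_n -> R) i x : C1 f ->
  is_derive x (ebase i) f (partial i f x).
Proof. by case/C1P. Qed.

Lemma continuousM_R n (f g : 'rV[R]_n -> R) : continuous f -> continuous g ->
  continuous (fun x => f x * g x).
Proof. by move=> cf cg x; exact: cvgM (cf x) (cg x). Qed.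

Lemma continuousD_R n (f g : 'rV[R]_n -> R) : continuous f -> continuous g ->
  continuous (fun x => f x + g x).
Proof. by move=> cf cg x; exact: cvgD (cf x) (cg x). Qed.

Lemma C1M n (f g : 'rV[R]_n -> R) : C1 f -> C1 g ->
  C1 (fun x => f x * g x) /\
  forall i x, partial i (fun x => f x * g x) x = f x * partial i g x + g x * partial i f x.
Proof.
move=> cf cg; apply: C1_of_deriv.
- by apply: continuousM_R; exact: C1_continuous.
- by move=> i x; apply: (is_deriveM (C1_is_derive i x cf) (C1_is_derive i x cg)).
- move=> i; apply: continuousD_R; apply: continuousM_R; try exact: C1_continuous;
  exact: C1_partial_continuous.
Qed.

Lemma C1D n (f g : 'rV[R]_n -> R) : C1 f -> C1 g ->
  C1 (fun x => f x + g x) /\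
  forall i x, partial i (fun x => f x + g x) x = partial i f x + partial i g x.
Proof.
move=> cf cg; apply: C1_of_deriv.
- by apply: continuousD_R; exact: C1_continuous.
- by move=> i x; apply: (is_deriveD (C1_is_derive i x cf) (C1_is_derive i x cg)).
- move=> i; apply: continuousD_R; exact: C1_partial_continuous.
Qed.

Lemma is_derive_comp_R n (f : 'rV[R]_n -> R) (h : R -> R) (x v : 'rV[R]_n) (df dh : R) :
  is_derive (f x) (1 : R) h dh -> is_derive x v f df ->
  is_derive x v (fun y => h (f y)) (dh * df).
Proof.
move=> Hh Hf.
have E : x = 0 *: v + x by rewrite scale0r add0r.
rewrite E; apply/is_derive_line.
apply: (@is_derive1_comp R h (fun t => f (t *: v + x))); first by rewrite -E.
by apply/is_derive_line; rewrite -E.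
Qed.

Lemma C1_comp n (f : 'rV[R]_n -> R) (h dh : R -> R) : C1 f -> continuous dh ->
  (forall s, is_derive s (1 : R) h (dh s)) ->
  C1 (fun x => h (f x)) /\ forall i x, partial i (fun x => h (f x)) x = dh (f x) * partial i f x.
Proof.
move=> cf cdh Hh; apply: C1_of_deriv.
- move=> x; apply: continuous_comp; first exact: C1_continuous.
  by apply: differentiable_continuous; apply/derivable1_diffP; have [] := Hh (f x).
- by move=> i x; exact: (is_derive_comp_R (Hh (f x)) (C1_is_derive i x cf)).
- move=> i; apply: continuousM_R; last exact: C1_partial_continuous.
  by move=> x; apply: continuous_comp; [exact: C1_continuous|exact: cdh].
Qed.

Lemma is_derive_coord n (i j : 'I_n) (x : 'rV[R]_n) :
  is_derive x (ebase i) (fun x : 'rV[R]_n => x ord0 j) ((j == i)%:R).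
Proof.
have E : x = 0 *: ebase i + x by rewrite scale0r add0r.
rewrite E; apply/is_derive_line.
rewrite (_ : (fun t => _) = (fun t : R => t * (j == i)%:R + x ord0 j)); last first.
  by apply/funext => t; rewrite mxE mxE ebaseE.
by apply: is_derive_eq; rewrite addr0 scale0r? mulr0 // add0r scaler1.
Qed.

Lemma C1_coord_fun n (j : 'I_n) (h dh : R -> R) : continuous dh ->
  (forall s, is_derive s (1 : R) h (dh s)) ->
  C1 (fun x : 'rV[R]_n => h (x ord0 j)) /\
  forall i x, partial i (fun x => h (x ord0 j)) x = dh (x ord0 j) * (j == i)%:R.
Proof.
move=> cdh Hh; apply: C1_of_deriv.
- move=> x; apply: continuous_comp; first exact: continuous_coord.
  by apply: differentiable_continuous; apply/derivable1_diffP; have [] := Hh (x ord0 j).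
- by move=> i x; exact: (is_derive_comp_R (Hh (x ord0 j)) (is_derive_coord i j x)).
- move=> i; apply: continuousM_R; last exact: cst_continuous.
  by move=> x; apply: continuous_comp; [exact: continuous_coord|exact: cdh].
Qed.

Lemma C1_cst n (c : R) : C1 (fun _ : 'rV[R]_n => c) /\
  forall i x, partial i (fun _ : 'rV[R]_n => c) x = 0.
Proof.
by apply: (@C1_of_deriv _ _ (fun _ _ => 0)) => *; exact: cst_continuous.
Qed.

Definition cube n (M : R) := [set x : 'rV[R]_n | forall i, `|x ord0 i| <= M].
Arguments cube : clear implicits.

Lemma measurable_cube n M : measurable (cube n M).
Proof.
apply: (measurable_rV_box (A := fun=> [set t : R | `|t| <= M])) => _.
rewrite (_ : [set _ | _] = `[-M, M]%classic)//.
by apply/seteqP; split => t; rewrite /= in_itv/= ler_norml.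
Qed.

Lemma cube_compact n M : compact (cube n M).
Proof.
rewrite (_ : cube n M = [set x : 'rV[R]_n | forall i, `[-M, M]%classic (x ord0 i)]).
  by apply: (@rV_compact R n (fun=> `[-M, M]%classic)) => _; exact: segment_compact.
by apply/seteqP; split => x xM i; have := xM i; rewrite /= in_itv/= ler_norml.
Qed.

Lemma cube_measure_lty n M : (lebesgue_rV R n (cube n M) < +oo)%E.
Proof.
have -> : cube n M = [set x : 'rV[R]_n | forall i, `[-M, M]%classic (x ord0 i)].
  by apply/seteqP; split => x xM i; have := xM i; rewrite /= in_itv/= ler_norml.
rewrite (@lebesgue_rV_box _ n (fun=> `[-M, M]%classic))//.
apply: (big_ind (fun y => y < +oo /\ 0 <= y)%E _ _ _).1 => //.
- by rewrite ltry lee_fin.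
- move=> x y [x1 x2] [y1 y2]; split; last exact: mule_ge0.
  by apply: lte_mul_pinfty; rewrite // ge0_fin_numE.
- move=> i _; split => //; rewrite lebesgue_measure_itv/=; case: ifP => // _.
  by rewrite -EFinB ltry.
Qed.

Lemma sub_cube_lty n M (S : set 'rV[R]_n) : measurable S -> S `<=` cube n M ->
  (lebesgue_rV R n S < +oo)%E.
Proof.
move=> mS SM; apply: le_lt_trans (cube_measure_lty n M).
by apply: le_measure SM; rewrite inE//; exact: measurable_cube.
Qed.

Lemma bounded_on_cube n M (f : 'rV[R]_n -> R) : continuous f ->
  exists2 K, 0 <= K & forall x, cube n M x -> `|f x| <= K.
Proof.
move=> cf; have : compact (f @` cube n M).
  by apply: continuous_compact; [exact: continuous_subspaceT|exact: cube_compact].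
move=> /compact_bounded[K [Kr KH]].
exists (`|K| + 1) => [|x xM]; first by rewrite addr_ge0.
by apply: (KH (`|K| + 1)); [rewrite (le_lt_trans (ler_norm _))// ltrDl|exists x].
Qed.

(** A form of compact support that passes at once to products, partial derivatives and coordinate
    slices, with the same [M]. *)
Definition csupp n M (f : 'rV[R]_n -> R) := forall x, ~ cube n M x -> f x = 0.

Lemma csupp_bounded n M (f : 'rV[R]_n -> R) : continuous f -> csupp M f ->
  exists2 K, 0 <= K & forall x, `|f x| <= K.
Proof.
move=> cf sf; have [K K0 H] := bounded_on_cube M cf; exists K => // x.
by have [/H//|/sf ->] := pselect (cube n M x); rewrite normr0.
Qed.

Lemma integrable_cube n M (K : R) (f : 'rV[R]_n -> R) : measurable_fun setT f ->
  csupp M f -> (forall x, `|f x| <= K) ->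
  (lebesgue_rV R n).-integrable setT (EFin \o f).
Proof.
move=> mf sf fK.
have mC := @measurable_cube n M.
have -> : EFin \o f = (EFin \o f) \_ (cube n M).
  apply/funext => x; rewrite patchE; case: ifPn => // /negP xM /=.
  by rewrite sf// => /mem_set.
apply/(integrable_mkcond _ mC).1; apply: measurable_bounded_integrable => //.
- exact: cube_measure_lty.
- exact: measurable_funS mf.
- exists K; split; first exact: num_real.
  by move=> N KN x _ /=; exact: le_trans (fK x) (ltW KN).
Qed.

Lemma csupp_partial n M (f : 'rV[R]_n -> R) i : csupp M f -> csupp M (partial i f).
Proof.
move=> sf x xM.
have [j xj] : exists j, M < `|x ord0 j|.
  by apply: contrapT => /forallNP H; apply: xM => j; rewrite leNgt; apply/negP.
have : \forall h \near 0^', h^-1 *: (f (h *: ebase i + x) - f x) = 0.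
  have : \forall h \near (0 : R), M < `|(h *: ebase i + x) ord0 j|.
    have : \forall h \near (0 : R), `|h| < `|x ord0 j| - M.
      by apply: nbhs0_lt; rewrite subr_gt0.
    apply: filterS => h hM; rewrite mxE mxE ebaseE.
    have : `|h * (j == i)%:R| <= `|h|.
      by case: (j == i); rewrite ?mulr1// mulr0 normr0.
    have := lerB_normD (x ord0 j) (h * (j == i)%:R).
    rewrite [_ + x ord0 j]addrC; lra.
  move=> H; apply: cvg_within; apply: filterS H => h hM.
  rewrite (sf x)// (sf (h *: _ + x)) ?subr0 ?scaler0// => /(_ j).
  by rewrite leNgt hM.
move=> H; rewrite /partial /derive; apply/cvg_lim => //.
by apply: cvg_near_cst.
Qed.

End calculus.
Arguments cube {R} n M.

(** * Vanishing of the integral of a partial derivative *)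

Section ibp.
Context {R : realType}.
Local Notation leb := (@lebesgue_measure R).

Lemma rV_eqP n (x y : 'rV[R]_n) : (forall i, x ord0 i = y ord0 i) -> x = y.
Proof. by move=> xy; apply/rowP. Qed.

Lemma lineE n (t : R) (x v : 'rV[R]_n) i :
  (t *: v + x) ord0 i = t * v ord0 i + x ord0 i.
Proof. by rewrite !mxE. Qed.

Lemma rV_cons_scale0 n (h a : R) (y : 'rV[R]_n) :
  rV_cons (h + a, y) = h *: ebase ord0 + rV_cons (a, y).
Proof.
apply: rV_eqP => i; rewrite lineE ebaseE; case: (unliftP ord0 i) => [j ->|->].
  by rewrite !rV_consES (_ : _ == _ = false) ?mulr0 ?add0r//; apply/negbTE/eqP.
by rewrite !rV_consE0 eqxx mulr1.
Qed.

Lemma rV_cons_scaleS n (h a : R) (j : 'I_n) (y : 'rV[R]_n) :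
  rV_cons (a, h *: ebase j + y) = h *: ebase (lift ord0 j) + rV_cons (a, y).
Proof.
apply: rV_eqP => i; rewrite lineE ebaseE; case: (unliftP ord0 i) => [k ->|->].
  by rewrite !rV_consES lineE ebaseE (inj_eq lift_inj).
by rewrite !rV_consE0 (_ : _ == _ = false) ?mulr0 ?add0r//; apply/negbTE/eqP.
Qed.

Lemma continuous_rV_cons1 n (a : R) : continuous (fun y : 'rV[R]_n => rV_cons (a, y)).
Proof.
apply: continuous_rV => i; case: (unliftP ord0 i) => [k ->|->].
  rewrite (_ : (fun _ => _) = fun y : 'rV[R]_n => y ord0 k); first exact: continuous_coord.
  by apply/funext => y; rewrite rV_consES.
rewrite (_ : (fun _ => _) = fun y : 'rV[R]_n => a); first exact: cst_continuous.
by apply/funext => y; rewrite rV_consE0.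
Qed.

Lemma continuous_rV_cons0 n (y : 'rV[R]_n) : continuous (fun a : R => rV_cons (a, y)).
Proof.
apply: continuous_rV => i; case: (unliftP ord0 i) => [k ->|->].
  rewrite (_ : (fun _ => _) = fun a : R => y ord0 k); first exact: cst_continuous.
  by apply/funext => a; rewrite rV_consES.
rewrite (_ : (fun _ => _) = id); first by move=> x; exact: cvg_id.
by apply/funext => a; rewrite rV_consE0.
Qed.

Lemma C1_section1 n (G : 'rV[R]_n.+1 -> R) (a : R) : C1 G ->
  C1 (fun y => G (rV_cons (a, y))) /\
  forall j y, partial j (fun y => G (rV_cons (a, y))) y = partial (lift ord0 j) G (rV_cons (a, y)).
Proof.
move=> cG; apply: C1_of_deriv.
- by move=> y; apply: continuous_comp; [exact: continuous_rV_cons1|exact: C1_continuous].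
- move=> j y.
  have E : y = 0 *: ebase j + y by rewrite scale0r add0r.
  rewrite {1}E; apply/is_derive_line.
  rewrite (_ : (fun t => _) = fun t => G (t *: ebase (lift ord0 j) + rV_cons (a, y))).
    apply/is_derive_line; rewrite scale0r add0r; exact: C1_is_derive.
  by apply/funext => t; rewrite rV_cons_scaleS.
- move=> j y; apply: continuous_comp; first exact: continuous_rV_cons1.
  exact: C1_partial_continuous.
Qed.

Lemma integral_deriv_csupp (g dg : R -> R) (M : R) :
  (forall s, is_derive s (1 : R) g (dg s)) -> continuous dg ->
  (forall s, M < `|s| -> g s = 0) -> (\int[leb]_s (dg s)%:E = 0)%E.
Proof.
move=> Hg cdg gM.
(* [M] may be negative; [N] is positive and exceeds [M], so that [g] vanishes at both ends of the
   nondegenerate interval [[-N, N]]. *)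
pose N : R := `|M| + 1.
have MN : M < N by rewrite (le_lt_trans (ler_norm M))// ltrDl.
have N0 : 0 < N by rewrite ltr_wpDl.
have cg : continuous g.
  by move=> s; apply: differentiable_continuous; apply/derivable1_diffP; have [] := Hg s.
have dg0 s : N < `|s| -> dg s = 0.
  move=> sN; rewrite -(@derive_val _ _ _ _ _ _ _ (Hg s)).
  rewrite (near_eq_derive _ (g := cst 0)) ?derive_cst//.
  near=> t; apply: gM; apply: (lt_trans MN).
  near: t; have : (fun t : R => `|t|) @ s --> `|s| by exact: norm_continuous.
  by move=> /cvgr_gt; apply.
rewrite (_ : [set: _] = [set: R])//.
transitivity (\int[leb]_(s in `[(- N)%R, N]) (dg s)%:E)%E.
  rewrite [RHS]integral_mkcond; apply: eq_integral => s _.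
  rewrite patchE; case: ifPn => // /negP sN; rewrite dg0// ltNge.
  by apply/negP => h; apply: sN; rewrite inE/= in_itv/= -ler_norml.
rewrite (@continuous_FTC2 _ dg g)//.
- rewrite !gM ?subee// ?normrN ?gtr0_norm//.
- lra.
- exact: continuous_subspaceT.
- split; [by move=> x _; have [] := Hg x|..].
    by apply: cvg_at_right_filter; exact: cg.
  by apply: cvg_at_left_filter; exact: cg.
- by move=> x _; rewrite derive1E derive_val.
Unshelve. all: by end_near. Qed.

Lemma csupp_integrable n M (f : 'rV[R]_n -> R) : continuous f -> csupp M f ->
  (lebesgue_rV R n).-integrable setT (EFin \o f).
Proof.
move=> cf sf; have [K _ fK] := csupp_bounded cf sf.
by apply: (integrable_cube _ sf fK); exact: continuous_measurable_rV.
Qed.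

Lemma is_derive_shift (g : R -> R) (a dg : R) :
  is_derive (0 : R) (1 : R) (fun t => g (t + a)) dg -> is_derive a (1 : R) g dg.
Proof.
have E : (fun h : R => h^-1 *: (g (h *: (1 : R) + 0 + a) - g (0 + a))) =
    (fun h : R => h^-1 *: (g (h *: (1 : R) + a) - g a)).
  by apply/funext => h; rewrite addr0 add0r.
by move=> [H1 H2]; split; move: H1 H2; rewrite /derivable /derive E.
Qed.

Lemma is_derive_section0 n (G : 'rV[R]_n.+1 -> R) (y : 'rV[R]_n) (a : R) : C1 G ->
  is_derive a (1 : R) (fun a => G (rV_cons (a, y))) (partial ord0 G (rV_cons (a, y))).
Proof.
move=> cG; apply: is_derive_shift.
rewrite (_ : (fun t => _) = (fun t => G (t *: ebase ord0 + rV_cons (a, y)))).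
  apply/is_derive_line; rewrite scale0r add0r; exact: C1_is_derive.
by apply/funext => t; rewrite -rV_cons_scale0.
Qed.

Lemma cube_cons n M (a : R) (y : 'rV[R]_n) :
  cube n.+1 M (rV_cons (a, y)) <-> `|a| <= M /\ cube n M y.
Proof.
split=> [H|[H1 H2] i].
  split; first by have := H ord0; rewrite rV_consE0.
  by move=> i; have := H (lift ord0 i); rewrite rV_consES.
by case: (unliftP ord0 i) => [k ->|->]; rewrite ?rV_consES ?rV_consE0.
Qed.

(** Fubini's theorem in one of two orders: a derivative in the first coordinate is integrated
    innermost, by the fundamental theorem of calculus; any other one is a derivative of the slices,
    handled by induction on the dimension. *)
Lemma integral_partial_eq0 n M (G : 'rV[R]_n -> R) (i : 'I_n) :
  C1 G -> csupp M G -> (\int[lebesgue_rV R n]_x (partial i G x)%:E = 0)%E.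
Proof.
elim: n G i => [G []//|n IH G i cG sG].
have ipG : (lebesgue_rV R n.+1).-integrable setT (fun x => (partial i G x)%:E).
  by apply: (csupp_integrable (M := M)); [exact: C1_partial_continuous|exact: csupp_partial].
case: (unliftP ord0 i) ipG => [j ->|->] ipG.
  rewrite fubini_rV1//; apply: integral0_eq => a _.
  have [c1 c2] := C1_section1 a cG.
  under eq_integral do rewrite -c2.
  by apply: IH => // y yM; apply: sG => /cube_cons[].
rewrite fubini_rV2//; apply: integral0_eq => y _.
apply: (@integral_deriv_csupp (fun a => G (rV_cons (a, y))) _ M).
- by move=> s; exact: is_derive_section0.
- move=> s; apply: continuous_comp; first exact: continuous_rV_cons0.
  exact: C1_partial_continuous.
- by move=> s sM; apply: sG => /cube_cons[]; rewrite leNgt sM.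
Qed.

End ibp.

(** * A C^1 ramp *)

Section ramp.
Context {R : realType}.

(** Made for squared positive parts: their quadratic remainder bound holds uniformly across the
    kink, so no one-sided limits have to be compared. *)
Lemma is_derive_quadratic_error (g : R -> R) (x d C : R) : 0 < C ->
  (forall h, `|g (h + x) - g x - d * h| <= C * h ^+ 2) -> is_derive x (1 : R) g d.
Proof.
move=> C0 H.
have cv : (fun h => h^-1 *: (g (h *: (1 : R) + x) - g x)) @ 0^' --> d.
  apply/cvgrPdist_le => e e0; near=> h.
  have h0 : h != 0 by near: h; exact: nbhs_dnbhs_neq.
  have he : `|h| < e / C.
    near: h; apply: dnbhs0_lt; exact: divr_gt0.
  rewrite scaler1 distrC.
  have -> : h^-1 *: (g (h + x) - g x) - d = h^-1 * (g (h + x) - g x - d * h).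
    by rewrite /GRing.scale/=; field.
  rewrite normrM normfV ler_pdivrMl ?normr_gt0//.
  apply: (le_trans (H h)).
  rewrite -(ger0_norm (sqr_ge0 h)) normrX expr2 mulrCA ler_wpM2l//.
  by rewrite mulrC -ler_pdivlMr// ltW.
split; first by apply/cvg_ex; exists d.
exact/cvg_lim.
Unshelve. all: by end_near. Qed.

Definition posp (x : R) := Num.max x 0.

Lemma pospP x : (0 <= x /\ posp x = x) \/ (x <= 0 /\ posp x = 0).
Proof. by rewrite /posp; case: (leP x 0) => h; [right|left; rewrite ltW]. Qed.

Lemma is_derive_posp2 (x : R) : is_derive x (1 : R) (fun t => posp t ^+ 2) (2 * posp x).
Proof.
apply: (@is_derive_quadratic_error _ _ _ 1) => // h; rewrite mul1r.
rewrite ler_norml; apply/andP.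
have [[h1 ->]|[h1 ->]] := pospP x; have [[h2 ->]|[h2 ->]] := pospP (h + x); split; nra.
Qed.

(** Two parabolic arcs joining 0 to 1 over [[0, 1]]. The derivative is a tent with peak 2 at 1/2;
    this 2 is the factor that accompanies [level_mass] from here on. *)
Definition ramp (x : R) := 2 * posp x ^+ 2 - 4 * posp (x - 2^-1) ^+ 2 + 2 * posp (x - 1) ^+ 2.
Definition dramp (x : R) := 4 * posp x - 8 * posp (x - 2^-1) + 4 * posp (x - 1).

Lemma is_derive_ramp (x : R) : is_derive x (1 : R) ramp (dramp x).
Proof.
have sh (c : R) : is_derive x (1 : R) (fun t => posp (t - c) ^+ 2) (2 * posp (x - c)).
  apply: (@is_derive_quadratic_error _ _ _ 1) => // h; rewrite mul1r.
  have -> : h + x - c = h + (x - c) by rewrite addrA.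
  rewrite ler_norml; apply/andP; move: (x - c) => y.
  have [[h1 ->]|[h1 ->]] := pospP y; have [[h2 ->]|[h2 ->]] := pospP (h + y); split; nra.
have H := is_deriveD (is_deriveB (is_deriveZ 2 (is_derive_posp2 x))
   (is_deriveZ 4 (sh 2^-1))) (is_deriveZ 2 (sh 1)).
have -> : dramp x = 2 *: (2 * posp x) - 4 *: (2 * posp (x - 2^-1)) + 2 *: (2 * posp (x - 1)).
  by rewrite /dramp /GRing.scale/=; ring.
exact: H.
Qed.

Lemma continuous_posp : continuous posp.
Proof.
rewrite (_ : posp = fun x => (x + `|x|) * 2^-1).
  move=> x; apply: cvgM; last exact: cvg_cst.
  by apply: cvgD; [exact: cvg_id|exact: norm_continuous].
apply/funext => x; have [[h1 ->]|[h1 ->]] := pospP x.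
  by rewrite ger0_norm//; lra.
by rewrite ler0_norm//; lra.
Qed.

Lemma continuous_ramp : continuous ramp.
Proof.
by move=> z; apply: differentiable_continuous; apply/derivable1_diffP; have [] := is_derive_ramp z.
Qed.

Lemma continuous_dramp : continuous dramp.
Proof.
move=> x; apply: cvgD; first apply: cvgB; apply: cvgM; try exact: cvg_cst.
- exact: continuous_posp.
- apply: (@cvg_comp _ _ _ (fun t => t - 2^-1) posp); last exact: continuous_posp.
  by apply: cvgB; [exact: cvg_id|exact: cvg_cst].
- apply: (@cvg_comp _ _ _ (fun t => t - 1) posp); last exact: continuous_posp.
  by apply: cvgB; [exact: cvg_id|exact: cvg_cst].
Qed.

Lemma ramp_le0 x : x <= 0 -> ramp x = 0.
Proof.
rewrite /ramp; have [[h1 ->]|[h1 ->]] := pospP x; have [[h2 ->]|[h2 ->]] := pospP (x - 2^-1);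
have [[h3 ->]|[h3 ->]] := pospP (x - 1) => h4; nra.
Qed.

Lemma ramp_ge1 x : 1 <= x -> ramp x = 1.
Proof.
rewrite /ramp; have [[h1 ->]|[h1 ->]] := pospP x; have [[h2 ->]|[h2 ->]] := pospP (x - 2^-1);
have [[h3 ->]|[h3 ->]] := pospP (x - 1) => h4; try nra; try lra.
Qed.

Lemma ramp_ge0 x : 0 <= ramp x.
Proof.
rewrite /ramp; have [[h1 ->]|[h1 ->]] := pospP x; have [[h2 ->]|[h2 ->]] := pospP (x - 2^-1);
have [[h3 ->]|[h3 ->]] := pospP (x - 1); nra.
Qed.

Lemma ramp_le1 x : ramp x <= 1.
Proof.
rewrite /ramp; have [[h1 ->]|[h1 ->]] := pospP x; have [[h2 ->]|[h2 ->]] := pospP (x - 2^-1);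
have [[h3 ->]|[h3 ->]] := pospP (x - 1); nra.
Qed.

Lemma dramp_ge0 x : 0 <= dramp x.
Proof.
rewrite /dramp; have [[h1 ->]|[h1 ->]] := pospP x; have [[h2 ->]|[h2 ->]] := pospP (x - 2^-1);
have [[h3 ->]|[h3 ->]] := pospP (x - 1); lra.
Qed.

Lemma dramp_le2 x : dramp x <= 2.
Proof.
rewrite /dramp; have [[h1 ->]|[h1 ->]] := pospP x; have [[h2 ->]|[h2 ->]] := pospP (x - 2^-1);
have [[h3 ->]|[h3 ->]] := pospP (x - 1); lra.
Qed.

Lemma dramp_eq0 x : ~~ (0 < x < 1) -> dramp x = 0.
Proof.
rewrite negb_and -!leNgt => /orP; rewrite /dramp; have [[h1 ->]|[h1 ->]] := pospP x;
have [[h2 ->]|[h2 ->]] := pospP (x - 2^-1);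
have [[h3 ->]|[h3 ->]] := pospP (x - 1); case; lra.
Qed.

Lemma ramp_nd (x y : R) : x <= y -> ramp x <= ramp y.
Proof.
move=> xy; have [c _ E] := @MVT_segment R ramp dramp x y xy
   (fun z _ => is_derive_ramp z) (continuous_subspaceT continuous_ramp).
by rewrite -subr_ge0 E mulr_ge0 ?dramp_ge0// subr_ge0.
Qed.

End ramp.

(** * Perimeter bounds from approximations of indicators *)

Section perimeter_bound.
Context {R : realType}.
Local Notation mu := (lebesgue_rV R).

Definition l1grad n (g : 'rV[R]_n -> R) (x : 'rV[R]_n) : R :=
  \sum_(i < n) `|partial i g x|.

Lemma l1grad_ge0 n (g : 'rV[R]_n -> R) x : 0 <= l1grad g x.
Proof. by apply: sumr_ge0 => i _. Qed.

Lemma continuous_sum n (I : Type) (r : seq I) (P : pred I) (h : I -> 'rV[R]_n -> R) :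
  (forall i, continuous (h i)) -> continuous (fun x => \sum_(i <- r | P i) h i x).
Proof.
move=> ch; elim: r => [|i r IH].
  under eq_fun do rewrite big_nil; exact: cst_continuous.
under eq_fun do rewrite big_cons; case: (P i) => //.
exact: continuousD_R.
Qed.

Lemma continuous_l1grad n (g : 'rV[R]_n -> R) : C1 g -> continuous (l1grad g).
Proof.
move=> cg; apply: continuous_sum => i x.
apply: (@continuous_comp _ _ _ (partial i g)); last exact: norm_continuous.
exact: C1_partial_continuous.
Qed.

Lemma measurable_l1grad n (g : 'rV[R]_n -> R) : C1 g ->
  measurable_fun setT (fun x => (l1grad g x)%:E).
Proof.
move=> cg; apply: measurable_EFin_comp; apply: continuous_measurable_rV.
exact: continuous_l1grad.
Qed.

Lemma coord_le_enorm n (v : 'rV[R]_n) i : `|v ord0 i| <= enorm v.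
Proof.
rewrite /enorm -sqrtr_sqr ler_sqrt.
  by rewrite (bigD1 i)//= lerDl; apply: sumr_ge0 => j _; exact: sqr_ge0.
by apply: sumr_ge0 => j _; exact: sqr_ge0.
Qed.

Lemma coord_le_norm n (v : 'rV[R]_n) i : `|v ord0 i| <= `|v|.
Proof.
rewrite [leRHS](mx_normrE v).
by apply: (le_bigmax_cond 0 (fun ij : 'I_1 * 'I_n => `|v ij.1 ij.2|) (j := (ord0, i))).
Qed.

Lemma compact_supp_csupp n (phi : 'rV[R]_n -> 'rV[R]_n) : compact (supp phi) ->
  exists M, forall i, csupp M (fun x => phi x ord0 i).
Proof.
move=> /compact_bounded[K [Kr KH]]; exists (`|K| + 1) => i x xM.
have [->|phix] := eqVneq (phi x) 0; first by rewrite mxE.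
exfalso; apply: xM => j; apply: (le_trans (coord_le_norm _ _)).
apply: (KH (`|K| + 1)); first by rewrite (le_lt_trans (ler_norm _))// ltrDl.
exact: subset_closure.
Qed.

Lemma continuous_divergence n (phi : 'rV[R]_n -> 'rV[R]_n) :
  (forall i, C1 (fun x => phi x ord0 i)) -> continuous (divergence phi).
Proof.
move=> cp; apply: (@continuous_sum n _ _ _ (fun i x => partial i (fun y => phi y ord0 i) x)) => i.
exact: C1_partial_continuous.
Qed.

Lemma csupp_sum n M (I : Type) (r : seq I) (P : pred I) (h : I -> 'rV[R]_n -> R) :
  (forall i, csupp M (h i)) -> csupp M (fun x => \sum_(i <- r | P i) h i x).
Proof. by move=> sh x xM; apply: big1 => i _; exact: sh. Qed.

Lemma csuppM n M (f g : 'rV[R]_n -> R) : csupp M g -> csupp M (fun x => f x * g x).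
Proof. by move=> sg x xM; rewrite sg// mulr0. Qed.

Lemma csupp_divergence n M (phi : 'rV[R]_n -> 'rV[R]_n) :
  (forall i, csupp M (fun x => phi x ord0 i)) -> csupp M (divergence phi).
Proof.
move=> sp; apply: (@csupp_sum n M _ _ _ (fun i x => partial i (fun y => phi y ord0 i) x)) => i.
exact: csupp_partial.
Qed.

(** Integration by parts. Only the field has compact support, which suffices because each product
    [g phi_i] then has it too; [|phi_i| <= |phi| <= 1] leaves the l1 norm of the gradient. *)
Lemma integral_mul_divergence_le n M (g : 'rV[R]_n -> R) (phi : 'rV[R]_n -> 'rV[R]_n) :
  C1 g -> (forall i, C1 (fun x => phi x ord0 i)) ->
  (forall i, csupp M (fun x => phi x ord0 i)) -> (forall x, enorm (phi x) <= 1) ->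
  (\int[mu n]_x (g x * divergence phi x)%:E <= \int[mu n]_x (l1grad g x)%:E)%E.
Proof.
move=> cg cp sp p1.
pose w x := \sum_(i < n) partial i g x * phi x ord0 i.
have cw : continuous w.
  apply: (@continuous_sum n _ _ _ (fun i x => partial i g x * phi x ord0 i)) => i.
  by apply: continuousM_R; [exact: C1_partial_continuous|exact: C1_continuous].
have sw : csupp M w.
  apply: (@csupp_sum n M _ _ _ (fun i x => partial i g x * phi x ord0 i)) => i.
  exact: csuppM.
pose h i x := partial i (fun y => g y * phi y ord0 i) x.
have hE x : g x * divergence phi x = \sum_(i < n) h i x - w x.
  rewrite /w -sumrB /divergence mulr_sumr; apply: eq_bigr => i _.
  have [_ E] := C1M cg (cp i); rewrite /h E; ring.
have ih i : (mu n).-integrable setT (fun x => (h i x)%:E).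
  have [c _] := C1M cg (cp i).
  apply: (csupp_integrable (M := M)); first exact: C1_partial_continuous.
  by apply: csupp_partial; exact: csuppM.
have iw : (mu n).-integrable setT (fun x => (w x)%:E).
  exact: (csupp_integrable (M := M)).
have : (\int[mu n]_x (g x * divergence phi x)%:E = - \int[mu n]_x (w x)%:E)%E.
  under eq_integral do rewrite hE EFinB.
  have isum : (mu n).-integrable setT (fun x => (\sum_(i < n) h i x)%:E).
    apply: (csupp_integrable (M := M)).
      apply: continuous_sum => i; have [c _] := C1M cg (cp i); exact: C1_partial_continuous.
    by apply: csupp_sum => i; apply: csupp_partial; exact: csuppM.
  rewrite integralB//.
  under eq_integral do rewrite -sumEFin.
  rewrite integral_sum//.
  rewrite big1 ?sub0e// => i _; have [c _] := C1M cg (cp i).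
  by apply: (integral_partial_eq0 (M := M) i c); exact: csuppM.
move=> ->.
set W := (\int[mu n]_x (w x)%:E)%E.
apply: (@le_trans _ _ `|W|%E); first by rewrite -abseN lee_abs.
have mw : measurable_fun setT (fun x => (w x)%:E) by case/integrableP : iw.
apply: (le_trans (le_abse_integral _ measurableT mw)).
apply: ge0_le_integral => //.
- exact: measurableT_comp.
- exact: measurable_l1grad.
- move=> x _; rewrite lee_fin; apply: (le_trans (ler_norm_sum _ _ _)).
  apply: ler_sum => i _; rewrite normrM ler_piMr//.
  exact: le_trans (coord_le_enorm _ _) (p1 x).
Qed.

Lemma cvg_sum_real (I : Type) (r : seq I) (P : pred I) (u : I -> nat -> R) (l : I -> R) :
  (forall i, u i m @[m --> \oo] --> l i) ->
  (\sum_(i <- r | P i) u i m) @[m --> \oo] --> \sum_(i <- r | P i) l i.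
Proof.
move=> H; elim: r => [|i r IH].
  by rewrite big_nil; under eq_fun do rewrite big_nil; exact: cvg_cst.
rewrite big_cons; under eq_fun do rewrite big_cons.
by case: (P i) => //; apply: cvgD => //; exact: H.
Qed.

(* Test the perimeters against fields phi_i: [\int g_i div phi_i] is at most the
   total variation of g_i and tends to [\int_(E_i) div phi_i]. *)
Lemma perimeter_family_le n (I : finType) (E : I -> set 'rV[R]_n)
    (g : I -> nat -> 'rV[R]_n -> R) (B : R) (theta : I -> R) :
  (forall i, measurable (E i)) -> (forall i m, C1 (g i m)) ->
  (forall i m x, 0 <= g i m x <= 1) ->
  (forall i x, g i m x @[m --> \oo] --> (\1_(E i) x : R)) ->
  (forall N, exists2 m, (N <= m)%N &
    (\sum_(i : I) \int[mu n]_x (l1grad (g i m) x)%:E <= B%:E)%E) ->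
  (forall i, (theta i)%:E * mu n (E i) = 0 \/ (theta i)%:E * mu n (E i) < perimeter (E i))%E ->
  (\sum_(i : I) (theta i)%:E * mu n (E i) <= B%:E)%E.
Proof.
move=> mE cg g01 gE gB Hth.
have : forall i, exists phi : 'rV[R]_n -> 'rV[R]_n,
    [/\ forall j, C1 (fun x => phi x ord0 j), exists M, forall j, csupp M (fun x => phi x ord0 j),
     forall x, enorm (phi x) <= 1 &
     ((theta i)%:E * mu n (E i) <= \int[mu n]_(x in E i) (divergence phi x)%:E)%E].
  (* The zero field serves in the first alternative; in the second, the strict inequality lets a
     single field beat [theta i] times the volume. *)
  move=> i; have [->|] := Hth i.
    exists (fun=> 0); split.
    - move=> j; rewrite (_ : (fun _ => _) = fun=> 0); first by have [] := @C1_cst R n 0.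
      by apply/funext => x; rewrite mxE.
    - by exists 0 => j x _; rewrite mxE.
    - by move=> x; rewrite /enorm big1 ?sqrtr0// => j _; rewrite mxE expr0n.
    - rewrite integral0_eq// => x _; rewrite /divergence big1// => j _.
      rewrite (_ : (fun _ => _) = fun=> 0); first by have [_ ->] := @C1_cst R n 0.
      by apply/funext => y; rewrite mxE.
  move=> /ereal_sup_gt[_ [phi [p1 p2 p3] <-] /ltW ple].
  by exists phi; split => //; exact: compact_supp_csupp.
move=> /choice[phi /all_and4[cphi /choice[M sphi] phi1 phiE]].
pose a i m := (\int[mu n]_x (g i m x * divergence (phi i) x)%:E)%E.
pose D i := (\int[mu n]_(x in E i) (divergence (phi i) x)%:E)%E.
have cdiv i : continuous (divergence (phi i)) by exact: continuous_divergence.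
have sdiv i : csupp (M i) (divergence (phi i)) by exact: csupp_divergence.
have idiv i : (mu n).-integrable setT (fun x => (divergence (phi i) x)%:E).
  exact: (csupp_integrable (M := M i)).
have iab i : (mu n).-integrable setT (fun x => (`|divergence (phi i) x|)%:E).
  by have := integrable_abse (idiv i).
have DE i : D i = (\int[mu n]_x (\1_(E i) x * divergence (phi i) x)%:E)%E.
  rewrite /D integral_mkcond; apply: eq_integral => x _.
  by rewrite patchE indicE; case: ifPn => _ /=; rewrite ?mul1r ?mul0r.
have aD i : a i m @[m --> \oo] --> D i.
  rewrite DE; apply: (@dominated_cvg _ _ _ _ _ _ _ _ (fun x => (`|divergence (phi i) x|)%:E)) => //.
  - move=> m; apply: measurable_EFin_comp; apply: continuous_measurable_rV.
    by apply: continuousM_R => //; exact: C1_continuous.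
  - move=> x _; apply/fine_cvgP; split; first by near=> m.
    by apply: cvgM; [exact: gE|exact: cvg_cst].
  - move=> m x _; rewrite /= lee_fin normrM ler_piMl//.
    by have /andP[g0 g1] := g01 i m x; rewrite ger0_norm.
have ale i m : (a i m <= \int[mu n]_x (l1grad (g i m) x)%:E)%E.
  exact: (integral_mul_divergence_le (M := M i)).
have Dfin i : D i \is a fin_num.
  by apply: integrable_fin_num => //; apply: integrableS (idiv i).
have aDr i : fine (a i m) @[m --> \oo] --> fine (D i).
  by have /fine_cvgP[] : a i m @[m --> \oo] --> (fine (D i))%:E by rewrite fineK.
have afin i m : a i m \is a fin_num.
  apply: integrable_fin_num => //; apply: (le_integrable measurableT _ _ (idiv i)).
  - apply: measurable_EFin_comp; apply: continuous_measurable_rV.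
    by apply: continuousM_R => //; exact: C1_continuous.
  - move=> x _; rewrite /= lee_fin normrM ler_piMl//.
    by have /andP[g0 g1] := g01 i m x; rewrite ger0_norm.
apply: (@le_trans _ _ (\sum_(i : I) D i)%E); first by apply: lee_sum => i _; exact: phiE.
have -> : (\sum_(i : I) D i)%E = (\sum_(i : I) fine (D i))%:E.
  by rewrite -sumEFin; apply: eq_bigr => i _; rewrite fineK.
(* If the limit exceeded [B], so would all late terms, whereas [gB] supplies arbitrarily late ones
   that do not. A bound along a subsequence is therefore enough. *)
rewrite lee_fin leNgt; apply/negP => BD.
have := @cvg_sum_real I (index_enum I) xpredT _ _ aDr.
move=> /cvgr_gt/(_ _ BD)[N _ HN].
have [m Nm] := gB N; rewrite leNgt => /negP; apply.
have := HN m Nm; rewrite /= -lte_fin => /lt_le_trans; apply.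
by rewrite -sumEFin; apply: lee_sum => i _; rewrite fineK.
Unshelve. all: by end_near. Qed.

End perimeter_bound.

(** * A coarea inequality *)

Section liminf.
Context {R : realType}.
Local Open Scope ereal_scope.

Lemma limn_einf_sup_einfs (u : (\bar R)^nat) : limn_einf u = ereal_sup (range (einfs u)).
Proof. by rewrite limn_einf_lim; apply/cvg_lim => //; exact: cvg_einfs_sup. Qed.

Lemma limn_einf_ge_eventually (u : (\bar R)^nat) (a : R) :
  (forall b : R, (b < a)%R -> exists N, forall m, (N <= m)%N -> b%:E <= u m) ->
  a%:E <= limn_einf u.
Proof.
move=> H; apply/lee_addgt0Pr => e e0.
have [|N HN] := H (a - e)%R; first by rewrite ltrBlDr ltrDl.
rewrite -leeBlDr// -EFinB limn_einf_sup_einfs.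
apply: (@le_trans _ _ (einfs u N)); last by apply: ereal_sup_ubound; exists N.
by apply: le_ereal_inf_tmp => _ [m /= Nm <-]; exact: HN.
Qed.

Lemma limn_einf_le_bound (u : (\bar R)^nat) (c : \bar R) :
  (forall m, u m <= c) -> limn_einf u <= c.
Proof.
move=> H; rewrite limn_einf_sup_einfs; apply: ge_ereal_sup => _ [m _ <-].
by apply: (le_trans _ (H m)); apply: ereal_inf_lbound; exists m => /=.
Qed.

Lemma measurable_limn_einf d (T : measurableType d) (D : set T) (f : (T -> \bar R)^nat) :
  (forall m, measurable_fun D (f m)) ->
  measurable_fun D (fun x => limn_einf (f ^~ x)).
Proof.
move=> mf; rewrite (_ : (fun x => _) = (fun x => - limn_esup ((fun m x => - f m x) ^~ x)))//.
apply: measurableT_comp => //.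
by apply: measurable_fun_limn_esup => m; exact: measurableT_comp.
Qed.

End liminf.

Lemma ge0_integralZ_real d (T : measurableType d) (R : realType)
    (mu : {measure set T -> \bar R}) (k : R) (f : T -> R) :
  0 <= k -> measurable_fun setT f -> (forall x, 0 <= f x) ->
  (\int[mu]_x (k * f x)%:E = k%:E * \int[mu]_x (f x)%:E)%E.
Proof.
move=> k0 mf f0; rewrite -ge0_integralZl//.
  exact: measurable_EFin_comp.
by move=> x _; rewrite lee_fin.
Qed.

Lemma le_integral_pos d (T : measurableType d) (R : realType)
    (mu : {measure set T -> \bar R}) (f g : T -> \bar R) :
  measurable_fun setT f -> measurable_fun setT g -> (forall x, 0 <= f x)%E ->
  (forall x, f x <= g x)%E -> (\int[mu]_x f x <= \int[mu]_x g x)%E.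
Proof. by move=> mf mg f0 fg; apply: ge0_le_integral. Qed.

Lemma measure_cover_le d (T : measurableType d) (R : realType)
    (mu : {measure set T -> \bar R}) (I : finType) (A : set T) (B : I -> set T) :
  measurable A -> (forall i, measurable (B i)) -> A `<=` \bigcup_i B i ->
  (mu A <= \sum_i mu (B i))%E.
Proof.
move=> mA mB AB.
rewrite -integral_indicT// (eq_bigr (fun i => \int[mu]_x (\1_(B i) x)%:E)%E);
  last by move=> i _; rewrite integral_indicT.
rewrite -ge0_integral_sum//; last first.
  by move=> i; apply: measurable_EFin_comp; exact: measurable_indic.
apply: le_integral_pos => [||x|x].
- by apply: measurable_EFin_comp; exact: measurable_indic.
- by apply: emeasurable_sum => i; apply: measurable_EFin_comp; exact: measurable_indic.
- by rewrite lee_fin.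
- rewrite sumEFin lee_fin [leLHS]indicE; have [/set_mem/AB[i _ xi]|_] := boolP (x \in _).
    by rewrite (bigD1 i)//= indicE mem_set// lerDl sumr_ge0.
  by rewrite sumr_ge0.
Qed.

Lemma measurable_powR_comp d (T : measurableType d) (R : realType) (D : set T) (f : T -> R) p :
  measurable_fun D f -> measurable_fun D (fun x => f x `^ p).
Proof. exact: (measurableT_comp (measurable_powR p)). Qed.

Lemma integral_indic_itv_oo (R : realType) (a b : R) : a <= b ->
  (\int[@lebesgue_measure R]_t (\1_(`]a, b[%classic) t)%:E = (b - a)%:E)%E.
Proof.
move=> ab; rewrite integral_indicT; last exact: measurable_itv.
have := @lebesgue_measure_itv R `]a, b[; rewrite /= lte_fin.
move: ab; rewrite le_eqVlt => /predU1P[->|ab]; first by rewrite ltxx subrr.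
by rewrite ab EFinB.
Qed.

Lemma measurable_lt_set {R : realType} d (T : measurableType d) (f g : T -> R) :
  measurable_fun setT f -> measurable_fun setT g -> measurable [set x | f x < g x].
Proof.
move=> mf mg; have := measurable_fun_ltr mf mg.
move=> /(_ measurableT [set true] I).
by rewrite setTI (_ : _ @^-1` _ = [set x | f x < g x]).
Qed.

Section coarea.
Context {R : realType}.
Local Notation mu := (lebesgue_rV R).
Local Notation leb := (@lebesgue_measure R).

Definition superlevel n (F : 'rV[R]_n -> R) (t : R) := [set x | t < F x].

Definition level_slab n (F : 'rV[R]_n -> R) (t : R) (m : nat) :=
  [set x | t < F x < t + m.+1%:R^-1].

(** Essentially the difference quotient at [t], with step [1/(m+1)], of the integral of the l1
    gradient over [{F <= t}], whose derivative is the perimeter of [{F > t}] in the coarea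
    formula. *)
Definition level_mass n (F : 'rV[R]_n -> R) (t : R) (m : nat) : \bar R :=
  (\int[mu n]_x (m.+1%:R * \1_(level_slab F t m) x * l1grad F x)%:E)%E.

Variables (n : nat) (F : 'rV[R]_n -> R) (tau p theta : R).
Hypotheses (cF : C1 F) (tau0 : 0 < tau) (p1 : 1 < p) (theta0 : 0 <= theta).
Hypothesis fin : forall t, tau < t -> (mu n (superlevel F t) < +oo)%E.
Hypothesis Hae : {ae leb, forall t, tau < t -> forall b : R,
  (b%:E < theta%:E * mu n (superlevel F t))%E ->
  exists N, forall m, (N <= m)%N -> (b%:E <= 2%:E * level_mass F t m)%E}.

(** The density of [t^p / p], cut off at [tau] because slowness and finite volume are assumed only
    for the levels above. *)
Let w (t : R) : R := \1_(`]tau, +oo[%classic) t * t `^ (p - 1).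

Let w0 t : 0 <= w t. Proof. by rewrite /w mulr_ge0// powR_ge0. Qed.

Let mw : measurable_fun setT w.
Proof. by apply: measurable_funM => //; exact: measurable_powR. Qed.

Let mF : measurable_fun setT F.
Proof. by apply: continuous_measurable_rV; exact: C1_continuous. Qed.

Let mFt t : measurable (superlevel F t).
Proof. by apply: measurable_lt_set => //; exact: measurable_cst. Qed.

Let mslab t m : measurable (level_slab F t m).
Proof.
rewrite (_ : level_slab F t m = [set x | t < F x] `&` [set x | F x < t + m.+1%:R^-1]).
  by apply: measurableI => //; apply: measurable_lt_set => //; exact: measurable_cst.
by apply/seteqP; split => x; rewrite /level_slab/= => /andP.
Qed.

Let Fz : measurable_fun [set: measurableTypeR R * 'rV[R]_n] (fun z => F z.2).
Proof. by apply: measurableT_comp => //; exact: measurable_snd. Qed.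

Let fz : measurable_fun [set: measurableTypeR R * 'rV[R]_n] (fun z => z.1 : R).
Proof. exact: measurable_fst. Qed.

Let A0 := [set z : measurableTypeR R * 'rV[R]_n | z.1 < F z.2].
Let mA0 : measurable A0. Proof. exact: measurable_lt_set. Qed.

Let A m := [set z : measurableTypeR R * 'rV[R]_n | z.1 < F z.2 < z.1 + m.+1%:R^-1].
Let mA m : measurable (A m).
Proof.
rewrite (_ : A m = A0 `&` [set z | F z.2 < z.1 + m.+1%:R^-1]).
  by apply: measurableI => //; apply: measurable_lt_set => //; exact: measurable_funD.
by apply/seteqP; split => x; rewrite /A/= => /andP.
Qed.

Let f0 (z : measurableTypeR R * 'rV[R]_n) : \bar R := (theta * w z.1 * \1_A0 z)%:E.
Let mf0 : measurable_fun setT f0.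
Proof.
apply: measurable_EFin_comp; apply: measurable_funM => //.
by apply: measurable_funM => //; apply: measurableT_comp.
Qed.
Let f00 z : (0 <= f0 z)%E.
Proof. by rewrite lee_fin !mulr_ge0// powR_ge0. Qed.

Let f m (z : measurableTypeR R * 'rV[R]_n) : \bar R :=
  (2 * w z.1 * (m.+1%:R * \1_(A m) z * l1grad F z.2))%:E.
Let mf m : measurable_fun setT (f m).
Proof.
apply: measurable_EFin_comp; apply: measurable_funM => //.
  by apply: measurable_funM => //; apply: measurableT_comp.
apply: measurable_funM; first exact: measurable_funM.
apply: (measurableT_comp (f := l1grad F)) => //.
by apply: continuous_measurable_rV; exact: continuous_l1grad.
Qed.
Let f_ge0 m z : (0 <= f m z)%E.
Proof. by rewrite lee_fin !mulr_ge0// ?powR_ge0 ?l1grad_ge0. Qed.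

Let intA0 t : (\int[mu n]_x f0 (t, x) = (theta * w t)%:E * mu n (superlevel F t))%E.
Proof.
rewrite -integral_indicT// -ge0_integralZ_real//; first by rewrite mulr_ge0 ?w0.
Qed.

Let intA m t : (\int[mu n]_x f m (t, x) = (w t)%:E * (2%:E * level_mass F t m))%E.
Proof.
rewrite muleA -EFinM /level_mass -ge0_integralZ_real//.
- by apply: eq_integral => x _; rewrite /f; congr (_%:E); rewrite [2 * w _]mulrC.
- by rewrite mulr_ge0 ?w0.
- apply: measurable_funM; first exact: measurable_funM.
  by apply: continuous_measurable_rV; exact: continuous_l1grad.
- by move=> x; rewrite !mulr_ge0// l1grad_ge0.
Qed.

Let f_ge0i m t : (0 <= \int[mu n]_x f m (t, x))%E.
Proof. by apply: integral_ge0 => x _; exact: f_ge0. Qed.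

Let f0_ge0i t : (0 <= \int[mu n]_x f0 (t, x))%E.
Proof. by apply: integral_ge0 => x _; exact: f00. Qed.

Let f_ge0j m x : (0 <= \int[leb]_t f m (t, x))%E.
Proof. by apply: integral_ge0 => t _; exact: f_ge0. Qed.

Let f0_ge0j x : (0 <= \int[leb]_t f0 (t, x))%E.
Proof. by apply: integral_ge0 => t _; exact: f00. Qed.

(** For almost every [t > tau], [Hae] says that the left inner integral is at most the lower limit
    of the right ones; for [t <= tau] the weight vanishes. Fatou's lemma then exchanges the lower
    limit with the integral in t. *)
Lemma coarea_fatou : (\int[leb]_t \int[mu n]_x f0 (t, x) <=
  limn_einf (fun m => \int[leb]_t \int[mu n]_x f m (t, x)))%E.
Proof.
have mI m : measurable_fun setT (fun t => \int[mu n]_x f m (t, x))%E.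
  by have := @measurable_fun_fubini_tonelli_F _ _ _ _ _ (mu n) (f m) (mf m) (f_ge0 m).
apply: (le_trans _ (fatou leb measurableT mI _)); last first.
  by move=> m t _; exact: f_ge0i.
apply: ae_ge0_le_integral => //.
- exact: (@measurable_fun_fubini_tonelli_F _ _ _ _ _ (mu n) f0 mf0 f00).
- move=> t _; apply: (le_trans _ (@limn_einf_ge_eventually R _ 0 _)) => // b b0.
  exists 0 => m _; apply: (@le_trans _ _ 0%E); first by rewrite lee_fin ltW.
  exact: f_ge0i.
- exact: measurable_limn_einf.
apply: (@filterS _ _ (ae_filter_ringOfSetsType _)) Hae => t Ht _; rewrite intA0.
have [taut|ttau] := ltP tau t; last first.
  rewrite /w indicE memNset ?mul0r ?mulr0 ?mul0e; last by rewrite /= in_itv/= andbT ltNge ttau.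
  apply: (le_trans _ (@limn_einf_ge_eventually R _ 0 _)) => // b b0.
  exists 0 => m _; apply: (@le_trans _ _ 0%E); first by rewrite lee_fin ltW.
  exact: f_ge0i.
have Vfin : mu n (superlevel F t) \is a fin_num by rewrite ge0_fin_numE//; exact: fin.
have wt : 0 < w t.
  by rewrite /w indicE mem_set ?mul1r ?powR_gt0 ?(lt_trans tau0)//= in_itv/= andbT.
move: (Ht taut); rewrite -(fineK Vfin); set V := fine _ => {}Ht.
rewrite -EFinM; apply: limn_einf_ge_eventually => b bV.
(* The weight is positive here, so a number below [theta w(t) V] becomes one below [theta V] after
   division by it. *)
have [|N HN] := Ht (b / w t).
  by rewrite -EFinM lte_fin ltr_pdivrMr// mulrAC.
exists N => m Nm; rewrite intA.
have -> : b%:E = ((w t)%:E * (b / w t)%:E)%E.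
  by rewrite -EFinM mulrCA divff ?mulr1// gt_eqF.
by rewrite lee_pmul2l ?lte_fin//; exact: HN.
Qed.

(** For fixed [x], the levels whose slab contains [x] form an interval of length [1/(m+1)] ending at
    [F x]. The weight is at most [F(x)^(p-1)] there, and the length cancels the factor [m+1]. *)
Let inner_le m x : (\int[leb]_t f m (t, x) <=
   (2 * (\1_[set x | tau < F x] x * (l1grad F x * (F x) `^ (p - 1))))%:E)%E.
Proof.
have [Fx|Fx] := ltP tau (F x); last first.
  rewrite integral0_eq; first by rewrite lee_fin !mulr_ge0 ?l1grad_ge0 ?powR_ge0.
  move=> t _; rewrite /f /w !indicE/=.
  have [|] := ltP tau t => ht; last first.
    by rewrite memNset ?mul0r ?mulr0 ?mul0r//= in_itv/= andbT ltNge ht.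
  rewrite [X in _ * (_ * X * _)](_ : _ = 0) ?mulr0 ?mul0r ?mulr0//.
  by rewrite memNset//= => /andP[h _]; move: (lt_trans ht h); rewrite ltNge Fx.
rewrite indicE mem_set// mul1r.
pose I := `]F x - m.+1%:R^-1, F x[%classic : set R.
apply: (@le_trans _ _ (\int[leb]_t ((2 * (F x) `^ (p - 1) * (m.+1%:R * l1grad F x)) * \1_I t)%:E)%E).
  apply: le_integral_pos => [||t|t].
  - exact: (measurableT_comp (mf m) (pair2_measurable x)).
  - apply: measurable_EFin_comp; apply: measurable_funM => //.
    by apply: measurable_indic; exact: measurable_itv.
  - exact: f_ge0.
  - rewrite /f lee_fin !indicE/=.
    have [tA|tA] := boolP ((t, x) \in A m); last first.
      by rewrite mulr0 mul0r mulr0 !mulr_ge0 ?powR_ge0 ?l1grad_ge0.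
    move: tA => /set_mem; rewrite /A/= => /andP[tF Ft].
    rewrite (_ : t \in I); last by apply/mem_set; rewrite /I/= in_itv/= tF ltrBlDr Ft.
    rewrite !mulr1 ler_wpM2r ?mulr_ge0 ?l1grad_ge0// ler_wpM2l//.
    rewrite /w indicE; have [ht|ht] := ltP tau t; last first.
      by rewrite memNset ?mul0r ?powR_ge0//= in_itv/= andbT ltNge ht.
    rewrite mem_set ?mul1r/= ?in_itv/= ?andbT//.
    apply: ge0_ler_powR; rewrite ?nnegrE ?subr_ge0 ?(ltW p1) ?(ltW tF)//.
      exact: ltW (lt_trans tau0 ht).
    exact: ltW (lt_trans tau0 Fx).
rewrite ge0_integralZ_real//; first last.
- by apply: measurable_indic; exact: measurable_itv.
- by rewrite !mulr_ge0 ?powR_ge0 ?l1grad_ge0.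
rewrite integral_indic_itv_oo ?lerBlDr ?lerDl// -EFinM lee_fin le_eqVlt; apply/orP; left; apply/eqP.
have m0 : m.+1%:R != 0 :> R by rewrite pnatr_eq0.
by rewrite opprB addrCA subrr addr0; move: m0; move: (m.+1%:R) => k k0; field.
Qed.

(** Only the levels between [F x / 2] and [F x] are kept. They exceed [tau] because [2 tau < F x],
    and the weight there is at least [(F x / 2)^(p-1)]. *)
Let inner_ge x : 2 * tau < F x ->
  ((theta * (F x / 2) `^ p)%:E <= \int[leb]_t f0 (t, x))%E.
Proof.
move=> Fx; have t0 := tau0; pose I := `]F x / 2, F x[%classic : set R.
apply: (@le_trans _ _ (\int[leb]_t (((theta * (F x / 2) `^ (p - 1)) * \1_I t)%:E))%E).
  rewrite ge0_integralZ_real//; first last.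
  - by apply: measurable_indic; exact: measurable_itv.
  - by rewrite !mulr_ge0 ?powR_ge0.
  rewrite integral_indic_itv_oo; last by lra.
  rewrite -EFinM lee_fin -mulrA ler_wpM2l//.
  have -> : F x - F x / 2 = F x / 2 by lra.
  have F2 : 0 < F x / 2 by lra.
  have -> : (F x / 2) `^ p = (F x / 2) `^ (p - 1) * (F x / 2) `^ 1.
    rewrite -powRD ?subrK//; apply/implyP => _; exact: lt0r_neq0.
  by rewrite (powRr1 (ltW F2)).
apply: le_integral_pos => [||t|t].
- apply: measurable_EFin_comp; apply: measurable_funM => //.
  by apply: measurable_indic; exact: measurable_itv.
- exact: (measurableT_comp mf0 (pair2_measurable x)).
- by rewrite lee_fin !mulr_ge0 ?powR_ge0.
- rewrite /f0 lee_fin !indicE/=.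
  have [tI|tI] := boolP (t \in I); last by rewrite mulr0 !mulr_ge0 ?powR_ge0.
  move: tI => /set_mem; rewrite /I/= in_itv/= => /andP[t1 t2].
  rewrite (_ : (t, x) \in A0); last exact/mem_set.
  rewrite !mulr1 ler_wpM2l// /w indicE mem_set ?mul1r; last first.
    rewrite /= in_itv/= andbT; apply: lt_trans t1; lra.
  have F2 : 0 <= F x / 2 by lra.
  by apply: ge0_ler_powR; rewrite ?nnegrE ?subr_ge0 ?(ltW p1) ?(ltW t1)// (le_trans F2)// ltW.
Qed.

Lemma coarea_weighted :
  (\int[mu n]_(x in [set x | (2 * tau < F x)%R]) (theta * (F x / 2) `^ p)%:E <=
   \int[mu n]_(x in [set x | (tau < F x)%R]) (2 * (l1grad F x * (F x) `^ (p - 1)))%:E)%E.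
Proof.
apply: (@le_trans _ _ (\int[mu n]_x \int[leb]_t f0 (t, x))%E).
  rewrite integral_mkcond; apply: le_integral_pos => [||x|x].
  - apply/(measurable_restrictT _ _).1; first by apply: measurable_lt_set => //; exact: measurable_cst.
    apply: measurable_EFin_comp; apply: measurable_funTS; apply: measurable_funM => //.
    by apply: measurable_powR_comp; exact: measurable_funM.
  - exact: (@measurable_fun_fubini_tonelli_G _ _ _ _ _ leb f0 mf0 f00).
  - by rewrite patchE; case: ifPn => // _; rewrite lee_fin mulr_ge0// powR_ge0.
  - by rewrite patchE; case: ifPn => [/set_mem|_]; [exact: inner_ge|exact: f0_ge0j].
have := @fubini_tonelli _ _ _ _ _ leb (mu n) f0 mf0 f00; rewrite /fubini_F/fubini_G => <-.
apply: (le_trans coarea_fatou); apply: limn_einf_le_bound => m.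
have := @fubini_tonelli _ _ _ _ _ leb (mu n) (f m) (mf m) (f_ge0 m); rewrite /fubini_F/fubini_G => ->.
rewrite [leRHS]integral_mkcond; apply: le_integral_pos => [||x|x].
- exact: (@measurable_fun_fubini_tonelli_G _ _ _ _ _ leb (f m) (mf m) (f_ge0 m)).
- apply/(measurable_restrictT _ _).1; first by apply: measurable_lt_set => //; exact: measurable_cst.
  apply: measurable_EFin_comp; apply: measurable_funTS; apply: measurable_funM => //.
  apply: measurable_funM; last exact: measurable_powR_comp.
  by apply: continuous_measurable_rV; exact: continuous_l1grad.
- exact: f_ge0j.
- apply: (le_trans (inner_le m x)); rewrite patchE indicE.
  by case: ifPn => _; rewrite ?mul1r// mul0r mulr0.
Qed.

End coarea.

(** * From superlevel sets to integrals *)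

Section powR_facts.
Context {R : realType}.

Lemma powR_mono (a b r : R) : 0 <= r -> 0 <= a -> a <= b -> a `^ r <= b `^ r.
Proof.
by move=> r0 a0 ab; apply: ge0_ler_powR => //; rewrite nnegrE// (le_trans a0).
Qed.

Lemma powR_pred_mul (x p : R) : 0 < x -> x `^ p = x `^ (p - 1) * x.
Proof.
move=> x0; rewrite -[X in _ = _ * X](powRr1 (ltW x0)) -powRD ?subrK//.
by apply/implyP => _; exact: lt0r_neq0.
Qed.

(** A version of Young's inequality by two cases: for [l <= Q F] the first term alone dominates,
    otherwise [F < l / Q] and the second one does. [Q] remains free so that the first term can be
    absorbed later. *)
Lemma powR_young (F l Q p : R) : 0 < F -> 0 <= l -> 0 < Q -> 1 < p ->
  l * F `^ (p - 1) <= Q * F `^ p + Q `^ (1 - p) * l `^ p.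
Proof.
move=> F0 l0 Q0 p1; have [lQ|Ql] := leP l (Q * F).
  apply: (@le_trans _ _ (Q * F `^ p)); last by rewrite lerDl mulr_ge0 ?powR_ge0.
  by rewrite (powR_pred_mul p F0) [_ * F]mulrC mulrA ler_wpM2r ?powR_ge0.
have l1 : 0 < l by rewrite (le_lt_trans _ Ql)// mulr_ge0// ltW.
apply: (@le_trans _ _ (Q `^ (1 - p) * l `^ p)); last first.
  by rewrite lerDr mulr_ge0 ?powR_ge0// ltW.
rewrite (powR_pred_mul p l1) mulrA mulrC ler_wpM2r ?(ltW l1)//.
apply: (@le_trans _ _ ((Q^-1 * l) `^ (p - 1))).
  by apply: powR_mono; rewrite ?subr_ge0 ?(ltW p1) ?(ltW F0)// ler_pdivlMl// ltW.
rewrite powRM ?invr_ge0 ?(ltW Q0) ?(ltW l1)// ler_wpM2r ?powR_ge0//.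
by rewrite -powR_inv1 ?(ltW Q0)// -powRrM mulN1r opprB.
Qed.

Lemma powRD_le (a b p : R) : 0 <= a -> 0 <= b -> 0 <= p ->
  (a + b) `^ p <= 2 `^ p * (a `^ p + b `^ p).
Proof.
move=> a0 b0 p0.
have H (c d : R) : 0 <= c -> c <= d -> (c + d) `^ p <= 2 `^ p * (c `^ p + d `^ p).
  move=> c0 cd; apply: (@le_trans _ _ ((2 * d) `^ p)).
    by apply: powR_mono => //; [rewrite addr_ge0// (le_trans c0)|rewrite mulr_natl mulr2n lerD2r].
  by rewrite powRM// ?(le_trans c0)// ler_wpM2l ?powR_ge0// lerDr powR_ge0.
have [ab|/ltW ba] := leP a b; first exact: H.
by rewrite addrC [a `^ p + _]addrC; exact: H.
Qed.

Lemma powR_le_self (t p : R) : 0 <= t <= 1 -> 1 < p -> t `^ p <= t.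
Proof.
move=> /andP[t0 t1] p1; move: t0; rewrite le_eqVlt => /predU1P[<-|t0].
  by rewrite powR0// gt_eqF// (lt_trans ltr01).
rewrite (powR_pred_mul p t0) ler_piMl ?(ltW t0)//.
apply: (@le_trans _ _ (1 `^ (p - 1))); last by rewrite powR1.
by apply: powR_mono; rewrite ?subr_ge0 ?(ltW p1) ?(ltW t0).
Qed.

End powR_facts.

Section sobolev_level.
Context {R : realType}.
Local Notation mu := (lebesgue_rV R).
Local Notation leb := (@lebesgue_measure R).

Lemma measurable_EFin_restrict d (T : measurableType d) (D : set T) (g : T -> R) :
  measurable D -> measurable_fun setT g ->
  measurable_fun setT ((fun x => (g x)%:E) \_ D).
Proof.
move=> mD mg; apply/(measurable_restrictT _ mD).1.
by apply: measurable_EFin_comp; exact: measurable_funTS.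
Qed.

Lemma bounded_integrable n (S : set 'rV[R]_n) (g : 'rV[R]_n -> R) (K : R) :
  measurable S -> (mu n S < +oo)%E -> measurable_fun setT g ->
  (forall x, S x -> `|g x| <= K) -> (mu n).-integrable S (EFin \o g).
Proof.
move=> mS fS mg gK; apply: measurable_bounded_integrable => //.
  exact: measurable_funS mg.
exists K; split; first exact: num_real.
by move=> N KN x Sx /=; exact: le_trans (gK x Sx) (ltW KN).
Qed.

(* By the coarea formula [liminf_m level_mass F t m] stands in for the perimeter
   of the superlevel set; the level is slow when twice this bounds
   [theta * mu (superlevel F t)]. *)
Definition slow_levels n (F : 'rV[R]_n -> R) (theta t : R) := forall b : R,
  (b%:E < theta%:E * mu n (superlevel F t))%E ->
  exists N, forall m, (N <= m)%N -> (b%:E <= 2%:E * level_mass F t m)%E.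

(** The pieces used for h_k come from any level of [f] itself, but smooth competitors for h_1
    require regular levels and hence a perturbed [F]. Both situations are covered by allowing an
    error [tau] in the function and in its gradient. *)
Definition approx_slow n (f : 'rV[R]_n -> R) (S : set 'rV[R]_n) (theta tau : R) :=
  exists F : 'rV[R]_n -> R,
  [/\ C1 F, superlevel F tau `<=` S, forall x, S x -> `|F x - f x| <= tau,
      forall x, S x -> l1grad F x <= l1grad f x + tau &
      {ae leb, forall t, tau < t -> slow_levels F theta t}].

(** [3^p] compares [f] with [F / 2]; [2^p] splits the p-th power of [l1grad f + tau]; the last
    factor is [Q^(1-p)] freed of [theta]; 4 is the coarea factor 2, doubled when half of the left
    side is absorbed. *)
Definition sob_cst (p : R) : R := 4 * 3 `^ p * 2 `^ p * (2 `^ (p + 2)) `^ (p - 1).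

Variables (n : nat) (f : 'rV[R]_n -> R) (S : set 'rV[R]_n) (M p theta : R).
Hypotheses (cf : C1 f) (mS : measurable S) (SM : S `<=` cube n M) (p1 : 1 < p)
  (theta0 : 0 < theta).
Hypothesis H : forall tau, 0 < tau <= 1 -> approx_slow f S theta tau.

Let p0 : 0 <= p. Proof. exact: ltW (lt_trans ltr01 p1). Qed.
Let fS : (mu n S < +oo)%E. Proof. exact: sub_cube_lty SM. Qed.
Let m := fine (mu n S).
Let m0 : 0 <= m. Proof. exact: fine_ge0. Qed.
Let X := \int[mu n]_(x in S) (posp (f x) `^ p).
Let Y := \int[mu n]_(x in S) (l1grad f x `^ p).
(** Chosen so that [2 Q F^p] is exactly half of [theta (F/2)^p]. *)
Let Q := theta / 2 `^ (p + 2).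
Let Q0 : 0 < Q. Proof. by rewrite divr_gt0 ?powR_gt0. Qed.
Let A := 4 * 3 `^ p * 2 `^ p * Q `^ (1 - p).
Let B := 3 `^ p * 2 * (2 * Q * 2 `^ p + 2 * Q `^ (1 - p) * 2 `^ p) * m + theta * 3 `^ p * m.

Let mpow (g : 'rV[R]_n -> R) (r : R) : continuous g -> measurable_fun setT (fun x => g x `^ r).
Proof. by move=> cg; apply: measurable_powR_comp; exact: continuous_measurable_rV. Qed.

Let cposp (g : 'rV[R]_n -> R) : continuous g -> continuous (fun x => posp (g x)).
Proof. by move=> cg x; apply: continuous_comp; [exact: cg|exact: continuous_posp]. Qed.

Let pow_bounded (g : 'rV[R]_n -> R) (r : R) : 0 <= r -> continuous g -> (forall x, 0 <= g x) ->
  exists K, forall x, S x -> `|g x `^ r| <= K.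
Proof.
move=> r0 cg g0; have [K K0 HK] := bounded_on_cube M cg; exists (K `^ r) => x Sx.
rewrite ger0_norm ?powR_ge0//; apply: powR_mono => //.
by apply: le_trans (HK x (SM Sx)); exact: ler_norm.
Qed.

Let ipow (g : 'rV[R]_n -> R) (r : R) : 0 <= r -> continuous g -> (forall x, 0 <= g x) ->
  (mu n).-integrable S (EFin \o (fun x => g x `^ r)).
Proof.
move=> r0 cg g0; have [K HK] := pow_bounded r0 cg g0.
by apply: (bounded_integrable mS fS (mpow r cg) HK).
Qed.

Let posp_ge0 (x : R) : 0 <= posp x.
Proof. by case: (pospP x) => -[? ->]. Qed.

Let icst (c : R) : (mu n).-integrable S (EFin \o (fun=> c)).
Proof. by apply: (bounded_integrable (K := `|c|)). Qed.

Let sobolev_error tau : 0 < tau <= 1 -> theta * X <= A * Y + B * tau.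
Proof.
move=> /andP[t0 t1].
have [|F [cF FS Ff lF Hae]] := H (tau := tau); first by rewrite t0.
have cF' := C1_continuous cF.
have mF := continuous_measurable_rV cF'.
have msup t : measurable (superlevel F t).
  by apply: measurable_lt_set => //; exact: measurable_cst.
have fin t : tau < t -> (mu n (superlevel F t) < +oo)%E.
  move=> tt; apply: (le_lt_trans _ fS); apply: le_measure; rewrite ?inE//.
  by move=> x h; apply: FS; exact: lt_trans h.
have co := coarea_weighted cF t0 p1 (ltW theta0) fin Hae.
pose a x : R := theta * (\1_(superlevel F (2 * tau)) x * (posp (F x) / 2) `^ p).
pose l x : R := l1grad f x.
pose c x : R := 2 * Q `^ (1 - p) * 2 `^ p * l x `^ p.
pose k : R := 2 * Q * (2 * tau) `^ p + 2 * Q `^ (1 - p) * 2 `^ p * tau `^ p.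
have cl : continuous l by exact: continuous_l1grad.
have l0 x : 0 <= l x by exact: l1grad_ge0.
have cF2 : continuous (fun x => posp (F x) / 2).
  by apply: continuousM_R; [exact: cposp|exact: cst_continuous].
have F20 x : 0 <= posp (F x) / 2 by rewrite divr_ge0.
have ia : (mu n).-integrable S (EFin \o a).
  have [K HK] := pow_bounded p0 cF2 F20.
  apply: (bounded_integrable (K := theta * K)) => //.
    apply: measurable_funM => //; apply: measurable_funM; last exact: mpow.
    exact: measurable_indic.
  move=> x Sx; rewrite normrM gtr0_norm// ler_wpM2l ?(ltW theta0)// normrM.
  apply: le_trans (HK x Sx); rewrite ler_piMl// indicE.
  by case: (_ \in _); rewrite ?normr1 ?normr0.
have ic : (mu n).-integrable S (EFin \o c).
  have := integrableZl mS (2 * Q `^ (1 - p) * 2 `^ p) (ipow p0 cl l0).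
  by apply: eq_integrable => // x _; rewrite /= EFinM.
have iha : (mu n).-integrable S (EFin \o (fun x => 2^-1 * a x)).
  by have := integrableZl mS 2^-1 ia; apply: eq_integrable => // x _; rewrite /= EFinM.
have ick : (mu n).-integrable S (EFin \o (fun x => c x + k)).
  by have := integrableD mS ic (icst k); apply: eq_integrable.
have iack : (mu n).-integrable S (EFin \o (fun x => 2^-1 * a x + (c x + k))).
  by have := integrableD mS iha ick; apply: eq_integrable.
(* The integral of [a] stands on both sides: half of it is the first term of [powR_young], and what
   that term misses where [F <= 2 tau] goes into [k]. Being finite, it can be subtracted. *)
have Ia : \int[mu n]_(x in S) a x <= 2^-1 * (\int[mu n]_(x in S) a x) +
    (2 * Q `^ (1 - p) * 2 `^ p * Y + k * m).
  have -> : 2^-1 * (\int[mu n]_(x in S) a x) + (2 * Q `^ (1 - p) * 2 `^ p * Y + k * m)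
     = \int[mu n]_(x in S) (2^-1 * a x + (c x + k)).
    rewrite (RintegralD mS iha ick) (RintegralZl _ mS ia) (RintegralD mS ic (icst k)).
    by rewrite (RintegralZl _ mS (ipow p0 cl l0)) Rintegral_cst.
  rewrite -lee_fin !fineK; [|exact: integrable_fin_num..].
  apply: (@le_trans _ _ (\int[mu n]_(x in superlevel F (2 * tau)) (theta * (F x / 2) `^ p)%:E)%E).
    rewrite integral_mkcond [leRHS]integral_mkcond le_eqVlt; apply/orP; left; apply/eqP.
    apply: eq_integral => x _; rewrite !patchE /a indicE.
    have [xs|xs] := boolP (x \in superlevel F (2 * tau)); last by rewrite mul0r mulr0; case: ifP.
    have Fx : 2 * tau < F x by move/set_mem : xs.
    have -> : x \in S by apply/mem_set/FS; rewrite /superlevel/=; lra.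
    by rewrite mul1r; have [[_ ->]|[h _]] := pospP (F x); [|exfalso; lra].
  apply: (le_trans co).
  rewrite [leLHS]integral_mkcond [leRHS]integral_mkcond.
  apply: le_integral_pos => [||x|x].
  - apply: measurable_EFin_restrict; first exact: msup.
    apply: measurable_funM => //.
    apply: measurable_funM; last exact: mpow.
    by apply: continuous_measurable_rV; exact: continuous_l1grad.
  - have /integrableP[mm _] := iack.
    exact: (measurable_restrictT _ mS).1 mm.
  - rewrite patchE; case: ifPn => // _.
    by rewrite lee_fin !mulr_ge0 ?powR_ge0 ?l1grad_ge0.
  - have [/set_mem xs|xs] := boolP (x \in superlevel F tau); last first.
      rewrite patchE (negbTE xs) patchE; case: ifPn => // _.
      by rewrite lee_fin /a /c /k !(addr_ge0, mulr_ge0) ?powR_ge0 ?invr_ge0 ?(ltW Q0) ?(ltW theta0).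
    rewrite !patchE (mem_set xs) (mem_set (FS _ xs)) lee_fin.
    have Fx : tau < F x := xs.
    have Fx0 : 0 < F x by apply: lt_trans Fx.
    have EF : posp (F x) = F x by have [[_ ->]|[h _]] := pospP (F x); [|exfalso; lra].
    have EQ : 2 * Q * F x `^ p = 2^-1 * (theta * (F x / 2) `^ p).
      rewrite /Q powRD ?powRM ?invr_ge0 ?(ltW Fx0)//; last by rewrite pnatr_eq0 implybT.
      have -> : (2^-1 : R) `^ p = (2 `^ p)^-1.
        by rewrite -(@powR_inv1 _ 2)// -powRrM mulN1r powRN.
      have -> : (2 : R) `^ 2 = 4 by rewrite powR_mulrn//; ring.
      have : (2 : R) `^ p != 0 by rewrite gt_eqF ?powR_gt0.
      by move: (2 `^ p) (F x `^ p) => u v u0; field.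
    have h1 : 2 * Q * F x `^ p <= 2^-1 * a x + 2 * Q * (2 * tau) `^ p.
      rewrite /a indicE; have [xs2|xs2] := boolP (x \in _).
        by rewrite mul1r EF -EQ lerDl !mulr_ge0 ?powR_ge0// ltW.
      have Q20 : 0 <= 2 * Q by rewrite mulr_ge0// ltW.
      rewrite mul0r !mulr0 add0r; apply: (ler_wpM2l Q20).
      apply: powR_mono; rewrite ?(ltW Fx0)// leNgt; apply: contra xs2 => h.
      exact/mem_set.
    have h2 : l1grad F x `^ p <= 2 `^ p * (l x `^ p + tau `^ p).
      apply: (le_trans _ (powRD_le (l0 x) (ltW t0) p0)).
      by apply: powR_mono; rewrite ?l1grad_ge0//; exact/lF/FS.
    have h3 := powR_young Fx0 (l1grad_ge0 F x) Q0 p1.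
    have Q1 : 0 <= Q `^ (1 - p) by exact: powR_ge0.
    have h4 : Q `^ (1 - p) * l1grad F x `^ p <= Q `^ (1 - p) * (2 `^ p * (l x `^ p + tau `^ p)).
      by rewrite ler_wpM2l.
    rewrite /c /k.
    set u := Q `^ (1 - p) in h3 h4 *; set v := 2 `^ p in h2 h4 *.
    set w := l1grad F x * _ in h3 *.
    apply: (@le_trans _ _ (2 * (Q * F x `^ p + u * l1grad F x `^ p))); first by rewrite ler_wpM2l.
    apply: (@le_trans _ _ (2 * Q * F x `^ p + 2 * (u * (v * (l x `^ p + tau `^ p))))).
      by rewrite mulrDr mulrA lerD2l ler_wpM2l.
    apply: (le_trans (lerD h1 (lexx _))).
    by rewrite le_eqVlt; apply/orP; left; apply/eqP; ring.
(* If [f > 3 tau], then [F >= f - tau > 2 f / 3 > 2 tau], so [a] is active there and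
   [f <= 3 (F / 2)]. The remaining points contribute at most [theta (3 tau)^p] each. *)
have IX : theta * X <= 3 `^ p * (\int[mu n]_(x in S) a x) + theta * (3 * tau) `^ p * m.
  have -> : 3 `^ p * (\int[mu n]_(x in S) a x) + theta * (3 * tau) `^ p * m =
     \int[mu n]_(x in S) (3 `^ p * a x + theta * (3 * tau) `^ p).
    rewrite RintegralD//; last first.
      by have := integrableZl mS (3 `^ p) ia; apply: eq_integrable => // x _; rewrite /= EFinM.
    by rewrite RintegralZl// Rintegral_cst.
  have cpf : continuous (fun x => posp (f x)) by exact: cposp (C1_continuous cf).
  rewrite -RintegralZl//; last exact: ipow.
  apply: le_Rintegral => //.
  - by have := integrableZl mS theta (ipow p0 cpf (fun x => posp_ge0 (f x)));
      apply: eq_integrable => // x _; rewrite /= EFinM.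
  - have iz : (mu n).-integrable S (EFin \o (fun x => 3 `^ p * a x)).
      by have := integrableZl mS (3 `^ p) ia; apply: eq_integrable => // x _; rewrite /= EFinM.
    by have := integrableD mS iz (icst (theta * (3 * tau) `^ p)); apply: eq_integrable.
  move=> x Sx; have := Ff x Sx; rewrite ler_norml => /andP[d1 d2].
  have th0 := ltW theta0.
  have [f3|f3] := leP (f x) (3 * tau).
    apply: (@le_trans _ _ (theta * (3 * tau) `^ p)).
      rewrite ler_wpM2l//; apply: powR_mono => //.
      by case: (pospP (f x)) => -[h ->] //; rewrite mulr_ge0// ltW.
    by rewrite lerDr mulr_ge0 ?powR_ge0// mulr_ge0// mulr_ge0 ?powR_ge0.
  rewrite /a indicE mem_set; last by rewrite /superlevel/=; lra.
  have -> : posp (F x) = F x by have [[_ ->]|[h _]] := pospP (F x); [|exfalso; lra].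
  have -> : posp (f x) = f x by have [[_ ->]|[h _]] := pospP (f x); [|exfalso; lra].
  rewrite mul1r mulrCA -powRM//; last by lra.
  apply: (@le_trans _ _ (theta * (3 * (F x / 2)) `^ p)).
    by rewrite ler_wpM2l//; apply: powR_mono => //; lra.
  by rewrite lerDl mulr_ge0 ?powR_ge0.
have tp : tau `^ p <= tau by apply: powR_le_self => //; rewrite ltW.
move: Ia IX; set Z := \int[mu n]_(x in S) a x => Ia IX.
have Z1 : Z <= 2 * (2 * Q `^ (1 - p) * 2 `^ p * Y + k * m) by lra.
apply: (le_trans IX).
apply: (@le_trans _ _ (3 `^ p * (2 * (2 * Q `^ (1 - p) * 2 `^ p * Y + k * m)) + theta * (3 * tau) `^ p * m)).
  by rewrite lerD2r ler_wpM2l ?powR_ge0.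
have kE : k = (2 * Q * 2 `^ p + 2 * Q `^ (1 - p) * 2 `^ p) * tau `^ p.
  by rewrite /k powRM ?(ltW t0)//; ring.
rewrite kE [(3 * tau) `^ p]powRM ?(ltW t0)//.
have -> : 3 `^ p * (2 * (2 * Q `^ (1 - p) * 2 `^ p * Y +
   (2 * Q * 2 `^ p + 2 * Q `^ (1 - p) * 2 `^ p) * tau `^ p * m)) + theta * (3 `^ p * tau `^ p) * m
   = A * Y + B * tau `^ p by rewrite /A /B; ring.
rewrite lerD2l ler_wpM2l// /B.
by rewrite !(addr_ge0, mulr_ge0) ?powR_ge0 ?(ltW Q0) ?(ltW theta0).
Qed.

(** [A] and [B] do not depend on [tau], so [sobolev_error] survives the limit [tau -> 0];
    multiplying by [theta^(p-1)] then cancels the power of [theta] hidden in [Q^(1-p)]. *)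
Lemma slow_levels_sobolev : theta `^ p * X <= sob_cst p * Y.
Proof.
have B0 : 0 <= B.
  by rewrite /B !(addr_ge0, mulr_ge0) ?powR_ge0 ?(ltW Q0) ?(ltW theta0).
have HX : theta * X <= A * Y.
  apply/ler_addgt0Pr => e e0.
  pose t := Num.min 1 (e / (B + 1)).
  have B1 : 0 < B + 1 by rewrite ltr_wpDl.
  have t0 : 0 < t <= 1 by rewrite lt_min ltr01 divr_gt0//= ge_min lexx.
  apply: (le_trans (sobolev_error t0)); rewrite lerD2l.
  apply: (@le_trans _ _ ((B + 1) * t)).
    by rewrite ler_wpM2r ?lerDl//; case/andP : t0 => /ltW.
  by rewrite -ler_pdivlMl// mulrC ge_min lexx orbT.
rewrite (powR_pred_mul p theta0) -mulrA.
apply: (@le_trans _ _ (theta `^ (p - 1) * (A * Y))).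
  by rewrite ler_wpM2l ?powR_ge0.
rewrite mulrA le_eqVlt; apply/orP; left; apply/eqP; congr (_ * Y).
rewrite /A /Q /sob_cst powRM ?invr_ge0 ?powR_ge0 ?(ltW theta0)//.
rewrite -powR_inv1 ?powR_ge0// -(powRrM _ (-1)) mulN1r opprB.
rewrite -(opprB p 1) powRN.
have : theta `^ (p - 1) != 0 by rewrite gt_eqF ?powR_gt0.
move: (theta `^ (p - 1)) (2 `^ p) (3 `^ p) ((2 `^ (p + 2)) `^ (p - 1)) => u v w z u0.
by field.
Qed.

End sobolev_level.

(** * Volume of a level that is not slow *)

Section nash.
Context {R : realType}.
Local Notation mu := (lebesgue_rV R).
Local Notation leb := (@lebesgue_measure R).

(** The inductive step of [nash_l1] for one slice: [m] and [s] are the integrals of [g] and [g^2] on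
    it, [M] is the total mass. If [m <= rn], the hypothesis from dimension n is multiplied by [r]
    and one factor [m] is replaced through [r m <= M + r G]. If [m > rn], the bound [s <= m] is
    enough, since then [rn M <= m M]. *)
Lemma nash_arith (r rn M m : R) (s G D : \bar R) : 0 < r -> 0 < rn -> 0 <= M -> 0 <= m ->
  (0 <= s -> 0 <= G -> 0 <= D -> s <= m%:E ->
   rn%:E * s <= (m * m)%:E + (rn * r)%:E * D ->
   r%:E * m%:E <= M%:E + r%:E * G ->
   (rn * r)%:E * s <= (m * M)%:E + ((rn * r)%:E * G + (rn * r * r)%:E * D))%E.
Proof.
move=> r0 rn0 M0 m0.
case: s => [s| |]//; case: G => [G| |]//; case: D => [D| |]//; rewrite ?lee_fin.
- move=> s0 G0 D0 sm; rewrite ?lee_fin => h1 h2.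
  have [mr|rm] := leP m rn.
    have h3 : r * (rn * s) <= r * (m * m + rn * r * D) by rewrite ler_wpM2l// ltW.
    have h4 : m * (r * m) <= m * (M + r * G) by rewrite ler_wpM2l.
    have h5 : m * (r * G) <= rn * (r * G) by rewrite ler_wpM2r// mulr_ge0// ltW.
    by lra.
  have h3 : rn * (r * s) <= rn * (r * m) by rewrite !ler_wpM2l// ltW.
  have h4 : rn * (r * m) <= rn * (M + r * G) by rewrite ler_wpM2l// ltW.
  have h5 : rn * M <= m * M by rewrite ler_wpM2r// ltW.
  have h6 : 0 <= rn * r * r * D by rewrite !mulr_ge0// ltW.
  by lra.
all: by move=> *; rewrite !gt0_muley ?lte_fin ?mulr_gt0//= ?leey.
Qed.

(** For every b in [[a, a + r]], [h a] is at most [h b] plus the variation of [h] on that interval;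
    integrate over b. *)
Lemma integral_section_le (h dh : R -> R) (r a : R) : 0 < r ->
  (forall s, is_derive s (1 : R) h (dh s)) -> continuous dh -> (forall s, 0 <= h s) ->
  ((r * h a)%:E <= \int[leb]_b (h b)%:E +
    r%:E * \int[leb]_c (\1_(`[a, a + r]%classic : set R) c * `|dh c|)%:E)%E.
Proof.
move=> r0 Hh cdh h0.
have ch : continuous h.
  by move=> s; apply: differentiable_continuous; apply/derivable1_diffP; have [] := Hh s.
have cadh : continuous (fun c => `|dh c|).
  by move=> c; apply: (@continuous_comp _ _ _ dh); [exact: cdh|exact: norm_continuous].
pose I := `[a, a + r]%classic : set R.
have mI : measurable I by exact: measurable_itv.
have madh : measurable_fun setT (fun c => `|dh c|) by exact: continuous_measurable_fun.
have mh : measurable_fun setT h by exact: continuous_measurable_fun.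
set W := (\int[leb]_c (\1_(`[a, a + r]%classic : set R) c * `|dh c|)%:E)%E.
have WE : W = (\int[leb]_(c in I) (`|dh c|)%:E)%E.
  rewrite [RHS]integral_mkcond; apply: eq_integral => c _.
  by rewrite patchE indicE; case: ifPn => _; rewrite ?mul1r ?mul0r.
have ptw b : I b -> ((h a)%:E <= (h b)%:E + W)%E.
  rewrite /I/= in_itv/= => /andP[ab br].
  move: ab; rewrite le_eqVlt => /predU1P[<-|ab].
    by rewrite leeDl// integral_ge0// => c _; rewrite lee_fin mulr_ge0.
  have E := @continuous_FTC2 R dh h a b ab (continuous_subspaceT cdh).
  rewrite -leeBlDl// -EFinB -opprB EFinN EFinB -E; last 2 first.
  - split; [by move=> x _; have [] := Hh x|..].
      by apply: cvg_at_right_filter; exact: ch.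
    by apply: cvg_at_left_filter; exact: ch.
  - by move=> x _; rewrite derive1E derive_val.
  set Z := (\int[_]_(x in _) _)%E.
  apply: (@le_trans _ _ `|Z|%E); first by rewrite -abseN lee_abs.
  have mab : measurable (`[a, b]%classic : set R) by exact: measurable_itv.
  apply: (@le_trans _ _ (\int[leb]_(c in `[a, b]) (`|dh c|)%:E)%E).
    apply: (le_abse_integral leb mab); apply: measurable_EFin_comp.
    by apply: measurable_funTS; exact: continuous_measurable_fun.
  rewrite WE; apply: ge0_subset_integral => //.
  - by apply: measurable_EFin_comp; exact: measurable_funTS.
  - by move=> x; rewrite /I/= !in_itv/= => /andP[-> xb]; rewrite (le_trans xb).
have -> : (r * h a)%:E = (\int[leb]_(b in I) (h a)%:E)%E.
  rewrite integral_cst// /I; have := @lebesgue_measure_itv R `[a, a + r].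
  rewrite /= lte_fin ltrDl r0 => ->.
  by rewrite -EFinB -EFinM; congr (_%:E); rewrite addrAC subrr add0r mulrC.
apply: (@le_trans _ _ (\int[leb]_(b in I) ((h b)%:E + W))%E).
  apply: ge0_le_integral => //.
  - by move=> x _; rewrite lee_fin.
  - apply: emeasurable_funD; last exact: measurable_cst.
    by apply: measurable_EFin_comp; exact: measurable_funTS.
have W0 : (0 <= W)%E by apply: integral_ge0 => c _; rewrite lee_fin mulr_ge0.
rewrite ge0_integralD//; last 2 first.
- by move=> x _; rewrite lee_fin.
- by apply: measurable_EFin_comp; exact: measurable_funTS.
apply: leeD.
  apply: ge0_subset_integral => //.
  - by apply: measurable_EFin_comp.
  - by move=> x _; rewrite lee_fin.
rewrite integral_cst// /I; have := @lebesgue_measure_itv R `[a, a + r].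
rewrite /= lte_fin ltrDl r0 => ->.
by rewrite -EFinB muleC addrAC subrr add0r.
Qed.

Lemma l1grad_cons n (g : 'rV[R]_n.+1 -> R) a y : C1 g ->
  l1grad g (rV_cons (a, y)) =
  `|partial ord0 g (rV_cons (a, y))| + l1grad (fun y => g (rV_cons (a, y))) y.
Proof.
move=> cg; rewrite /l1grad big_ord_recl; congr (_ + _); apply: eq_bigr => i _.
by have [_ ->] := C1_section1 a cg.
Qed.

(* By induction on n: the slice at height a has mass at most 1/r times the total
   mass plus the variation of g in the first direction over [a, a + r]. *)
Lemma nash_l1 n (r M : R) (g : 'rV[R]_n -> R) : 0 < r -> C1 g -> csupp M g ->
  (forall x, 0 <= g x <= 1) ->
  ((r ^+ n)%:E * \int[mu n]_x (g x ^+ 2)%:E <=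
   (\int[mu n]_x (g x)%:E) * (\int[mu n]_x (g x)%:E) +
   (r ^+ n.+1)%:E * \int[mu n]_x (l1grad g x)%:E)%E.
Proof.
move=> r0; elim: n g => [|n IH] g cg sg g01.
  rewrite expr0 mul1e.
  have dE (f : 'rV[R]_0 -> R) : measurable_fun setT f -> (\int[mu 0]_x (f x)%:E = (f 0)%:E)%E.
    move=> mf; have := integral_dirac (0 : 'rV[R]_0) measurableT (measurable_EFin_comp mf).
    by rewrite diracT mul1e.
  have mg : measurable_fun setT g by apply: continuous_measurable_rV; exact: C1_continuous.
  rewrite (dE _ mg) (dE (fun x => g x ^+ 2)); last exact: measurable_funX.
  rewrite -EFinM expr2 leeDl// mule_ge0 ?lee_fin ?exprn_ge0 ?(ltW r0)//.
  by apply: integral_ge0 => x _; rewrite lee_fin l1grad_ge0.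
have g0 x : 0 <= g x by case/andP: (g01 x).
have cg' := C1_continuous cg.
have mg := continuous_measurable_rV cg'.
have cp0 : continuous (partial ord0 g) by exact: C1_partial_continuous.
have cap : continuous (fun x => `|partial ord0 g x|).
  by move=> x; apply: (@continuous_comp _ _ _ (partial ord0 g)); [exact: cp0|exact: norm_continuous].
have map_ := continuous_measurable_rV cap.
pose ga a y := g (rV_cons (a, y)).
have cga a : C1 (ga a) by have [] := C1_section1 a cg.
have sga a : csupp M (ga a) by move=> y yM; apply: sg => /cube_cons[].
pose m a := (\int[mu n]_y (ga a y)%:E)%E.
pose s a := (\int[mu n]_y (ga a y ^+ 2)%:E)%E.
pose D a := (\int[mu n]_y (l1grad (ga a) y)%:E)%E.
pose Hc c := (\int[mu n]_y (`|partial ord0 g (rV_cons (c, y))|)%:E)%E.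
pose I a := `[a, a + r]%classic : set R.
pose G a := (\int[leb]_c ((\1_(I a) c)%:E * Hc c))%E.
pose MM := (\int[mu n.+1]_x (g x)%:E)%E.
have mga a : measurable_fun setT (ga a).
  by apply: continuous_measurable_rV; exact: C1_continuous.
have mfin a : m a \is a fin_num.
  by apply: integrable_fin_num => //; apply: (csupp_integrable (M := M)); [exact: C1_continuous|].
have m0 a : (0 <= m a)%E by apply: integral_ge0 => y _; rewrite lee_fin; exact: g0.
have Mfin : MM \is a fin_num.
  by apply: integrable_fin_num => //; apply: (csupp_integrable (M := M)).
have M0 : (0 <= MM)%E by apply: integral_ge0 => y _; rewrite lee_fin; exact: g0.
have D0 a : (0 <= D a)%E by apply: integral_ge0 => y _; rewrite lee_fin l1grad_ge0.
have H0 a : (0 <= Hc a)%E by apply: integral_ge0 => y _; rewrite lee_fin.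
have G0 a : (0 <= G a)%E by apply: integral_ge0 => y _; rewrite mule_ge0.
have s0 a : (0 <= s a)%E by apply: integral_ge0 => y _; rewrite lee_fin sqr_ge0.
have mcons d (T : measurableType d) (f : 'rV[R]_n.+1 -> R) (h : T -> R * 'rV[R]_n) :
    measurable_fun setT f -> measurable_fun [set: T] (h : T -> measurableTypeR R * 'rV[R]_n) ->
    measurable_fun setT (fun z => f (rV_cons (h z))).
  move=> mf mh; apply: (measurableT_comp mf).
  exact: (measurableT_comp (@measurable_rV_cons R n) mh).
have msec (f : 'rV[R]_n.+1 -> R) : measurable_fun setT f -> (forall x, 0 <= f x) ->
    measurable_fun setT (fun a : R => \int[mu n]_y (f (rV_cons (a, y)))%:E)%E.
  move=> mf f0.
  have := @measurable_fun_fubini_tonelli_F _ _ _ _ _ (mu n) (fun z => (f (rV_cons z))%:E).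
  apply; first by apply: measurable_EFin_comp; exact: (mcons _ _ f id).
  by move=> z; rewrite lee_fin.
have mm : measurable_fun setT m by exact: (msec g).
have mH : measurable_fun setT Hc.
  by apply: (msec (fun x => `|partial ord0 g x|)).
have mD : measurable_fun setT D.
  pose f x := l1grad g x - `|partial ord0 g x|.
  have := msec f.
  rewrite (_ : (fun a : R => _) = D).
    apply; last by move=> x; rewrite /f /l1grad big_ord_recl addrAC subrr add0r sumr_ge0.
    apply: measurable_funB => //.
    by apply: continuous_measurable_rV; exact: continuous_l1grad.
  apply/funext => a; apply: eq_integral => y _.
  by rewrite /f (l1grad_cons _ _ cg) addrAC subrr add0r.
have ms : measurable_fun setT s.
  by apply: (msec (fun x => g x ^+ 2)) => [|x]; [exact: measurable_funX|exact: sqr_ge0].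
pose K (z : measurableTypeR R * measurableTypeR R) : \bar R := ((\1_(I z.1) z.2 : R)%:E * Hc z.2)%E.
have mK : measurable_fun setT K.
  apply: emeasurable_funM; last by apply: measurableT_comp mH _; exact: measurable_snd.
  apply: measurable_EFin_comp.
  pose B := [set z : measurableTypeR R * measurableTypeR R | ~ (z.2 < z.1) /\ ~ (z.1 + r < z.2)].
  have mB : measurable B.
    rewrite (_ : B = ~` [set z | z.2 < z.1] `&` ~` [set z | z.1 + r < z.2]); last by [].
    have m1 := @measurable_fst _ _ (measurableTypeR R) (measurableTypeR R).
    have m2 := @measurable_snd _ _ (measurableTypeR R) (measurableTypeR R).
    apply: measurableI; apply: measurableC; apply: measurable_lt_set => //.
    exact: measurable_funD.
  rewrite (_ : (fun z => _) = \1_B); first exact: measurable_indic.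
  apply/funext => z; rewrite !indicE; congr (_%:R); congr nat_of_bool.
  apply/idP/idP => /set_mem h; apply/mem_set; move: h; rewrite /B /I/= in_itv/=.
    by move=> /andP[h1 h2]; split; apply/negP; rewrite -leNgt.
  by move=> [/negP h1 /negP h2]; rewrite !leNgt h1 h2.
have K0 z : (0 <= K z)%E by rewrite mule_ge0.
have mG : measurable_fun setT G.
  by have := @measurable_fun_fubini_tonelli_F _ _ _ _ _ leb K mK K0.
(* A height [c] lies in [[a, a + r]] for a set of [a] of length [r]. This supplies the missing
   factor that turns [r^(n+1)] into [r^(n+2)]. *)
have GE : (\int[leb]_a G a = r%:E * \int[leb]_c Hc c)%E.
  have := @fubini_tonelli _ _ _ _ _ leb leb K mK K0; rewrite /fubini_F /fubini_G/= => ->.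
  rewrite -ge0_integralZl//; last by rewrite lee_fin ltW.
  apply: eq_integral => c _.
  transitivity (\int[leb]_a (Hc c * (\1_(`[c - r, c]%classic : set R) a)%:E))%E.
    apply: eq_integral => a _; rewrite /K muleC; congr (_ * _%:E)%E.
    rewrite !indicE; congr (_%:R); congr nat_of_bool.
    apply/idP/idP => /set_mem h; apply/mem_set; move: h; rewrite /I/= !in_itv/=;
      move=> /andP[h1 h2]; apply/andP; split; lra.
  rewrite ge0_integralZl//; last first.
    by apply: measurable_EFin_comp; apply: measurable_indic; exact: measurable_itv.
  rewrite integral_indicT; last exact: measurable_itv.
  have := @lebesgue_measure_itv R `[c - r, c]; rewrite /= lte_fin ltrBlDr ltrDl r0 => ->.
  by rewrite -EFinB muleC; congr (_%:E * _)%E; lra.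
have key a : ((r ^+ n.+1)%:E * s a <= m a * MM + ((r ^+ n.+1)%:E * G a + (r ^+ n.+2)%:E * D a))%E.
  have sm : (s a <= m a)%E.
    apply: le_integral_pos => [||y|y].
    - by apply: measurable_EFin_comp; exact: measurable_funX.
    - exact: measurable_EFin_comp.
    - by rewrite lee_fin sqr_ge0.
    - by rewrite lee_fin expr2 ler_piMr//; case/andP: (g01 (rV_cons (a, y))).
  have rG : (r%:E * m a <= MM + r%:E * G a)%E.
    rewrite /m -ge0_integralZ_real ?(ltW r0)//; last by move=> y; exact: g0.
    rewrite /MM tonelli_rV2//; last exact: measurable_EFin_comp.
    pose L (z : measurableTypeR R * 'rV[R]_n) : \bar R :=
      (\1_(I a) z.1 * `|partial ord0 g (rV_cons z)|)%:E.
    have mL : measurable_fun setT L.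
      apply: measurable_EFin_comp; apply: measurable_funM; last first.
        by apply: (mcons _ _ (fun x => `|partial ord0 g x|) id).
      by apply: measurableT_comp; [apply: measurable_indic; exact: measurable_itv|exact: measurable_fst].
    have L0 z : (0 <= L z)%E by rewrite lee_fin mulr_ge0.
    have GE' : G a = (\int[mu n]_y \int[leb]_c (\1_(I a) c * `|partial ord0 g (rV_cons (c, y))|)%:E)%E.
      have := @fubini_tonelli _ _ _ _ _ leb (mu n) L mL L0; rewrite /fubini_F /fubini_G/= => <-.
      apply: eq_integral => c _; rewrite /L/= ge0_integralZ_real//.
      by apply: (mcons _ _ (fun x => `|partial ord0 g x|) (fun y => (c, y))) => //; exact: pair1_measurable.
    pose P y := (\int[leb]_b (g (rV_cons (b, y)))%:E)%E.
    pose Qq y := (\int[leb]_c (\1_(I a) c * `|partial ord0 g (rV_cons (c, y))|)%:E)%E.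
    have mP : measurable_fun setT P.
      have := @measurable_fun_fubini_tonelli_G _ _ _ _ _ leb (fun z => (g (rV_cons z))%:E).
      apply; first by apply: measurable_EFin_comp; exact: (mcons _ _ g id).
      by move=> z; rewrite lee_fin; exact: g0.
    have P0 y : (0 <= P y)%E by apply: integral_ge0 => c _; rewrite lee_fin; exact: g0.
    have Q0 y : (0 <= Qq y)%E by apply: integral_ge0 => c _; rewrite lee_fin mulr_ge0.
    have mQ : measurable_fun setT Qq.
      by have := @measurable_fun_fubini_tonelli_G _ _ _ _ _ leb L mL L0.
    rewrite -/P GE' -/Qq -ge0_integralZl ?lee_fin ?(ltW r0)//; last first.
      by move=> y _; exact: Q0.
    rewrite -ge0_integralD//; last 3 first.
    - by move=> y _; exact: P0.
    - by move=> y _; apply: mule_ge0; [rewrite lee_fin ltW|exact: Q0].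
    - exact: emeasurable_funM.
    apply: le_integral_pos => [||y|y].
    - by apply: measurable_EFin_comp; exact: measurable_funM.
    - by apply: emeasurable_funD => //; exact: emeasurable_funM.
    - by rewrite lee_fin mulr_ge0 ?(ltW r0)//; exact: g0.
    - apply: (@integral_section_le (fun a => g (rV_cons (a, y)))) => //.
      + by move=> t; exact: is_derive_section0.
      + by move=> t; apply: continuous_comp; [exact: continuous_rV_cons0|exact: cp0].
  have rn0 : 0 < r ^+ n by rewrite exprn_gt0.
  have IHa := IH (ga a) (cga a) (sga a) (fun y => g01 _).
  move: rG IHa sm; rewrite -/(m a) -/(s a) -/(D a) -(fineK (mfin a)) -(fineK Mfin) => rG IHa sm.
  rewrite [r ^+ n.+2]exprSr [r ^+ n.+1]exprSr -EFinM.
  apply: nash_arith => //.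
  - exact: fine_ge0.
  - exact: fine_ge0.
  - by move: IHa; rewrite exprSr EFinM.
rewrite (tonelli_rV1 (f := fun x => (g x ^+ 2)%:E)); last 2 first.
- by apply: measurable_EFin_comp; exact: measurable_funX.
- by move=> x; rewrite lee_fin sqr_ge0.
rewrite -ge0_integralZl//; last 2 first.
- by move=> a _; exact: s0.
- by rewrite lee_fin exprn_ge0// ltW.
apply: (@le_trans _ _ (\int[leb]_a (m a * MM + ((r ^+ n.+1)%:E * G a + (r ^+ n.+2)%:E * D a)))%E).
  apply: le_integral_pos => [||a|a].
  - by apply: emeasurable_funM.
  - apply: emeasurable_funD; first exact: emeasurable_funM.
    by apply: emeasurable_funD; exact: emeasurable_funM.
  - by apply: mule_ge0; [rewrite lee_fin exprn_ge0// ltW|exact: s0].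
  - exact: key.
have rk k : 0 <= r ^+ k by rewrite exprn_ge0// ltW.
have rG0 a : (0 <= (r ^+ n.+1)%:E * G a)%E by rewrite mule_ge0 ?lee_fin.
have rD0 a : (0 <= (r ^+ n.+2)%:E * D a)%E by rewrite mule_ge0 ?lee_fin.
have mrG : measurable_fun setT (fun a => (r ^+ n.+1)%:E * G a)%E by exact: emeasurable_funM.
have mrD : measurable_fun setT (fun a => (r ^+ n.+2)%:E * D a)%E by exact: emeasurable_funM.
rewrite ge0_integralD//; last 4 first.
- by move=> a _; exact: mule_ge0.
- exact: emeasurable_funM.
- by move=> a _; exact: adde_ge0.
- exact: emeasurable_funD.
rewrite ge0_integralZr//.
have <- : MM = (\int[leb]_a m a)%E.
  by rewrite /MM tonelli_rV1//; exact: measurable_EFin_comp.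
rewrite leeD2l// ge0_integralD// !ge0_integralZl ?lee_fin// GE muleA -EFinM -exprSr.
have -> : (\int[mu n.+1]_x (l1grad g x)%:E = \int[leb]_c Hc c + \int[leb]_a D a)%E.
  rewrite tonelli_rV1//; last 2 first.
  - exact: measurable_l1grad.
  - by move=> x; rewrite lee_fin l1grad_ge0.
  rewrite -ge0_integralD//; apply: eq_integral => a _.
  rewrite /Hc /D -ge0_integralD//.
  - by apply: eq_integral => y _; rewrite (l1grad_cons _ _ cg) EFinD.
  - by apply: measurable_EFin_comp; apply: (mcons _ _ (fun x => `|partial ord0 g x|) (fun y => (a, y))) => //; exact: pair1_measurable.
  - by move=> y _; rewrite lee_fin l1grad_ge0.
  - exact: measurable_l1grad.
have i1 : (0 <= \int[leb]_c Hc c)%E by apply: integral_ge0 => c _; exact: H0.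
have i2 : (0 <= \int[leb]_c D c)%E by apply: integral_ge0 => c _; exact: D0.
by rewrite (ge0_muleDr _ i1 i2); exact: lexx.
Qed.

Definition level_ramp n (F : 'rV[R]_n -> R) (t : R) (m : nat) (x : 'rV[R]_n) : R :=
  ramp (m.+1%:R * (F x - t)).

Lemma C1_level_ramp n (F : 'rV[R]_n -> R) t m : C1 F ->
  C1 (level_ramp F t m) /\ forall i x,
  partial i (level_ramp F t m) x = (dramp (m.+1%:R * (F x - t)) * m.+1%:R) * partial i F x.
Proof.
move=> cF.
apply: (@C1_comp R n F (fun s => ramp (m.+1%:R * (s - t))) (fun s => dramp (m.+1%:R * (s - t)) * m.+1%:R)) => //.
- move=> s; apply: cvgM; last exact: cvg_cst.
  apply: (@cvg_comp _ _ _ (fun s : R => m.+1%:R * (s - t)) dramp); last exact: continuous_dramp.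
  apply: cvgM; first exact: cvg_cst.
  by apply: cvgB; [exact: cvg_id|exact: cvg_cst].
- move=> s; apply: (@is_derive1_comp R ramp (fun s => m.+1%:R * (s - t))); first exact: is_derive_ramp.
  have := is_deriveZ (m.+1%:R : R) (is_deriveB (is_derive_id s (1 : R)) (is_derive_cst t s (1 : R))).
  by move=> H; apply: (is_derive_eq H); rewrite subr0 /GRing.scale/= mulr1.
Qed.

Lemma level_ramp01 n (F : 'rV[R]_n -> R) t m x : 0 <= level_ramp F t m x <= 1.
Proof. by rewrite ramp_ge0 ramp_le1. Qed.

Lemma level_ramp_out n (F : 'rV[R]_n -> R) t m x : F x <= t -> level_ramp F t m x = 0.
Proof. by move=> Ft; apply: ramp_le0; rewrite mulr_ge0_le0// subr_le0. Qed.

Lemma l1grad_level_ramp_le n (F : 'rV[R]_n -> R) t m x : C1 F ->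
  l1grad (level_ramp F t m) x <= 2 * (m.+1%:R * \1_(level_slab F t m) x * l1grad F x).
Proof.
move=> cF; have [_ E] := C1_level_ramp t m cF.
rewrite {1}/l1grad; under eq_bigr do rewrite E normrM.
rewrite -mulr_sumr -/(l1grad F x) mulrA ler_wpM2r ?l1grad_ge0//.
rewrite ger0_norm ?mulr_ge0 ?dramp_ge0// indicE.
have [xs|xs] := boolP (x \in _).
  by rewrite mulr1 ler_wpM2r// dramp_le2.
rewrite mulr0 mulr0 dramp_eq0 ?mul0r//; apply: contra xs => /andP[h1 h2]; apply/mem_set.
rewrite /level_slab/=; move: h1; rewrite pmulr_rgt0// subr_gt0 => ->/=.
by rewrite -ltrBlDl -[ltRHS]mulr1 ltr_pdivlMl.
Qed.

Lemma level_ramp_cvg n (F : 'rV[R]_n -> R) t (x : 'rV[R]_n) :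
  level_ramp F t m x @[m --> \oo] --> (\1_(superlevel F t) x : R).
Proof.
rewrite indicE; have [/set_mem xs|xs] := boolP (x \in _); last first.
  have Ft : F x <= t by rewrite leNgt; apply: contra xs => h; exact/mem_set.
  by under eq_fun do rewrite level_ramp_out//; exact: cvg_cst.
have Fx : 0 < F x - t by rewrite subr_gt0.
apply: cvg_near_cst; near=> m; apply: ramp_ge1.
rewrite mulrC -ler_pdivrMl// mulr1 -[leRHS]invrK; apply/ltW.
rewrite ltf_pV2 ?posrE ?invr_gt0//; last first.
near: m; exact: (near_infty_natSinv_lt (PosNum Fx)).
Unshelve. all: by end_near. Qed.

Lemma level_mass_ramp n (F : 'rV[R]_n -> R) t m : C1 F ->
  (\int[mu n]_x (l1grad (level_ramp F t m) x)%:E <= 2%:E * level_mass F t m)%E.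
Proof.
move=> cF; have [cr _] := C1_level_ramp t m cF.
have mF : measurable_fun setT F by apply: continuous_measurable_rV; exact: C1_continuous.
have mS : measurable (level_slab F t m).
  rewrite (_ : level_slab F t m = superlevel F t `&` [set x | F x < t + m.+1%:R^-1]).
    by apply: measurableI => //; apply: measurable_lt_set => //; exact: measurable_cst.
  by apply/seteqP; split => x; rewrite /level_slab/= => /andP.
have mm : measurable_fun setT (fun x => m.+1%:R * \1_(level_slab F t m) x * l1grad F x).
  apply: measurable_funM; first by apply: measurable_funM => //; exact: measurable_indic.
  by apply: continuous_measurable_rV; exact: continuous_l1grad.
rewrite /level_mass -ge0_integralZ_real//; last by move=> x; rewrite !mulr_ge0// l1grad_ge0.
apply: le_integral_pos => [||x|x].
- exact: measurable_l1grad.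
- by apply: measurable_EFin_comp; exact: measurable_funM.
- by rewrite lee_fin l1grad_ge0.
- by rewrite lee_fin; exact: l1grad_level_ramp_le.
Qed.

Lemma superlevel_measurable n (F : 'rV[R]_n -> R) t : continuous F -> measurable (superlevel F t).
Proof.
move=> cF; apply: measurable_lt_set; first exact: measurable_cst.
exact: continuous_measurable_rV.
Qed.

(** Apply [nash_l1] to the level ramps along the infinitely many m whose variation is below
    [theta V], V being the volume. In the limit [r^n V <= V^2 + r^(n+1) theta V]; with
    [r = 1/(2 theta)] the last term is half of the left side, and division by V gives
    [V >= r^n / 2]. *)
Lemma level_volume n (F : 'rV[R]_n -> R) (M theta t : R) : C1 F ->
  superlevel F t `<=` cube n M -> 0 < theta -> ~ slow_levels F theta t ->
  (0 < mu n (superlevel F t))%E /\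
  (((2 * theta)^-1 ^+ n / 2)%:E <= mu n (superlevel F t))%E.
Proof.
move=> cF FM th0 /existsNP[b /not_implyP[bV /forallNP nb]].
have {}nb N : exists2 m, (N <= m)%N & (2%:E * level_mass F t m < b%:E)%E.
  have /existsNP[m /not_implyP[Nm h]] := nb N.
  by exists m => //; rewrite ltNge; exact/negP.
have cF' := C1_continuous cF.
set E := superlevel F t in FM bV *.
have mE : measurable E by exact: superlevel_measurable.
have fE : (mu n E < +oo)%E by exact: sub_cube_lty FM.
have fE' : mu n E \is a fin_num by rewrite ge0_fin_numE.
have b0 : 0 < b.
  have [m _ h] := nb 0; rewrite -lte_fin; apply: le_lt_trans h.
  rewrite mule_ge0// integral_ge0// => x _; rewrite lee_fin !mulr_ge0//.
  exact: l1grad_ge0.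
set V := mu n E in bV fE fE' *.
have V0 : (0 < V)%E.
  rewrite lt0e measure_ge0 andbT; apply/eqP => V0.
  by move: bV; rewrite V0 mule0 lte_fin => /(lt_trans b0); rewrite ltxx.
split => //.
pose r := (2 * theta)^-1.
have r0 : 0 < r by rewrite invr_gt0 mulr_gt0.
pose v := fine V.
have vE : V = v%:E by rewrite fineK.
have v0 : 0 < v by rewrite fine_gt0// V0.
pose g := level_ramp F t.
have sg m : csupp M (g m).
  by move=> x xM; apply: level_ramp_out; rewrite leNgt; apply/negP => h; exact: xM (FM _ h).
have cg m : C1 (g m) by have [] := C1_level_ramp t m cF.
have mg m : measurable_fun setT (g m) by apply: continuous_measurable_rV; exact: C1_continuous.
have cvE (u : nat -> 'rV[R]_n -> R) : (forall m, measurable_fun setT (u m)) ->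
    (forall x, u m x @[m --> \oo] --> (\1_E x : R)) -> (forall m x, 0 <= u m x <= \1_E x) ->
    (\int[mu n]_x (u m x)%:E)%E @[m --> \oo] --> V.
  move=> mu_ cu u01; rewrite /V -integral_indicT//.
  apply: (@dominated_cvg _ _ _ _ _ _ _ _ (fun x => (\1_E x : R)%:E)) => //.
  - by move=> m; exact: measurable_EFin_comp.
  - by move=> x _; apply/fine_cvgP; split; [near=> m|exact: cu].
  - apply/integrableP; split.
      by apply: measurable_EFin_comp; exact: measurable_indic.
    under eq_integral do rewrite gee0_abs ?lee_fin//.
    by rewrite integral_indicT.
  - move=> m x _; have /andP[u0 u1] := u01 m x.
    by rewrite /= lee_fin ger0_norm.
have gE m x : g m x <= \1_E x.
  rewrite indicE; have [_|xs] := boolP (x \in _); first by have /andP[] := level_ramp01 F t m x.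
  by rewrite /g level_ramp_out// leNgt; apply: contra xs => h; exact/mem_set.
have c2 : (\int[mu n]_x (g m x ^+ 2)%:E)%E @[m --> \oo] --> V.
  apply: cvE => [m|x|m x]; first exact: measurable_funX.
  - have -> : (\1_E x : R) = \1_E x * \1_E x by rewrite indicE -natrM mulnb andbb.
    by under eq_fun do rewrite expr2; apply: cvgM; exact: level_ramp_cvg.
  - rewrite sqr_ge0/= (le_trans _ (gE m x))// expr2 ler_piMr//;
      by have /andP[] := level_ramp01 F t m x.
have gV m : (\int[mu n]_x (g m x)%:E <= V)%E.
  rewrite /V -integral_indicT//; apply: le_integral_pos => [||x|x].
  - exact: measurable_EFin_comp.
  - by apply: measurable_EFin_comp; exact: measurable_indic.
  - by rewrite lee_fin; have /andP[] := level_ramp01 F t m x.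
  - by rewrite lee_fin.
have main : r ^+ n * v <= v * v + r ^+ n.+1 * (theta * v).
  rewrite leNgt; apply/negP => contra_.
  have c3 : ((r ^+ n)%:E * \int[mu n]_x (g m x ^+ 2)%:E)%E @[m --> \oo] --> (r ^+ n * v)%:E.
    by rewrite EFinM -vE; apply: cvgeZl.
  have /fine_cvgP[[N1 _ HN1] c3'] := c3.
  have /cvgr_gt/(_ _ contra_)[N _ HN] := c3'.
  have [m Nm bm] := nb (maxn N N1).
  have := HN m (leq_trans (leq_maxl _ _) Nm); rewrite /= ltNge => /negP; apply.
  have h1 := HN1 m (leq_trans (leq_maxr _ _) Nm).
  rewrite -lee_fin fineK//.
  apply: (le_trans (nash_l1 r0 (cg m) (sg m) (level_ramp01 F t m))).
  rewrite EFinD EFinM -vE; apply: leeD.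
    by apply: lee_pmul => //; apply: integral_ge0 => x _; rewrite lee_fin; have /andP[] := level_ramp01 F t m x.
  rewrite EFinM; apply: lee_wpmul2l; first by rewrite lee_fin exprn_ge0// ltW.
  apply: (le_trans (level_mass_ramp t m cF)); apply: ltW; apply: (lt_trans bm).
  by move: bV; rewrite vE -EFinM.
rewrite vE lee_fin.
have rn0 : 0 < r ^+ n by rewrite exprn_gt0.
have : r ^+ n <= v + r ^+ n.+1 * theta.
  by rewrite -(ler_pM2r v0) mulrDl -mulrA.
rewrite exprSr -mulrA; have -> : r * theta = 2^-1 by rewrite /r; field; rewrite gt_eqF.
rewrite -/r; lra.
Unshelve. all: by end_near. Qed.


End nash.

(** * Cutoffs of grid cells *)

Section grid.
Context {R : realType}.
Local Notation mu := (lebesgue_rV R).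
Local Notation leb := (@lebesgue_measure R).

Lemma ramp_cvg (y : R) : ramp (m.+1%:R * y) @[m --> \oo] --> ((0 < y)%R%:R : R).
Proof.
have [y0|y0] := ltP 0 y; last first.
  apply: cvg_near_cst; near=> m; apply: ramp_le0.
  by rewrite mulr_ge0_le0.
apply: cvg_near_cst; near=> m; apply: ramp_ge1.
rewrite mulrC -ler_pdivrMl// mulr1 -[leRHS]invrK; apply/ltW.
rewrite ltf_pV2 ?posrE ?invr_gt0//.
near: m; exact: (near_infty_natSinv_lt (PosNum y0)).
Unshelve. all: by end_near. Qed.

Definition ind01 (z : R) : R := \1_(`]0, 1[%classic : set R) z.

Lemma ind01E z : ind01 z = (0 < z < 1)%R%:R.
Proof.
rewrite /ind01 indicE; congr (_%:R); congr nat_of_bool.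
by apply/idP/idP => [/set_mem|h]; [|apply/mem_set]; rewrite /= in_itv.
Qed.

Lemma ind01_ge0 z : 0 <= ind01 z. Proof. by rewrite ind01E. Qed.

Lemma dramp_le_ind (z : R) : dramp z <= 2 * ind01 z.
Proof.
rewrite ind01E; case: (boolP (0 < z < 1)) => [_|h]; first by rewrite mulr1 dramp_le2.
by rewrite dramp_eq0// mulr0.
Qed.

Definition cutoff (k sigma s : R) (j : nat) (y : R) := ramp (k * (y - sigma - j%:R * s)).
(** A difference of consecutive cutoffs, so that the cells along an axis telescope and their sum
    never exceeds 1. The limit for large [k] is the indicator of a left-open, right-closed
    interval. *)
Definition cell1 (k sigma s : R) (j : nat) (y : R) := cutoff k sigma s j y - cutoff k sigma s j.+1 y.
Definition dcell1 (k sigma s : R) (j : nat) (y : R) :=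
  k * dramp (k * (y - sigma - j%:R * s)) - k * dramp (k * (y - sigma - j.+1%:R * s)).

Section cell1.
Variables (k sigma s : R).
Hypotheses (k0 : 0 < k) (s0 : 0 < s).

Lemma is_derive_cutoff c y :
  is_derive y (1 : R) (fun y => ramp (k * (y - sigma - c))) (k * dramp (k * (y - sigma - c))).
Proof.
rewrite mulrC; apply: (@is_derive1_comp R ramp (fun s => k * (s - sigma - c))).
  exact: is_derive_ramp.
have H := is_deriveZ (k : R) (is_deriveB (is_deriveB (is_derive_id y (1 : R))
  (is_derive_cst sigma y (1 : R))) (is_derive_cst c y (1 : R))).
by apply: (is_derive_eq H); rewrite !subr0 /GRing.scale/= mulr1.
Qed.

Lemma is_derive_cell1 j y : is_derive y (1 : R) (cell1 k sigma s j) (dcell1 k sigma s j y).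
Proof. exact: (is_deriveB (is_derive_cutoff _ y) (is_derive_cutoff _ y)). Qed.

Lemma continuous_dcell1 j : continuous (dcell1 k sigma s j).
Proof.
have H c : continuous (fun y => k * dramp (k * (y - sigma - c))).
  move=> y; apply: cvgM; first exact: cvg_cst.
  apply: (@cvg_comp _ _ _ (fun y : R => k * (y - sigma - c)) dramp); last exact: continuous_dramp.
  apply: cvgM; first exact: cvg_cst.
  apply: cvgB; last exact: cvg_cst.
  by apply: cvgB; [exact: cvg_id|exact: cvg_cst].
by move=> y; apply: cvgB; exact: H.
Qed.

Lemma cell1_ge0 j y : 0 <= cell1 k sigma s j y.
Proof.
rewrite subr_ge0; apply: ramp_nd; rewrite ler_pM2l// lerD2l lerN2.
by rewrite ler_pM2r// ler_nat.
Qed.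

Lemma sum_cell1 N y : \sum_(j < N) cell1 k sigma s j y <= 1.
Proof.
have -> : \sum_(j < N) cell1 k sigma s j y = cutoff k sigma s 0 y - cutoff k sigma s N y.
  elim: N => [|N IH]; first by rewrite big_ord0 subrr.
  by rewrite big_ord_recr/= IH /cell1; ring.
by have := ramp_le1 (k * (y - sigma - 0%:R * s)); have := ramp_ge0 (k * (y - sigma - N%:R * s));
  rewrite /cutoff; lra.
Qed.

Lemma cell1_le1 j y : cell1 k sigma s j y <= 1.
Proof.
by have := ramp_le1 (k * (y - sigma - j%:R * s)); have := ramp_ge0 (k * (y - sigma - j.+1%:R * s));
  rewrite /cell1 /cutoff; lra.
Qed.

Lemma dcell1_le j y : `|dcell1 k sigma s j y| <=
  2 * k * (ind01 (k * (y - sigma - j%:R * s)) + ind01 (k * (y - sigma - j.+1%:R * s))).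
Proof.
rewrite /dcell1; set z1 := k * (y - sigma - j%:R * s); set z2 := k * (y - sigma - j.+1%:R * s).
apply: (le_trans (ler_normB _ _)); rewrite !normrM !(gtr0_norm k0) !ger0_norm ?dramp_ge0//.
have h1 : k * dramp z1 <= k * (2 * ind01 z1) by rewrite ler_pM2l// dramp_le_ind.
have h2 : k * dramp z2 <= k * (2 * ind01 z2) by rewrite ler_pM2l// dramp_le_ind.
by lra.
Qed.

Lemma sum_dcell1 N y : \sum_(j < N) `|dcell1 k sigma s j y| <=
  4 * k * \sum_(j < N.+1) ind01 (k * (y - sigma - j%:R * s)).
Proof.
apply: (@le_trans _ _ (\sum_(j < N) 2 * k *
   (ind01 (k * (y - sigma - j%:R * s)) + ind01 (k * (y - sigma - j.+1%:R * s))))).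
  by apply: ler_sum => j _; exact: dcell1_le.
rewrite -mulr_sumr big_split/=.
have h1 : \sum_(j < N) ind01 (k * (y - sigma - j%:R * s)) <=
    \sum_(j < N.+1) ind01 (k * (y - sigma - j%:R * s)).
  by rewrite big_ord_recr/= lerDl ind01_ge0.
have h2 : \sum_(j < N) ind01 (k * (y - sigma - j.+1%:R * s)) <=
    \sum_(j < N.+1) ind01 (k * (y - sigma - j%:R * s)).
  by rewrite [leRHS]big_ord_recl/= lerDr ind01_ge0.
have -> : 4 * k = 2 * k * 2 by ring.
rewrite -[leRHS]mulrA; apply: ler_wpM2l; [by rewrite mulr_ge0 ?(ltW k0)|lra].
Qed.

End cell1.

Lemma cell1_cvg (sigma s : R) j y : 0 < s ->
  cell1 m.+1%:R sigma s j y @[m --> \oo] -->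
    ((sigma + j%:R * s < y <= sigma + j.+1%:R * s)%R%:R : R).
Proof.
move=> s0.
have -> : ((sigma + j%:R * s < y <= sigma + j.+1%:R * s)%R%:R : R) =
   (0 < y - sigma - j%:R * s)%R%:R - (0 < y - sigma - j.+1%:R * s)%R%:R.
  rewrite !subr_gt0 !ltrBrDl leNgt.
  have jj : sigma + j%:R * s < sigma + j.+1%:R * s by rewrite ltrD2l ltr_pM2r// ltr_nat.
  have [h1|h1] := ltP (sigma + j%:R * s) y; have [h2|h2] := ltP (sigma + j.+1%:R * s) y => /=;
    rewrite ?subr0 ?subrr//.
  by have := lt_le_trans (lt_trans jj h2) h1; rewrite ltxx.
by apply: cvgB; exact: ramp_cvg.
Qed.

Lemma continuous_prod n (I : Type) (r : seq I) (P : pred I) (h : I -> 'rV[R]_n -> R) :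
  (forall i, continuous (h i)) -> continuous (fun x => \prod_(i <- r | P i) h i x).
Proof.
move=> ch; elim: r => [|i r IH].
  under eq_fun do rewrite big_nil; exact: cst_continuous.
under eq_fun do rewrite big_cons; case: (P i) => //.
exact: continuousM_R.
Qed.

Lemma C1_prod_coord n (a da : 'I_n -> R -> R) :
  (forall i, continuous (da i)) -> (forall i s, is_derive s (1 : R) (a i) (da i s)) ->
  C1 (fun x : 'rV[R]_n => \prod_i a i (x ord0 i)) /\
  forall l x, partial l (fun x : 'rV[R]_n => \prod_i a i (x ord0 i)) x =
    \prod_i (if i == l then da i (x ord0 i) else a i (x ord0 i)).
Proof.
move=> cda Ha.
have Ci i : C1 (fun x : 'rV[R]_n => a i (x ord0 i)).
  by have [] := C1_coord_fun i (cda i) (Ha i).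
have cdai i : continuous (fun x : 'rV[R]_n => da i (x ord0 i)).
  by move=> x; apply: continuous_comp; [exact: continuous_coord|exact: cda].
apply: C1_of_deriv.
- by apply: (@continuous_prod n _ _ _ (fun i x => a i (x ord0 i))) => i; exact: C1_continuous.
- move=> l x.
  rewrite (_ : (fun x : 'rV[R]_n => _) =
     (fun x : 'rV[R]_n => a l (x ord0 l)) * (fun x : 'rV[R]_n => \prod_(i | i != l) a i (x ord0 i))); last first.
    by apply/funext => y; rewrite (bigD1 l).
  rewrite (bigD1 l)//= eqxx.
  have H1 : is_derive x (ebase l) (fun x : 'rV[R]_n => a l (x ord0 l)) (da l (x ord0 l)).
    apply: is_derive_eq; first exact: (is_derive_comp_R (Ha l (x ord0 l)) (is_derive_coord l l x)).
    by rewrite eqxx mulr1.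
  have H2 : is_derive x (ebase l) (fun x : 'rV[R]_n => \prod_(i | i != l) a i (x ord0 i)) 0.
    have E : x = 0 *: ebase l + x by rewrite scale0r add0r.
    rewrite {1}E; apply/is_derive_line.
    rewrite (_ : (fun t => _) = cst (\prod_(i | i != l) a i (x ord0 i))); first exact: is_derive_cst.
    apply/funext => t; apply: eq_bigr => i il.
    by rewrite lineE ebaseE (negbTE il) mulr0 add0r.
  have := is_deriveM H1 H2 => /is_derive_eq; apply.
  rewrite scaler0 add0r /GRing.scale/= mulrC; congr (_ * _).
  by apply: eq_bigr => i /negbTE ->.
- move=> l; apply: (@continuous_prod n _ _ _ (fun i x => if i == l then da i (x ord0 i) else a i (x ord0 i))) => i.
  by case: (i == l) => //; exact: C1_continuous.
Qed.

(* [0, s] meets ]u, u + d[ in length [clamp d (s - u) - clamp d (- u)], which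
   telescopes along translates by multiples of s. *)
Definition clamp (d v : R) := Num.min (Num.max v 0) d.

Lemma clamp_ge0 d v : 0 <= d -> 0 <= clamp d v.
Proof. by move=> d0; rewrite le_min d0 le_max lexx orbT. Qed.

Lemma clamp_le d v : clamp d v <= d.
Proof. by rewrite ge_min lexx orbT. Qed.

Lemma clamp_nd (s u d : R) : 0 < s -> clamp d (- u) <= clamp d (s - u).
Proof.
move=> s0; have H x y z : x <= y -> Num.min x z <= Num.min y z :> R.
  by move=> xy; rewrite le_min !ge_min xy lexx orbT.
by apply: H; rewrite ge_max !le_max lexx orbT andbT; apply/orP; left; lra.
Qed.

Lemma overlap_arith (s u d : R) : 0 < s -> 0 < d ->
  Num.min s (u + d) - Num.max 0 u <= clamp d (s - u) - clamp d (- u).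
Proof.
move=> s0 d0; rewrite /clamp.
have H1 : Num.min s (u + d) <= s /\ Num.min s (u + d) <= u + d by rewrite !ge_min !lexx orbT.
have H2 : 0 <= Num.max 0 u /\ u <= Num.max 0 u by rewrite !le_max !lexx orbT.
move: H1 H2; move: (Num.min s _) (Num.max 0 u) => A B [A1 A2] [B1 B2].
have [h1|h1] := leP (s - u) 0; have [h2|h2] := leP (- u) 0.
- by rewrite !min_l ?(ltW d0)//; lra.
- by have [h3|h3] := leP (- u) d; rewrite ?min_l ?(ltW d0)//; lra.
- by have [h3|h3] := leP (s - u) d; rewrite ?(min_l (ltW d0)); lra.
- by have [h3|h3] := leP (s - u) d; have [h4|h4] := leP (- u) d; lra.
Qed.

Lemma overlap_le (s u d : R) : 0 < s -> 0 < d ->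
  (\int[leb]_w (\1_(`[0%R, s]%classic : set R) w * \1_(`]u, u + d[%classic : set R) w)%:E <=
   (clamp d (s - u) - clamp d (- u))%:E)%E.
Proof.
move=> s0 d0.
pose a := Num.max 0 u; pose b := Num.min s (u + d).
pose J := `[a, b]%classic : set R.
have mJ : measurable J by exact: measurable_itv.
apply: (@le_trans _ _ (\int[leb]_w (\1_J w)%:E)%E).
  apply: le_integral_pos => [||w|w].
  - by apply: measurable_EFin_comp; apply: measurable_funM; apply: measurable_indic; exact: measurable_itv.
  - by apply: measurable_EFin_comp; exact: measurable_indic.
  - by rewrite lee_fin mulr_ge0.
  - rewrite lee_fin !indicE -natrM mulnb ler_nat.
    case: (boolP (_ && _)) => // /andP[/set_mem h1 /set_mem h2].
    rewrite (_ : w \in J)//; apply/mem_set; move: h1 h2; rewrite /J/= !in_itv/=.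
    move=> /andP[w1 w2] /andP[w3 w4].
    by rewrite ge_max le_min w1 w2 (ltW w3) (ltW w4).
rewrite integral_indicT//.
have := @lebesgue_measure_itv R `[a, b]; rewrite /= lte_fin => ->.
rewrite /a /b /clamp.
case: ifPn => [_|_]; rewrite ?lee_fin ?EFinB ?lee_fin.
  exact: overlap_arith.
by rewrite subr_ge0; exact: clamp_nd.
Qed.

End grid.

(** * Averaging over the position of the grid *)

Section grid_cells.
Context {R : realType}.
Local Notation mu := (lebesgue_rV R).
Local Notation leb := (@lebesgue_measure R).

Lemma limn_einf_le_frequently (u : (\bar R)^nat) (c : \bar R) :
  (forall N, exists2 m, (N <= m)%N & (u m <= c)%E) -> (limn_einf u <= c)%E.
Proof.
move=> H; rewrite limn_einf_sup_einfs; apply: ge_ereal_sup => _ [N _ <-].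
have [m Nm um] := H N.
by apply: (le_trans _ um); apply: ereal_inf_lbound; exists m => /=.
Qed.

Variables (n : nat) (M s : R) (N : nat) (E : set 'rV[R]_n).
Hypotheses (s0 : 0 < s) (mE : measurable E) (fE : (mu n E < +oo)%E).

(** The extra unit puts the points of the cube of size [M] strictly to the right of the first face,
    which belongs to no cell; [w] is the shift over which the grid is averaged. *)
Definition grid_origin (w : R) : R := - M - 1 - w.

(** A pointwise majorant of the total gradient of all cell bumps: each of the [N+1] faces in a
    direction is counted with slope at most [2 (m+1)] for each of the two cells that it
    separates. *)
Definition grid_cost (m : nat) (w : R) (x : 'rV[R]_n) : R :=
  4 * m.+1%:R * \sum_(l < n) \sum_(j < N.+1)
    ind01 (m.+1%:R * (x ord0 l - grid_origin w - j%:R * s)).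

Definition grid_area (m : nat) (w : R) : \bar R :=
  (\int[mu n]_x (\1_E x * grid_cost m w x)%:E)%E.

Lemma grid_cost_ge0 m w x : 0 <= grid_cost m w x.
Proof.
rewrite mulr_ge0// sumr_ge0// => l _; rewrite sumr_ge0// => j _; exact: ind01_ge0.
Qed.

Lemma measurable_grid_cost m : measurable_fun setT
  (fun z : measurableTypeR R * 'rV[R]_n => grid_cost m z.1 z.2).
Proof.
apply: measurable_funM => //; apply: measurable_sum => l; apply: measurable_sum => j.
apply: measurableT_comp; first by apply: measurable_indic; exact: measurable_itv.
apply: measurable_funM => //; apply: measurable_funB => //; apply: measurable_funB.
  apply: (measurableT_comp (measurable_coordR l)); exact: measurable_snd.
by apply: measurable_funB => //; exact: measurable_fst.
Qed.

Lemma measurable_grid_cost_at m w : measurable_fun setT (grid_cost m w).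
Proof. exact: (measurableT_comp (measurable_grid_cost m) (pair1_measurable w)). Qed.

Let f m (z : measurableTypeR R * 'rV[R]_n) : \bar R :=
  (\1_(`[0, s]%classic : set R) z.1 * (\1_E z.2 * grid_cost m z.1 z.2))%:E.

Let mf m : measurable_fun setT (f m).
Proof.
apply: measurable_EFin_comp; apply: measurable_funM.
  by apply: measurableT_comp; [apply: measurable_indic; exact: measurable_itv|exact: measurable_fst].
apply: measurable_funM; last exact: measurable_grid_cost.
by apply: measurableT_comp; [exact: measurable_indic|exact: measurable_snd].
Qed.

Let f0 m z : (0 <= f m z)%E.
Proof. by rewrite lee_fin; apply: mulr_ge0 => //; apply: mulr_ge0 => //; exact: grid_cost_ge0. Qed.

Let mfw m w : measurable_fun setT (fun x => \1_E x * grid_cost m w x).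
Proof. by apply: measurable_funM; [exact: measurable_indic|exact: measurable_grid_cost_at]. Qed.

Lemma grid_area_ge0 m w : (0 <= grid_area m w)%E.
Proof. by apply: integral_ge0 => x _; rewrite lee_fin mulr_ge0// grid_cost_ge0. Qed.

Let fE_area m w : (\int[mu n]_x f m (w, x) = (\1_(`[0%R, s]%classic : set R) w)%:E * grid_area m w)%E.
Proof.
rewrite /f /= ge0_integralZ_real//.
by move=> x; rewrite mulr_ge0// grid_cost_ge0.
Qed.

(** In each direction the strips at the faces are translates by multiples of [s] of an interval of
    length [1/(m+1)]. While [w] runs through [[0, s]], a point spends total time at most [1/(m+1)]
    in them, which cancels the factor [m+1] of the cost. *)
Let averaged_cost_le m x : (\int[leb]_w f m (w, x) <= (4 * n%:R * \1_E x)%:E)%E.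
Proof.
set k : R := m.+1%:R; have k0 : 0 < k by [].
pose h l j w : R := \1_(`[0, s]%classic : set R) w *
  \1_(`](j%:R * s - (x ord0 l + M + 1)), (j%:R * s - (x ord0 l + M + 1)) + k^-1[%classic : set R) w.
have mh l j : measurable_fun setT (h l j).
  by apply: measurable_funM; apply: measurable_indic; exact: measurable_itv.
have h0 l j w : 0 <= h l j w by rewrite mulr_ge0.
have fE' w : f m (w, x) = (\1_E x * (4 * k) * \sum_(l < n) \sum_(j < N.+1) h l j w)%:E.
  rewrite /f /grid_cost; congr (_%:E); rewrite /= mulrCA -!mulrA; congr (_ * _).
  rewrite mulrC -!mulrA; congr (_ * (_ * _)).
  rewrite mulr_suml; apply: eq_bigr => l _; rewrite mulr_suml; apply: eq_bigr => j _.
  rewrite mulrC; congr (_ * _); rewrite ind01E indicE; congr (_%:R); congr nat_of_bool.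
  rewrite /grid_origin; set u : R := j%:R * s - (x ord0 l + M + 1).
  have -> : x ord0 l - (- M - 1 - w) - j%:R * s = w - u by rewrite /u; ring.
  rewrite pmulr_rgt0// subr_gt0 -ltr_pdivlMl// mulr1 [w - u < _]ltrBlDl.
  by apply/idP/idP => [hh|/set_mem]; [apply/mem_set|]; rewrite /= in_itv.
under eq_integral do rewrite fE'.
rewrite ge0_integralZ_real//; first last.
- by move=> w; rewrite sumr_ge0// => l _; rewrite sumr_ge0.
- by apply: measurable_sum => l; apply: measurable_sum => j; exact: mh.
- by rewrite !mulr_ge0// ltW.
apply: (@le_trans _ _ ((\1_E x * (4 * k))%:E * (n%:R * k^-1)%:E)%E); last first.
  rewrite -EFinM lee_fin le_eqVlt; apply/orP; left; apply/eqP; field.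
  by rewrite gt_eqF.
apply: lee_wpmul2l; first by rewrite lee_fin mulr_ge0// mulr_ge0// ltW.
under eq_integral do rewrite -sumEFin.
rewrite ge0_integral_sum//; last 2 first.
- by move=> l; apply: measurable_EFin_comp; apply: measurable_sum => j; exact: mh.
- by move=> l w _; rewrite lee_fin sumr_ge0.
apply: (@le_trans _ _ (\sum_(l < n) (k^-1)%:E)%E); last first.
  by rewrite sumEFin sumr_const card_ord lee_fin -[leLHS]mulr_natl.
apply: lee_sum => l _.
under eq_integral do rewrite -sumEFin.
rewrite ge0_integral_sum//; last 2 first.
- by move=> j; apply: measurable_EFin_comp; exact: mh.
- by move=> j w _; rewrite lee_fin; exact: h0.
set c := x ord0 l + M + 1.
apply: (@le_trans _ _ (\sum_(j < N.+1) (clamp k^-1 (s - (j%:R * s - c)) - clamp k^-1 (- (j%:R * s - c)))%:E)%E).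
  by apply: lee_sum => j _; apply: overlap_le => //; rewrite invr_gt0.
rewrite sumEFin lee_fin.
have -> : \sum_(j < N.+1) (clamp k^-1 (s - (j%:R * s - c)) - clamp k^-1 (- (j%:R * s - c))) =
  clamp k^-1 (s + c) - clamp k^-1 (s - (N.+1%:R * s - c)).
  elim: N.+1 => [|N' IH]; first by rewrite big_ord0 mul0r sub0r opprK subrr.
  rewrite big_ord_recr/= IH; have -> : - (N'%:R * s - c) = s - (N'.+1%:R * s - c) by ring.
  by ring.
have ki : 0 <= k^-1 by rewrite invr_ge0 ltW.
rewrite lerBlDr (le_trans (clamp_le _ _))// lerDl.
exact: clamp_ge0.
Qed.

Lemma grid_area_average m :
  (\int[leb]_(w in `[0%R, s]) grid_area m w <= (4 * n%:R)%:E * mu n E)%E.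
Proof.
rewrite integral_mkcond.
have -> : (\int[leb]_w ((grid_area m) \_ `[0%R, s]) w = \int[leb]_w \int[mu n]_x f m (w, x))%E.
  apply: eq_integral => w _; rewrite fE_area patchE indicE.
  by case: ifPn => _; rewrite ?mul1e ?mul0e.
have := @fubini_tonelli _ _ _ _ _ leb (mu n) (f m) (mf m) (f0 m); rewrite /fubini_F/fubini_G/= => ->.
rewrite -integral_indicT// -ge0_integralZ_real//.
apply: le_integral_pos => [||x|x].
- exact: (@measurable_fun_fubini_tonelli_G _ _ _ _ _ leb (f m) (mf m) (f0 m)).
- by apply: measurable_EFin_comp; apply: measurable_funM => //; exact: measurable_indic.
- by apply: integral_ge0 => w _; exact: f0.
- exact: averaged_cost_le.
Qed.

Lemma measurable_grid_area m : measurable_fun `[0%R, s]%classic (grid_area m).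
Proof.
have := @measurable_fun_fubini_tonelli_F _ _ _ _ _ (mu n)
  (fun z : measurableTypeR R * 'rV[R]_n => (\1_E z.2 * grid_cost m z.1 z.2)%:E).
move=> H; apply: measurable_funTS; apply: H.
  apply: measurable_EFin_comp.
  apply: measurable_funM; last exact: measurable_grid_cost.
  by apply: measurableT_comp; [exact: measurable_indic|exact: measurable_snd].
by move=> z; rewrite lee_fin mulr_ge0// grid_cost_ge0.
Qed.

(** One shift must work for infinitely many m, so choosing a good shift for each m would not do. If
    no [w] worked, the lower limit of the costs would be at least [B] everywhere on [[0, s]], and
    Fatou's lemma with [grid_area_average] would contradict the strict inequality. *)
Lemma grid_shift (J : nat -> \bar R) (b B : R) :
  (forall m, 0 <= J m)%E -> (forall N0, exists2 m, (N0 <= m)%N & (J m <= b%:E)%E) ->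
  (s%:E * b%:E + (4 * n%:R)%:E * mu n E < (s * B)%:E)%E ->
  exists2 w, w \in `[0, s] &
    forall N0, exists2 m, (N0 <= m)%N & (J m + grid_area m w <= B%:E)%E.
Proof.
move=> J0 Jb bB; apply: contrapT => H.
have H' w : w \in `[0, s] -> (B%:E <= limn_einf (fun m => J m + grid_area m w)%E)%E.
  move=> ws; apply: limn_einf_ge_eventually => b' b'B.
  apply: contrapT => hN; apply: H; exists w => // N0; apply: contrapT => hm.
  apply: hN; exists N0 => m Nm; rewrite leNgt; apply/negP => h; apply: hm.
  by exists m => //; apply: ltW; apply: (lt_trans h); rewrite lte_fin.
have mI : measurable (`[0, s]%classic : set R) by exact: measurable_itv.
have lI : leb `[0, s]%classic = s%:E.
  by have := @lebesgue_measure_itv R `[0, s]; rewrite /= lte_fin s0 => ->; rewrite oppr0 adde0.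
have mJ m : measurable_fun `[0%R, s]%classic (fun w => J m + grid_area m w)%E.
  by apply: emeasurable_funD; [exact: measurable_cst|exact: measurable_grid_area].
have J0' m w : (0 <= J m + grid_area m w)%E by rewrite adde_ge0// grid_area_ge0.
have h1 : ((s * B)%:E <= \int[leb]_(w in `[0%R, s]) limn_einf (fun m => J m + grid_area m w))%E.
  have [B0|B0] := leP 0 B; last first.
    apply: (@le_trans _ _ 0%E); first by rewrite lee_fin nmulr_lle0// ltW.
    apply: integral_ge0 => w _; apply: (@limn_einf_ge_eventually R _ 0) => b' b'0.
    by exists 0 => m _; apply: (le_trans _ (J0' m w)); rewrite lee_fin ltW.
  have -> : (s * B)%:E = (\int[leb]_(w in `[0%R, s]) B%:E)%E.
    rewrite integral_cst//; rewrite [X in (_ * X)%E](_ : _ = leb `[0, s]%classic)// lI.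
    by rewrite -EFinM mulrC.
  apply: ge0_le_integral => //.
  - exact: measurable_limn_einf.
have h2 := fatou leb mI mJ (fun m w _ => J0' m w).
have h3 : (limn_einf (fun m => \int[leb]_(w in `[0%R, s]) (J m + grid_area m w)) <=
    s%:E * b%:E + (4 * n%:R)%:E * mu n E)%E.
  apply: limn_einf_le_frequently => N0; have [m Nm Jm] := Jb N0; exists m => //.
  rewrite ge0_integralD//; last 2 first.
  - by move=> w _; exact: grid_area_ge0.
  - exact: measurable_grid_area.
  apply: leeD; last exact: grid_area_average.
  rewrite integral_cst//; rewrite [X in (_ * X)%E](_ : _ = leb `[0, s]%classic)// lI muleC.
  by apply: lee_wpmul2l => //; rewrite lee_fin ltW.
by have := lt_le_trans bB (le_trans h1 (le_trans h2 h3)); rewrite ltxx.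
Qed.

Definition grid_cell (w : R) (J : {ffun 'I_n -> 'I_N}) :=
  [set x : 'rV[R]_n | forall i, (grid_origin w + (J i)%:R * s < x ord0 i <=
     grid_origin w + (J i).+1%:R * s)%R].

Lemma grid_cell_box w J : grid_cell w J = [set x : 'rV[R]_n | forall i,
  (`](grid_origin w + (J i)%:R * s), (grid_origin w + (J i).+1%:R * s)]%classic : set R) (x ord0 i)].
Proof. by apply/seteqP; split => x h i; have := h i; rewrite /= in_itv. Qed.

Lemma measurable_grid_cell w J : measurable (grid_cell w J).
Proof.
rewrite grid_cell_box; apply: (measurable_rV_box (A := fun i => `](grid_origin w + (J i)%:R * s),
  (grid_origin w + (J i).+1%:R * s)]%classic : set R)) => i.
exact: measurable_itv.
Qed.

Lemma grid_cell_volume w J : (mu n (grid_cell w J) = (s ^+ n)%:E)%E.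
Proof.
rewrite grid_cell_box (@lebesgue_rV_box _ n (fun i => `](grid_origin w + (J i)%:R * s),
  (grid_origin w + (J i).+1%:R * s)]%classic)); last by move=> i; exact: measurable_itv.
rewrite (eq_bigr (fun=> s%:E)).
  rewrite -[X in (s ^+ X)%:E]card_ord -prodr_const.
  by elim/big_rec2: _ => // i y1 y2 _ ->; rewrite EFinM.
move=> i _; rewrite lebesgue_measure_itv/= lte_fin ltrD2l ltr_pM2r// ltr_nat ltnSn.
by rewrite -EFinB; congr (_%:E); rewrite -natr1; ring.
Qed.

Lemma grid_cell_disjoint w J J' : J != J' -> grid_cell w J `&` grid_cell w J' = set0.
Proof.
move=> JJ'; apply/seteqP; split => // x [h h']; apply: (elimN eqP JJ').
have aux (j j' : nat) y : grid_origin w + j%:R * s < y -> y <= grid_origin w + j'.+1%:R * s -> (j <= j')%N.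
  move=> h1 h2; have := lt_le_trans h1 h2; rewrite ltrD2l ltr_pM2r// ltr_nat.
  by rewrite ltnS.
apply/ffunP => i; apply/val_inj/eqP; rewrite eqn_leq.
have /andP[a1 a2] := h i; have /andP[b1 b2] := h' i.
by rewrite (aux _ _ _ a1 b2) (aux _ _ _ b1 a2).
Qed.

Lemma grid_cell_cover w x : 0 <= w <= s -> (2 * M + 1 + s <= N%:R * s) -> cube n M x ->
  exists J, grid_cell w J x.
Proof.
clear mE fE; move=> /andP[w0 ws] hN xM.
have H i : exists j : 'I_N, (grid_origin w + j%:R * s < x ord0 i <= grid_origin w + j.+1%:R * s)%R.
  have x1 : 0 < x ord0 i - grid_origin w.
    by have := xM i; rewrite ler_norml /grid_origin => /andP[h1 h2]; lra.
  have x2 : x ord0 i - grid_origin w <= N%:R * s.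
    by have := xM i; rewrite ler_norml /grid_origin => /andP[h1 h2]; lra.
  (* Take the least such [j]. It is positive since the coordinate lies strictly beyond the origin of
     the grid, so the cell has index [j - 1]. *)
  have ex : exists j : nat, x ord0 i - grid_origin w <= j%:R * s by exists N.
  have jN := ex_minnP ex; case: jN => j j1 j2.
  have j0 : (0 < j)%N.
    rewrite lt0n; apply/eqP => j0; move: j1; rewrite j0 mul0r; lra.
  have jN : (j.-1 < N)%N by rewrite prednK// j2.
  exists (Ordinal jN); rewrite /= prednK//; apply/andP; split; last by rewrite -lerBlDl.
  rewrite -ltrBrDl ltNge; apply/negP => h; have := j2 _ h; lia.
have [J HJ] := choice H.
by exists [ffun i => J i] => i; rewrite ffunE.
Qed.

Definition grid_bump (m : nat) (w : R) (J : {ffun 'I_n -> 'I_N}) (x : 'rV[R]_n) : R :=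
  \prod_i cell1 m.+1%:R (grid_origin w) s (J i) (x ord0 i).

Lemma C1_grid_bump m w J : C1 (grid_bump m w J) /\
  forall l x, partial l (grid_bump m w J) x = \prod_i
   (if i == l then dcell1 m.+1%:R (grid_origin w) s (J i) (x ord0 i)
    else cell1 m.+1%:R (grid_origin w) s (J i) (x ord0 i)).
Proof.
apply: (@C1_prod_coord R n (fun i => cell1 m.+1%:R (grid_origin w) s (J i))
  (fun i => dcell1 m.+1%:R (grid_origin w) s (J i))).
- by move=> i; exact: continuous_dcell1.
- by move=> i y; exact: is_derive_cell1.
Qed.

Lemma grid_bump01 m w J x : 0 <= grid_bump m w J x <= 1.
Proof.
rewrite prodr_ge0 => [|i _]; last exact: cell1_ge0.
by apply: prodr_ile1 => i _; rewrite cell1_ge0//= cell1_le1.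
Qed.

Lemma grid_bump_cvg w J x : grid_bump m w J x @[m --> \oo] --> (\1_(grid_cell w J) x : R).
Proof.
have -> : (\1_(grid_cell w J) x : R) = \prod_i (grid_origin w + (J i)%:R * s < x ord0 i <=
     grid_origin w + (J i).+1%:R * s)%R%:R.
  rewrite indicE; have [/set_mem h|h] := boolP (_ \in _).
    by rewrite big1// => i _; rewrite h.
  have /existsNP[i hi] : ~ grid_cell w J x by move=> h'; move: h; rewrite mem_set.
  by rewrite (bigD1 i)//= (negbTE (introN idP hi)) mul0r.
rewrite /grid_bump; elim: (index_enum _) => [|i r IH].
  by rewrite big_nil; under eq_fun do rewrite big_nil; exact: cvg_cst.
rewrite big_cons; under eq_fun do rewrite big_cons.
by apply: cvgM => //; exact: cell1_cvg.
Qed.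

Lemma sum_grid_bump m w x : \sum_J grid_bump m w J x <= 1.
Proof.
rewrite /grid_bump -(bigA_distr_bigA (fun i (j : 'I_N) => cell1 m.+1%:R (grid_origin w) s j (x ord0 i))).
apply: prodr_ile1 => i _; rewrite sum_cell1// andbT sumr_ge0// => j _; exact: cell1_ge0.
Qed.

(** By distributivity the sum over all cells is a product over the coordinates of one-dimensional
    sums: the differentiated coordinate contributes [sum_dcell1], each other one at most 1. *)
Lemma sum_grid_bump_grad m w x :
  \sum_J l1grad (grid_bump m w J) x <= grid_cost m w x.
Proof.
rewrite /l1grad exchange_big/= /grid_cost mulr_sumr; apply: ler_sum => l _.
pose F i (j : 'I_N) : R := if i == l then `|dcell1 m.+1%:R (grid_origin w) s j (x ord0 i)|
   else cell1 m.+1%:R (grid_origin w) s j (x ord0 i).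
have -> : \sum_J `|partial l (grid_bump m w J) x| = \sum_(J : {ffun 'I_n -> 'I_N}) \prod_i F i (J i).
  apply: eq_bigr => J _; have [_ ->] := C1_grid_bump m w J.
  rewrite normr_prod; apply: eq_bigr => i _; rewrite /F.
  by case: (i == l) => //; rewrite ger0_norm// cell1_ge0.
rewrite -bigA_distr_bigA (bigD1 l)//=.
apply: (@le_trans _ _ (\sum_(j < N) F l j)).
  apply: ler_piMr; first by apply: sumr_ge0 => j _; rewrite /F eqxx.
  apply: prodr_ile1 => i /negbTE il; rewrite /F il sum_cell1// andbT sumr_ge0// => j _.
  exact: cell1_ge0.
by rewrite /F eqxx; exact: sum_dcell1.
Qed.

End grid_cells.

(** * Cutting a superlevel set into k pieces *)

Section grid_pieces.
Context {R : realType}.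
Local Notation mu := (lebesgue_rV R).

Lemma l1gradM_le n (f g : 'rV[R]_n -> R) x : C1 f -> C1 g -> 0 <= f x -> 0 <= g x ->
  l1grad (fun x => f x * g x) x <= f x * l1grad g x + g x * l1grad f x.
Proof.
move=> cf cg f0 g0; have [_ E] := C1M cf cg.
rewrite /l1grad !mulr_sumr -big_split/=; apply: ler_sum => i _.
by rewrite E (le_trans (ler_normD _ _))// !normrM (ger0_norm f0) (ger0_norm g0).
Qed.

Lemma powR_root (x : R) n : (0 < n)%N -> 0 <= x -> (x `^ n%:R^-1) ^+ n = x.
Proof.
move=> n0 x0; rewrite -powR_mulrn ?powR_ge0// -powRrM mulVf ?powRr1//.
by rewrite pnatr_eq0 -lt0n.
Qed.

(* With side s, the grid cuts add at most O(n |E| / s) to the area on average over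
   the shift; s is chosen so that one cell has volume at most |E| / (2 k), whence
   k cells are left after discarding those with a large perimeter. *)
Lemma grid_pieces n (F : 'rV[R]_n -> R) (M theta t : R) (k : nat) :
  (0 < n)%N -> (0 < k)%N -> C1 F -> superlevel F t `<=` cube n M -> 0 < theta ->
  ~ slow_levels F theta t ->
  exists E : 'I_k -> set 'rV[R]_n,
  [/\ forall i, measurable (E i) /\ E i `<=` superlevel F t,
      forall i j, i != j -> E i `&` E j = set0 &
      forall i, (0 < mu n (E i))%E /\
        (perimeter (E i) <= (66 * n%:R * k%:R `^ n%:R^-1 * theta)%:E * mu n (E i))%E].
Proof.
move=> n0 k0 cF FM th0 nslow.
have [V0 Vlow] := level_volume cF FM th0 nslow.
move: nslow => /existsNP[b /not_implyP[bV /forallNP nb]].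
have {}nb N : exists2 m, (N <= m)%N & (2%:E * level_mass F t m <= b%:E)%E.
  have /existsNP[m /not_implyP[Nm h]] := nb N.
  by exists m => //; rewrite leNgt; apply/negP => h'; exact: h (ltW h').
have cF' := C1_continuous cF.
set S := superlevel F t in FM bV V0 Vlow *.
have mS : measurable S by exact: superlevel_measurable.
have fS : (mu n S < +oo)%E by exact: sub_cube_lty FM.
pose v : R := fine (mu n S).
have vE : mu n S = v%:E by rewrite fineK// ge0_fin_numE.
have v0 : 0 < v by rewrite fine_gt0// V0.
have kR : 1 <= k%:R :> R by rewrite ler1n.
(* Makes [s^n = r^n / (4 k)]. As [level_volume] gives at least [r^n / 2] for the volume, a cell has
   at most the fraction [1/(2 k)] of it. *)
pose c : R := (4 * k%:R) `^ n%:R^-1.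
have c0 : 0 < c by rewrite powR_gt0// mulr_gt0// (lt_le_trans ltr01).
have cn : c ^+ n = 4 * k%:R by rewrite powR_root// mulr_ge0// (le_trans ler01).
pose r : R := (2 * theta)^-1.
have r0 : 0 < r by rewrite invr_gt0 mulr_gt0.
pose s : R := r / c.
have s0 : 0 < s by rewrite divr_gt0.
have sn : s ^+ n * (4 * k%:R) = r ^+ n.
  by rewrite /s expr_div_n cn mulfVK// gt_eqF// mulr_gt0// (lt_le_trans ltr01).
(* Twice the average density of perimeter, so that [B = lam (v / 2)]: the cells whose quotient
   exceeds [lam] hold at most half of the volume. *)
pose lam : R := 2 * (theta + 4 * n%:R / s).
have lam0 : 0 < lam.
  have h : 0 <= 4 * n%:R / s by apply: divr_ge0; [exact: mulr_ge0|exact: ltW].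
  by rewrite /lam; lra.
pose B : R := (theta + 4 * n%:R / s) * v.
pose N := Num.bound `|(2 * M + 1 + s) / s|.
have hN : 2 * M + 1 + s <= N%:R * s.
  rewrite -ler_pdivrMr//; apply/ltW.
  exact: le_lt_trans (ler_norm _) (archi_boundP (normr_ge0 _)).
have J0 m : (0 <= 2%:E * level_mass F t m)%E.
  by apply: mule_ge0 => //; apply: integral_ge0 => x _; rewrite lee_fin !mulr_ge0 ?l1grad_ge0.
have hB : (s%:E * b%:E + (4 * n%:R)%:E * mu n S < (s * B)%:E)%E.
  rewrite vE -!EFinM -EFinD lte_fin.
  have -> : s * B = s * (theta * v) + 4 * n%:R * v.
    by rewrite /B; field; rewrite gt_eqF.
  by rewrite ltrD2r ltr_pM2l//; move: bV; rewrite vE -EFinM lte_fin.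
have [w ws Bw] := grid_shift M N s0 mS J0 nb hB.
have w01 : 0 <= w <= s by move: ws; rewrite in_itv.
pose E (J : {ffun 'I_n -> 'I_N}) := S `&` grid_cell M s w J.
have mE J : measurable (E J) by apply: measurableI => //; exact: measurable_grid_cell.
have fE J : mu n (E J) \is a fin_num.
  rewrite ge0_fin_numE//; apply: (le_lt_trans _ fS); apply: le_measure; rewrite ?inE//.
  exact: subIsetl.
pose bad J := `[< (lam%:E * mu n (E J) < perimeter (E J))%E >].
(* The zero weight puts the good cells into the first alternative required by [perimeter_family_le],
   so that only bad cells are charged. *)
pose th J : R := if bad J then lam else 0.
pose a J : R := fine (mu n (E J)).
have aE J : mu n (E J) = (a J)%:E by rewrite fineK.
have a0 J : 0 <= a J by exact: fine_ge0.
pose g (J : {ffun 'I_n -> 'I_N}) m x := level_ramp F t m x * grid_bump M s m w J x.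
have cr m : C1 (level_ramp F t m) by have [] := C1_level_ramp t m cF.
have cb m (J : {ffun 'I_n -> 'I_N}) : C1 (grid_bump M s m w J) by have [] := C1_grid_bump M s m w J.
have cg J m : C1 (g J m) by exact: (C1M (cr m) (cb m J)).1.
have r01 m x := level_ramp01 F t m x.
have b01 m (J : {ffun 'I_n -> 'I_N}) x := grid_bump01 M s0 m w J x.
have rS m x : level_ramp F t m x <= \1_S x.
  rewrite indicE; have [_|xs] := boolP (x \in _); first by have /andP[] := r01 m x.
  by rewrite level_ramp_out// leNgt; apply: contra xs => h; exact/mem_set.
have ptw m x : \sum_J l1grad (g J m) x <= l1grad (level_ramp F t m) x + \1_S x * grid_cost M s N m w x.
  apply: (@le_trans _ _ (\sum_J (level_ramp F t m x * l1grad (grid_bump M s m w J) x +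
       grid_bump M s m w J x * l1grad (level_ramp F t m) x))).
    apply: ler_sum => J _; apply: l1gradM_le => //.
      by have /andP[] := r01 m x.
    by have /andP[] := b01 m J x.
  rewrite big_split/= -mulr_sumr -mulr_suml addrC; apply: lerD.
    by rewrite ler_piMl ?l1grad_ge0//; exact: sum_grid_bump.
  apply: ler_pM => //.
  - by have /andP[] := r01 m x.
  - by apply: sumr_ge0 => J _; exact: l1grad_ge0.
  - exact: sum_grid_bump_grad.
have main : (\sum_J (th J)%:E * mu n (E J) <= B%:E)%E.
  apply: (@perimeter_family_le R n _ E g B th) => //.
  - move=> J m x; have /andP[h1 h2] := r01 m x; have /andP[h3 h4] := b01 m J x.
    by rewrite mulr_ge0//= mulr_ile1.
  - move=> J x; have -> : (\1_(E J) x : R) = \1_S x * \1_(grid_cell M s w J) x.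
      by rewrite !indicE in_setI -natrM mulnb.
    by apply: cvgM; [exact: level_ramp_cvg|exact: grid_bump_cvg].
  - move=> N0; have [m Nm hm] := Bw N0; exists m => //; apply: le_trans hm.
    rewrite -ge0_integral_sum//; last 2 first.
    + by move=> J; exact: measurable_l1grad.
    + by move=> J x _; rewrite lee_fin l1grad_ge0.
    have mc : measurable_fun setT (fun x => \1_S x * grid_cost M s N m w x).
      by apply: measurable_funM; [exact: measurable_indic|exact: measurable_grid_cost_at].
    apply: (@le_trans _ _ (\int[mu n]_x ((l1grad (level_ramp F t m) x)%:E +
         (\1_S x * grid_cost M s N m w x)%:E))%E).
      apply: le_integral_pos => [||x|x].
      + by apply: emeasurable_sum => J; exact: measurable_l1grad.
      + by apply: emeasurable_funD; [exact: measurable_l1grad|exact: measurable_EFin_comp].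
      + by apply: sume_ge0 => J _; rewrite lee_fin l1grad_ge0.
      + by rewrite sumEFin -EFinD lee_fin.
    rewrite ge0_integralD//; last 4 first.
    + by move=> x _; rewrite lee_fin l1grad_ge0.
    + exact: measurable_l1grad.
    + by move=> x _; rewrite lee_fin mulr_ge0// grid_cost_ge0.
    + exact: measurable_EFin_comp.
    by apply: leeD; [exact: level_mass_ramp|].
  - move=> J; rewrite /th; case: ifPn => [/asboolP|_]; first by right.
    by left; rewrite mul0e.
have bad_sum : \sum_(J | bad J) a J <= v / 2.
  have : \sum_J th J * a J <= B.
    by rewrite -lee_fin -sumEFin; apply: le_trans main; apply: lee_sum => J _; rewrite aE EFinM.
  rewrite (bigID bad)/= [X in _ + X]big1 => [|J /negbTE hJ]; last by rewrite /th hJ mul0r.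
  rewrite addr0 (eq_bigr (fun J => lam * a J)) => [|J hJ]; last by rewrite /th hJ.
  have BE : B = lam * (v / 2) by rewrite /B /lam; field; rewrite gt_eqF.
  by rewrite -mulr_sumr BE ler_pM2l.
have tot : v <= \sum_J a J.
  rewrite -lee_fin -vE -sumEFin (eq_bigr (fun J => mu n (E J))) => [|J _]; last by rewrite aE.
  apply: measure_cover_le => // x xS; have [J hJ] := grid_cell_cover s0 w01 hN (FM _ xS).
  by exists J.
pose G := [set J | ~~ bad J & 0 < a J]%SET.
have good_sum : v / 2 <= \sum_(J in G) a J.
  have -> : \sum_(J in G) a J = \sum_(J | ~~ bad J) a J.
    rewrite [RHS](bigID (fun J => 0 < a J))/= [X in _ = _ + X]big1 => [|J /andP[_]]; last first.
      by rewrite -leNgt => h; apply/le_anti; rewrite h a0.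
    by rewrite addr0; apply: eq_bigl => J; rewrite inE.
  move: tot; rewrite (bigID bad)/=; lra.
have aS J : a J <= s ^+ n.
  rewrite -lee_fin -aE -(grid_cell_volume M s0 w J); apply: le_measure; rewrite ?inE//.
    exact: measurable_grid_cell.
  exact: subIsetr.
(* The good cells share a volume of at least [v / 2 >= r^n / 4 = k s^n], and each holds at most
   [s^n]. *)
have kG : (k <= #|G|)%N.
  have h1 : v / 2 <= #|G|%:R * s ^+ n.
    apply: (le_trans good_sum); rewrite mulr_natl -sumr_const; exact: ler_sum.
  have sn0 : 0 < s ^+ n by rewrite exprn_gt0.
  rewrite -(ler_nat R) -(ler_pM2r sn0); apply: le_trans h1.
  move: Vlow; rewrite vE lee_fin -/r -sn; lra.
pose Ek (i : 'I_k) := E (enum_val (widen_ord kG i)).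
exists Ek; split.
- by move=> i; split; [exact: mE|exact: subIsetl].
- move=> i j ij; have /(grid_cell_disjoint M s0 w) dJ :
    enum_val (widen_ord kG i) != enum_val (widen_ord kG j).
    by rewrite (inj_eq enum_val_inj); apply: contra ij => /eqP/(congr1 val)/= h; exact/eqP/val_inj.
  by apply/seteqP; split => // x [[_ h1] [_ h2]]; rewrite -dJ; split.
- move=> i; have := enum_valP (widen_ord kG i); rewrite -/(Ek i) inE => /andP[gb ga].
  rewrite /Ek; set J := enum_val _ in gb ga *; split; first by rewrite aE lte_fin.
  apply: (@le_trans _ _ (lam%:E * mu n (E J))%E).
    by rewrite leNgt; apply/negP => h; move: gb => /negP; apply; exact/asboolP.
  apply: lee_wpmul2r => //; rewrite lee_fin.
  have kn1 : 1 <= k%:R `^ n%:R^-1 :> R.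
    apply: (@le_trans _ _ (1 `^ n%:R^-1)); first by rewrite powR1.
    by apply: powR_mono; rewrite ?invr_ge0.
  have c4 : c <= 4 * k%:R `^ n%:R^-1.
    rewrite /c powRM// ler_wpM2r ?powR_ge0//; apply: ler1_powR; first by rewrite ler1n.
    by rewrite invf_le1 ?ler1n ?ltr0n.
  have nR : 1 <= n%:R :> R by rewrite ler1n.
  (* Since [1/s = 2 theta c] and [c <= 4 K], the second term is at most [64 n theta K], and the
     first at most [2 n theta K]; hence 66. *)
  have -> : lam = 2 * theta + 16 * (n%:R * theta * c).
    by rewrite /lam /s /r; field; rewrite !gt_eqF.
  set K := k%:R `^ n%:R^-1 in kn1 c4 *.
  have nt0 : 0 <= n%:R * theta by rewrite mulr_ge0// ltW.
  have h1 : n%:R * theta * c <= n%:R * theta * (4 * K) by rewrite ler_wpM2l.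
  have h2 : theta * 1 <= (n%:R * theta) * K.
    rewrite -[theta * 1]mul1r; rewrite mulr1 mul1r; apply: (@le_trans _ _ (n%:R * theta)).
      by rewrite ler_peMl// ltW.
    by rewrite ler_peMr.
  lra.
Qed.

End grid_pieces.

(** * Components of superlevel sets *)

Section level_components.
Context {R : realType}.

Lemma partial_mvt n (f : 'rV[R]_n -> R) (i : 'I_n) (x : 'rV[R]_n) (h : R) : C1 f ->
  exists2 c : R, 0 <= c <= 1 &
    f (h *: ebase i + x) - f x = h * partial i f ((c * h) *: ebase i + x).
Proof.
move=> cf.
pose g (s : R) := f (s *: ebase i + x).
have dg (s : R) : is_derive s (1 : R) g (partial i f (s *: ebase i + x)).
  by apply/is_derive_line; exact: C1_is_derive.
have cg a b : {within `[a, b], continuous g}.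
  apply: continuous_subspaceT => s; apply: differentiable_continuous.
  by apply/derivable1_diffP; have [] := dg s.
have g0 : g 0 = f x by rewrite /g scale0r add0r.
have [h0|h0] := leP 0 h.
- have [c] := MVT_segment h0 (fun s _ => dg s) (@cg 0 h).
  rewrite in_itv/= => /andP[c0 ch]; rewrite g0 subr0 => E.
  have [h00|h00] := eqVneq h 0.
    exists 0; first by rewrite lexx ler01.
    by rewrite -/(g h) E h00 mulr0 mul0r.
  have hp : 0 < h by rewrite lt_def h00.
  exists (c / h); first by rewrite divr_ge0//= ler_pdivrMr// mul1r.
  by rewrite -/(g h) E divfK// mulrC.
- have [c] := MVT_segment (ltW h0) (fun s _ => dg s) (@cg h 0).
  rewrite in_itv/= => /andP[c0 ch]; rewrite g0 sub0r => E.
  exists (c / h); first by rewrite ler_ndivlMr// mul0r ch ler_ndivrMr// mul1r.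
  by rewrite -/(g h) divfK ?lt_eqF// -opprB E mulrN opprK mulrC.
Qed.

Definition rbox n (y : 'rV[R]_n) (e : R) :=
  [set z : 'rV[R]_n | forall i, `|z ord0 i - y ord0 i| < e].

Lemma rbox_center n (y : 'rV[R]_n) e : 0 < e -> rbox y e y.
Proof. by move=> e0 i; rewrite subrr normr0. Qed.

Lemma nbhs_rbox n (y : 'rV[R]_n) e : 0 < e -> nbhs y (rbox y e).
Proof. by move=> e0; apply/nbhs_rVP; exists e. Qed.

Lemma segment_component n (A : set 'rV[R]_n) (z v : 'rV[R]_n) :
  (forall s : R, 0 <= s <= 1 -> A (s *: v + z)) -> connected_component A z (v + z).
Proof.
move=> sA.
apply: (@connected_component_max _ A ((fun s : R => s *: v + z) @` `[0, 1])).
- by exists 0 => /=; rewrite ?in_itv/= ?lexx ?ler01// scale0r add0r.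
- by move=> _ [s + <-]; rewrite /= in_itv/= => /sA.
- apply: connected_continuous_connected; first exact: segment_connected.
  apply: continuous_subspaceT; apply: continuous_rV => i s.
  have -> : (fun t : R => (t *: v + z) ord0 i) = (fun t => t * v ord0 i + z ord0 i).
    by apply/funext => t; exact: lineE.
  by apply: cvgD; [apply: cvgMl; exact: cvg_id|exact: cvg_cst].
- by exists 1 => /=; rewrite ?in_itv/= ?lexx ?ler01// scale1r.
Qed.

Lemma norm_conv_lt (s x y e : R) : 0 <= s -> s <= 1 -> `|x| < e -> `|y| < e ->
  `|s * x + (1 - s) * y| < e.
Proof.
move=> s0 s1 xe ye; pose m := Num.max `|x| `|y|.
have me : m < e by rewrite gt_max xe.
apply: le_lt_trans me; rewrite (le_trans (ler_normD _ _))// !normrM.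
rewrite (ger0_norm s0) (@ger0_norm _ (1 - s)) ?subr_ge0//.
have -> : m = s * m + (1 - s) * m by ring.
by apply: lerD; apply: ler_wpM2l; rewrite ?subr_ge0// le_max lexx ?orbT.
Qed.

Lemma rbox_component n (A : set 'rV[R]_n) (y a b : 'rV[R]_n) (e : R) :
  rbox y e `<=` A -> rbox y e a -> rbox y e b -> connected_component A a b.
Proof.
move=> eA ea eb; have -> : b = (b - a) + a by rewrite subrK.
apply: segment_component => s /andP[s0 s1]; apply: eA => i.
rewrite lineE !mxE.
have -> : s * (b ord0 i - a ord0 i) + a ord0 i - y ord0 i =
  s * (b ord0 i - y ord0 i) + (1 - s) * (a ord0 i - y ord0 i) by ring.
exact: norm_conv_lt.
Qed.

(** At a point of the level, some partial derivative keeps a strict sign nearby. Moving along that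
    axis in the increasing direction never leaves the superlevel set, and it brings every nearby
    point of the set into one fixed box around [p] where [F > t]. *)
Lemma level_local n (F : 'rV[R]_n -> R) (t : R) (y : 'rV[R]_n) : C1 F -> t <= F y ->
  (F y = t -> exists i, partial i F y != 0) ->
  exists (U : set 'rV[R]_n) (p : 'rV[R]_n), nbhs y U /\
    forall z, U z -> superlevel F t z -> connected_component (superlevel F t) p z.
Proof.
move=> cF ty reg; have cF' := C1_continuous cF.
have nA z : t < F z -> exists2 e : R, 0 < e & rbox z e `<=` superlevel F t.
  move=> tz; suff /nbhs_rVP : nbhs z (superlevel F t) by [].
  exact: (cF' z _ (lt_nbhsr tz)).
move: ty; rewrite le_eqVlt => /predU1P[ty|ty]; last first.
  have [e e0 eA] := nA _ ty; exists (rbox y e), y; split; first exact: nbhs_rbox.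
  by move=> z ze _; apply: (rbox_component eA) => //; exact: rbox_center.
have [i di] := reg (esym ty).
pose sg := Num.sg (partial i F y).
have sg2 : sg * sg = 1 by rewrite -expr2 sqr_sg di.
have sgd : 0 < sg * partial i F y by rewrite /sg -normrEsg normr_gt0.
have nsg : `|sg| = 1 by rewrite normr_sg di.
have [e e0 ed] : exists2 e : R, 0 < e &
    forall z, rbox y e z -> 0 < sg * partial i F z.
  have cd : continuous (fun z => sg * partial i F z).
    by apply: continuousM_R; [exact: cst_continuous|exact: C1_partial_continuous].
  by have /nbhs_rVP[e e0 h] := cd y _ (lt_nbhsr sgd); exists e.
have [h h0 he] : exists2 h : R, 0 < h & h < e by exists (e / 2); lra.
pose p := (sg * h) *: ebase i + y.
have tp : t < F p.
  have [c /andP[c0 c1] E] := partial_mvt i y (sg * h) cF.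
  rewrite -subr_gt0 ty E mulrAC pmulr_lgt0//; apply: ed => j.
  rewrite lineE ebaseE addrK !normrM nsg mul1r (ger0_norm c0) (gtr0_norm h0).
  by case: (j == i); rewrite ?normr1 ?normr0; nra.
have [e1 e10 eA] := nA _ tp.
pose r := Num.min e1 h; have r0 : 0 < r by rewrite lt_min e10.
have re1 : r <= e1 by rewrite ge_min lexx.
have rh : r <= h by rewrite ge_min lexx orbT.
exists (rbox y r), p; split; first exact: nbhs_rbox.
move=> z zr Az.
pose d := sg * (z ord0 i - y ord0 i).
have dE : z ord0 i - y ord0 i = sg * d by rewrite /d mulrA sg2 mul1r.
have dr : `|d| < r by rewrite /d normrM nsg mul1r; exact: zr.
have /ltr_normlP[d1 d2] := dr.
(* The length of the move after which the i-th coordinate of [z] agrees with that of [p]. *)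
pose l := h - d; have l0 : 0 <= l by rewrite /l; lra.
apply: connected_component_sym.
apply: (@connected_component_trans _ _ ((sg * l) *: ebase i + z)).
- apply: segment_component => s /andP[s0 s1].
  rewrite scalerA /superlevel/=; apply: lt_le_trans Az _.
  have [c /andP[c0 c1] E] := partial_mvt i z (s * (sg * l)) cF.
  rewrite -subr_ge0 E.
  set w := (_ *: _ + _).
  have : 0 < sg * partial i F w.
    apply: ed => j; rewrite lineE ebaseE.
    have [->|ji] := eqVneq j i; last first.
      by rewrite mulr0 add0r (lt_trans (zr j))//; lra.
    have -> : c * (s * (sg * l)) * 1%:R + z ord0 i - y ord0 i = sg * (c * s * l + d).
      by rewrite -addrA dE mulr1; ring.
    rewrite normrM nsg mul1r.
    have cs0 : 0 <= c * s by rewrite mulr_ge0.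
    have cs1 : c * s <= 1 by rewrite mulr_ile1.
    move: (c * s) cs0 cs1 => u u0 u1; rewrite /l.
    by apply/ltr_normlP; split; nra.
  move=> /ltW hp; have -> : s * (sg * l) * partial i F w = s * l * (sg * partial i F w) by ring.
  by apply: mulr_ge0 => //; exact: mulr_ge0.
- apply: (rbox_component eA); last exact: rbox_center.
  move=> j; rewrite lineE /p lineE ebaseE.
  have [->|ji] := eqVneq j i.
    have -> : sg * l * 1%:R + z ord0 i - (sg * h * 1%:R + y ord0 i) =
      (z ord0 i - y ord0 i) - sg * d by rewrite /l; ring.
    by rewrite dE subrr normr0.
  by rewrite !mulr0 !add0r (lt_le_trans (zr j)).
Qed.

End level_components.

(** * Algebra of smooth functions and gluing of C^1 functions *)

Section smooth_algebra.
Context {R : realType} {n : nat}.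
Implicit Types f g : 'rV[R]_n -> R.

Lemma Ck_continuous k f : Ck k f -> continuous f.
Proof. by case: k => [|k] // []. Qed.

Lemma Ck_C1 k f : Ck k.+1 f -> C1 f.
Proof.
by move=> [cf df]; split=> // i; have [? /Ck_continuous] := df i.
Qed.

Lemma Ck_weaken k f : Ck k.+1 f -> Ck k f.
Proof.
elim: k f => [f []//|k IH f [cf df]]; split=> // i.
by have [? /IH] := df i.
Qed.

Lemma CkD k f g : Ck k f -> Ck k g -> Ck k (fun x => f x + g x).
Proof.
elim: k f g => [f g|k IH f g cf cg]; first exact: continuousD_R.
have [[c d] E] := C1D (Ck_C1 cf) (Ck_C1 cg).
split=> // i; split; first by have [] := d i.
rewrite (_ : partial i _ = fun x => partial i f x + partial i g x); last exact/funext/E.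
by apply: IH; [have [_ h] := cf; have [] := h i|have [_ h] := cg; have [] := h i].
Qed.

Lemma CkM k f g : Ck k f -> Ck k g -> Ck k (fun x => f x * g x).
Proof.
elim: k f g => [f g|k IH f g cf cg]; first exact: continuousM_R.
have [[c d] E] := C1M (Ck_C1 cf) (Ck_C1 cg).
split=> // i; split; first by have [] := d i.
rewrite (_ : partial i _ = fun x => f x * partial i g x + g x * partial i f x); last first.
  exact/funext/E.
apply: CkD; apply: IH; try exact: Ck_weaken.
  by have [_ h] := cg; have [] := h i.
by have [_ h] := cf; have [] := h i.
Qed.

Lemma smooth_cst (c : R) : smooth (fun _ : 'rV[R]_n => c).
Proof.
move=> k; elim: k c => [|k IH] c; first exact: cst_continuous.
have [[ct d] E] := C1_cst n c.
split=> // i; split; first by have [] := d i.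
by rewrite (_ : partial i _ = fun=> 0) //; apply/funext => x; exact: E.
Qed.

Lemma smooth_coord (j : 'I_n) : smooth (fun x : 'rV[R]_n => x ord0 j).
Proof.
case=> [|k]; first exact: continuous_coord.
split; first exact: continuous_coord.
move=> i; split; first by move=> x; have [] := is_derive_coord i j x.
rewrite (_ : partial i _ = fun=> (j == i)%:R); first exact: smooth_cst.
by apply/funext => x; have [_] := is_derive_coord i j x.
Qed.

Lemma smoothD f g : smooth f -> smooth g -> smooth (fun x => f x + g x).
Proof. by move=> sf sg k; exact: CkD. Qed.

Lemma smoothM f g : smooth f -> smooth g -> smooth (fun x => f x * g x).
Proof. by move=> sf sg k; exact: CkM. Qed.

Lemma smooth_sum (I : Type) (r : seq I) (f : I -> 'rV[R]_n -> R) :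
  (forall i, smooth (f i)) -> smooth (fun x => \sum_(i <- r) f i x).
Proof.
move=> sf; elim: r => [|i r IH].
  by under eq_fun do rewrite big_nil; exact: smooth_cst.
by under eq_fun do rewrite big_cons; exact: smoothD.
Qed.

Lemma smooth_C1 f : smooth f -> C1 f.
Proof. by move=> /(_ 1%N). Qed.

Lemma smooth_partial f i : smooth f -> smooth (partial i f).
Proof. by move=> sf k; have [_ h] := sf k.+1; have [] := h i. Qed.

(** Meant for a level ramp cut off to one component, which near each point is either the full ramp
    or zero. *)
Lemma C1_local g :
  (forall y : 'rV[R]_n, exists2 h, C1 h & \forall z \near y, g z = h z) -> C1 g.
Proof.
move=> loc.
have pl (y : 'rV[R]_n) h : (\forall z \near y, g z = h z) ->
    \forall z \near y, forall i, partial i g z = partial i h z.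
  by move=> /nbhs_interior; apply: filterS => z zg i; apply: near_eq_derive.
apply/C1P; split.
- move=> y; have [h ch gh] := loc y; rewrite /continuous_at.
  have -> : g y = h y by exact: nbhs_singleton gh.
  apply: cvg_trans (C1_continuous ch (x := y)).
  have hg : \forall z \near y, h z = g z by apply: filterS gh => z ->.
  exact: near_eq_cvg hg.
- move=> i y; have [h ch gh] := loc y.
  have -> : partial i g y = partial i h y by exact: (nbhs_singleton (pl _ _ gh) i).
  apply: (near_eq_is_derive _ (C1_is_derive i y ch)).
  by apply: filterS gh => z ->.
- move=> i y; have [h ch gh] := loc y; have gh' := pl _ _ gh; rewrite /continuous_at.
  have -> : partial i g y = partial i h y by exact: (nbhs_singleton gh' i).
  have cy : partial i h z @[z --> y] --> partial i h y by exact: C1_partial_continuous ch y.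
  apply: cvg_trans cy.
  have hg : \forall z \near y, partial i h z = partial i g z by apply: filterS gh' => z ->.
  exact: near_eq_cvg hg.
Qed.

End smooth_algebra.

(** * Components of the superlevel set at a regular level *)

Section regular_levels.
Context {R : realType} {n : nat}.
Variables (F : 'rV[R]_n -> R) (t M : R).
Hypotheses (cF : C1 F) (FM : [set x | t <= F x] `<=` cube n M).
Hypothesis regular : forall y, F y = t -> exists i, partial i F y != 0.
Local Notation A := (superlevel F t).
Local Notation component := (connected_component A).

Let cF' := C1_continuous cF.

Let local y : t <= F y -> exists (U : set 'rV[R]_n) (p : 'rV[R]_n), nbhs y U /\
    forall z, U z -> A z -> component p z.
Proof. by move=> ty; apply: level_local => //; exact: regular. Qed.

Lemma superlevel_open : open A.
Proof. exact: (open_comp (fun x _ => cF' (x := x)) (@open_gt _ t)). Qed.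

Lemma compact_level : compact [set x | t <= F x].
Proof.
apply: (subclosed_compact _ (@cube_compact R n M) FM).
exact: (closed_comp (fun x _ => cF' (x := x)) (@closed_ge _ t)).
Qed.

(** [{F >= t}] is compact and each of its points has a neighbourhood meeting at most one component
    of [{F > t}]; a finite subcover bounds their number. *)
Lemma finite_components : finite_set [set component x | x in A].
Proof.
have /choice[Up hUp] : forall y, exists Up : set 'rV[R]_n * 'rV[R]_n, t <= F y ->
    nbhs y Up.1 /\ forall z, Up.1 z -> A z -> component Up.2 z.
  move=> y; have [ty|ty] := boolP (t <= F y); last by exists (set0, 0).
  by have [U [p h]] := local ty; exists (U, p).
have := compact_level; rewrite compact_cover.
move=> /(_ _ [set y | t <= F y] (fun y => (Up y).1°)) [||D' sD cov].
- by move=> y _; exact: open_interior.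
- by move=> y ty; exists y => //; have [h _] := hUp _ ty; exact: nbhs_singleton (nbhs_interior h).
apply: (sub_finite_set _ (finite_image (fun y => component (Up y).2) (finite_fset D'))).
move=> _ [x Ax <-]; have [y yD Uy] := cov x (ltW Ax).
have ty : t <= F y by have /set_mem := sD _ yD.
exists y => //; apply: same_connected_component.
have [_ h] := hUp _ ty; apply: h => //; exact: interior_subset Uy.
Qed.

Lemma component_open x : open (component x).
Proof.
rewrite openE => z xz; have Az := connected_component_sub xz.
have /nbhs_rVP[e e0 eA] : nbhs z A by exact: open_nbhs_nbhs (conj superlevel_open Az).
apply/nbhs_rVP; exists e => // w wz; apply: connected_component_trans xz _.
by apply: (rbox_component eA) => //; exact: rbox_center.
Qed.

(* Near a point of {F = t}, the set {F > t} lies in one component. *)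
Lemma component_ramp_local (x : 'rV[R]_n) m (y : 'rV[R]_n) :
  let g z := level_ramp F t m z * \1_(component x) z in
  (\forall z \near y, g z = level_ramp F t m z) \/ (\forall z \near y, g z = 0).
Proof.
move=> g; have [ty|ty] := leP t (F y); last first.
  right; have : nbhs y (F @^-1` [set z | z < t]) := cF' (lt_nbhsl ty).
  by apply: filterS => z /= zt; rewrite /g level_ramp_out ?mul0r// ltW.
have [U [p [Uy Up]]] := local ty.
have [xp|xp] := pselect (component x p); [left|right]; apply: filterS Uy => z Uz.
- have [tz|tz] := leP (F z) t; first by rewrite /g level_ramp_out ?mul0r.
  rewrite /g indicE mem_set ?mulr1//.
  exact: connected_component_trans xp (Up _ Uz tz).
- have [tz|tz] := leP (F z) t; first by rewrite /g level_ramp_out ?mul0r.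
  rewrite /g indicE memNset ?mulr0// => xz; apply: xp.
  exact: connected_component_trans xz (connected_component_sym (Up _ Uz tz)).
Qed.

Lemma C1_component_ramp x m : C1 (fun z => level_ramp F t m z * \1_(component x) z).
Proof.
apply: C1_local => y; have [h|h] := component_ramp_local x m y.
  by exists (level_ramp F t m) => //; have [] := C1_level_ramp t m cF.
by exists (fun=> 0) => //; have [] := C1_cst n (0 : R).
Qed.

Lemma l1grad_near (f g : 'rV[R]_n -> R) (y : 'rV[R]_n) :
  (\forall z \near y, f z = g z) -> l1grad f y = l1grad g y.
Proof.
by move=> fg; apply: eq_bigr => i _; congr (`|_|); exact: near_eq_derive.
Qed.

Lemma l1grad_cst (c : R) (y : 'rV[R]_n) : l1grad (fun=> c) y = 0.
Proof.
by rewrite /l1grad big1// => i _; have [_ ->] := C1_cst n c; rewrite normr0.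
Qed.

(** Summed over the disjoint components, the right-hand sides do not exceed the gradient of the
    uncut ramp: separating components costs no perimeter. *)
Lemma l1grad_component_ramp x m y :
  l1grad (fun z => level_ramp F t m z * \1_(component x) z) y <=
  \1_(component x) y * l1grad (level_ramp F t m) y.
Proof.
have [xy|xy] := pselect (component x y).
  rewrite indicE mem_set// mul1r.
  by have [/l1grad_near ->|/l1grad_near ->] := component_ramp_local x m y;
    rewrite ?l1grad_cst ?l1grad_ge0.
rewrite indicE memNset// mul0r.
have [Ay|Ay] := pselect (A y).
  rewrite (l1grad_near (g := fun=> 0)) ?l1grad_cst//.
  have : nbhs y (component y).
    apply: open_nbhs_nbhs; split; first exact: component_open.
    exact: connected_component_refl.
  apply: filterS => z yz; rewrite indicE memNset ?mulr0// => xz; apply: xy.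
  exact: connected_component_trans xz (connected_component_sym yz).
have h0 : l1grad (level_ramp F t m) y = 0.
  rewrite /l1grad big1// => i _; have [_ ->] := C1_level_ramp t m cF.
  rewrite dramp_eq0 ?mul0r ?normr0//.
  by rewrite negb_and -leNgt pmulr_rle0// subr_le0 leNgt; apply/orP; left; exact/negP.
by have [/l1grad_near ->|/l1grad_near ->] := component_ramp_local x m y;
  rewrite ?l1grad_cst ?h0.
Qed.

(** By closedness [F z >= t]. If [F z > t], the open component of [z] would meet, hence equal, that
    of [x], and [z] would be interior. *)
Lemma bdry_component x z : bdry (component x) z -> F z = t.
Proof.
move=> [clz nz]; have zt : t <= F z.
  have cl : closed [set x | t <= F x].
    exact: (closed_comp (fun x _ => cF' (x := x)) (@closed_ge _ t)).
  apply: (cl z); apply: closureS clz => w /connected_component_sub; exact: ltW.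
apply/eqP; rewrite eq_le zt andbT leNgt; apply/negP => tz; apply: nz.
have nz : nbhs z (component z).
  apply: open_nbhs_nbhs; split; first exact: component_open.
  exact: connected_component_refl.
have [w [xw zw]] := clz _ nz.
rewrite (same_connected_component (connected_component_trans xw (connected_component_sym zw))).
exact: nz.
Qed.

(** [t - F] is the local defining function: near a boundary point the component is the whole of
    [{F > t}], by [level_local]. The boundary lies in [{F = t}], inside the open set [Omega], and so
    misses the boundary of [Omega]. *)
Lemma component_subdomain Omega x : smooth F -> open Omega ->
  [set x | t <= F x] `<=` Omega -> A x -> smooth_subdomain Omega (component x).
Proof.
move=> sF oO FO Ax; split.
- split; [exact: component_open|exact: component_connected|].
  by exists x; exact: connected_component_refl.
- move=> y by_; have Fy := bdry_component by_.
  have [U [p [Uy Up]]] : exists (U : set 'rV[R]_n) (p : 'rV[R]_n), nbhs y U /\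
    forall z, U z -> A z -> component p z by apply: local; rewrite Fy.
  exists (U°), (fun z => t + (-1) * F z).
  have sps : smooth (fun z : 'rV[R]_n => t + (-1) * F z).
    by apply: smoothD; [|apply: smoothM => //]; exact: smooth_cst.
  split => //.
  + exact: open_interior.
  + have [i di] := regular Fy; apply: contra di => /eqP/(congr1 (fun v : 'rV[R]_n => v ord0 i)).
    rewrite !mxE; have [_ ->] := C1D (C1_cst n t).1 (C1M (C1_cst n (-1 : R)).1 cF).1.
    have [_ ->] := C1_cst n t; have [_ ->] := C1M (C1_cst n (-1 : R)).1 cF.
    have [_ ->] := C1_cst n (-1 : R).
    by move=> h; apply/eqP; lra.
  + have [w [xw Uw]] : component x `&` U !=set0 by have [] := by_; move=> /(_ _ Uy).
    have px := connected_component_trans xw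
      (connected_component_sym (Up _ Uw (connected_component_sub xw))).
    apply/seteqP; split => z /= [].
      move=> xz Uz; split=> //; have : A z := connected_component_sub xz.
      rewrite /superlevel/=; lra.
    move=> Uz Fz; split=> //; apply: connected_component_trans px _.
    by apply: Up; [exact: interior_subset Uz|rewrite /superlevel/=; lra].
- by move=> z /connected_component_sub Az; apply: FO; exact: ltW.
- apply/seteqP; split => // z [/bdry_component Fz [_ nz]]; apply: nz.
  by apply: open_nbhs_nbhs; split => //; apply: FO; rewrite /= Fz.
Qed.

(** Each component of positive volume is a competitor for [cheeger Omega], so its perimeter exceeds
    [theta] times its volume. Were the level not slow, [perimeter_family_le] would bound [theta]
    times the sum of these volumes by [b], against [b < theta mu(A)]. *)
Lemma regular_slow_levels Omega (theta : R) : smooth F -> open Omega ->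
  [set x | t <= F x] `<=` Omega -> 0 < theta -> (theta%:E < cheeger Omega)%E ->
  slow_levels F theta t.
Proof.
move=> sF oO FO th0 thO b bA; apply: contrapT => /forallNP nb.
have {}nb N : exists2 m, (N <= m)%N & (2%:E * level_mass F t m <= b%:E)%E.
  have /existsNP[m /not_implyP[Nm h]] := nb N.
  by exists m => //; rewrite leNgt; apply/negP => h'; exact: h (ltW h').
have /finite_seqP[C CE] := finite_components.
pose I : finType := seq_sub C.
pose E (i : I) : set 'rV[R]_n := val i.
have EC i : exists2 x, A x & E i = component x.
  have : [set` C] (E i) by exact: (valP i).
  by rewrite -CE => -[x Ax Ex]; exists x.
have mE i : measurable (E i).
  by have [x _ ->] := EC i; apply: open_measurable_rV; exact: component_open.
have disj i j z : E i z -> E j z -> i = j.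
  move=> zi zj; apply: val_inj; have [x Ax Ei] := EC i; have [y Ay Ej] := EC j.
  rewrite -/(E i) -/(E j) Ei Ej; apply: same_connected_component.
  by move: zi zj; rewrite Ei Ej => /connected_component_trans h /connected_component_sym /h.
have ind_sum z : \sum_(i : I) \1_(E i) z <= 1 :> R.
  have [[i zi]|/forallNP nz] := pselect (exists i, E i z).
    rewrite (bigD1 i)//= big1 ?addr0 ?indicE ?lern1 ?leq_b1// => j ji.
    by rewrite indicE memNset// => zj; move: ji; rewrite (disj _ _ _ zj zi) eqxx.
  by rewrite big1 => [|i _]; rewrite ?ler01// indicE memNset.
have main : (\sum_(i : I) theta%:E * lebesgue_rV R n (E i) <= b%:E)%E.
  apply: (@perimeter_family_le R n I E (fun i m z => level_ramp F t m z * \1_(E i) z) b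
    (fun=> theta)) => //.
  - by move=> i m; have [x _ ->] := EC i; exact: C1_component_ramp.
  - move=> i m x; have /andP[h1 h2] := level_ramp01 F t m x.
    by rewrite mulr_ge0//= mulr_ile1// indicE lern1 leq_b1.
  - move=> i x; have E1 : (\1_(E i) x : R) = \1_A x * \1_(E i) x.
      have [xE|xE] := pselect (E i x); last by rewrite [\1_(E i) x]indicE memNset// mulr0.
      rewrite [\1_A x]indicE mem_set ?mul1r//; move: xE; have [y _ ->] := EC i.
      exact: connected_component_sub.
    rewrite [X in _ --> (X : R)]E1; apply: cvgM; [exact: level_ramp_cvg|exact: cvg_cst].
  - move=> N; have [m Nm hm] := nb N; exists m => //; apply: le_trans hm.
    apply: le_trans (level_mass_ramp t m cF).
    rewrite -ge0_integral_sum//; last 2 first.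
    + by move=> i; apply: measurable_l1grad; have [x _ ->] := EC i; exact: C1_component_ramp.
    + by move=> i x _; rewrite lee_fin l1grad_ge0.
    apply: le_integral_pos => [||x|x].
    + apply: emeasurable_sum => i; apply: measurable_l1grad.
      by have [x _ ->] := EC i; exact: C1_component_ramp.
    + by apply: measurable_l1grad; have [] := C1_level_ramp t m cF.
    + by apply: sume_ge0 => i _; rewrite lee_fin l1grad_ge0.
    + rewrite sumEFin lee_fin.
      apply: (@le_trans _ _ (\sum_(i : I) \1_(E i) x * l1grad (level_ramp F t m) x)).
        by apply: ler_sum => i _; have [y _ ->] := EC i; exact: l1grad_component_ramp.
      by rewrite -mulr_suml ler_piMl ?l1grad_ge0.
  - move=> i; have [x Ax Ei] := EC i.
    have [E0|E0] := eqVneq (lebesgue_rV R n (E i)) 0%E; [by left; rewrite E0 mule0|right].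
    have : (theta%:E < cheeger_quotient (E i))%E.
      apply: lt_le_trans thO _; apply: ereal_inf_lbound; exists (E i) => //.
      by rewrite Ei; exact: component_subdomain.
    have fE : lebesgue_rV R n (E i) \is a fin_num.
      rewrite ge0_fin_numE//; apply: (sub_cube_lty (M := M) (mE i)).
      by rewrite Ei => z /connected_component_sub Az; apply: FM; exact: ltW.
    have [v vE] : exists v, lebesgue_rV R n (E i) = v%:E.
      by exists (fine (lebesgue_rV R n (E i))); rewrite fineK.
    have v0 : 0 < v by rewrite -lte_fin -vE lt0e E0 measure_ge0.
    by rewrite /cheeger_quotient (negbTE E0) vE inver gt_eqF// lte_pdivlMr.
move: (le_lt_trans main bA); rewrite ltNge => /negP; apply.
rewrite -ge0_sume_distrr//; apply: lee_wpmul2l; first by rewrite lee_fin ltW.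
have mA : measurable A by exact: open_measurable_rV superlevel_open.
apply: measure_cover_le => // z Az.
have zC : component z \in C by have : [set` C] (component z) by rewrite -CE; exists z.
by exists (SeqSub zC : I) => //; exact: connected_component_refl.
Qed.

End regular_levels.

(** * Almost every level is regular *)

Section critical_values.
Context {R : realType}.

(** Go from [x] to [y] by changing one coordinate at a time: the path stays in the cube, and each of
    the n steps is an instance of [partial_mvt]. *)
Lemma C1_lipschitz n (f : 'rV[R]_n -> R) (M L s : R) (x y : 'rV[R]_n) : C1 f ->
  (forall i z, cube n M z -> `|partial i f z| <= L) -> 0 <= s ->
  cube n M x -> cube n M y -> (forall i, `|x ord0 i - y ord0 i| <= s) ->
  `|f y - f x| <= n%:R * (s * L).
Proof.
move=> cf fL s0 xM yM xy.
pose z (k : nat) : 'rV[R]_n := \row_i (if (i < k)%N then y ord0 i else x ord0 i).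
have z0 : z 0%N = x by apply/rowP => i; rewrite mxE.
have zn : z n = y by apply/rowP => i; rewrite mxE ltn_ord.
rewrite -zn -z0 -(@telescope_sumr _ 0 n (f \o z))// big_mkord.
apply: (le_trans (ler_norm_sum _ _ _)).
rewrite mulr_natl -[X in _ *+ X]card_ord -sumr_const; apply: ler_sum => k _ /=.
have -> : z k.+1 = (y ord0 k - x ord0 k) *: ebase k + z k.
  apply/rowP => i; rewrite lineE ebaseE !mxE ltnS.
  have [->|ik] := eqVneq i k; first by rewrite leqnn ltnn mulr1 subrK.
  by rewrite mulr0 add0r leq_eqVlt (inj_eq val_inj) (negbTE ik).
have [c /andP[c0 c1] ->] := partial_mvt k (z k) (y ord0 k - x ord0 k) cf.
rewrite normrM; apply: ler_pM => //; first by rewrite distrC.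
apply: fL => i; rewrite lineE ebaseE !mxE.
have [->|ik] := eqVneq i k; last by rewrite mulr0 add0r; case: ifP => _; [exact: yM|exact: xM].
rewrite ltnn mulr1.
have := xM k; have := yM k; rewrite !ler_norml => /andP[a1 a2] /andP[b1 b2].
by apply/andP; split; nra.
Qed.

(* The image of one of N^n small cubes lies in a box of side O(1/N), so that the
   total volume of the boxes is O(1/N) in dimension n + 1. *)
Lemma null_C1_image n (phi : 'I_n.+1 -> 'rV[R]_n -> R) (M : R) : 0 <= M ->
  (forall c, C1 (phi c)) ->
  exists Z : set 'rV[R]_n.+1, [/\ measurable Z, lebesgue_rV R n.+1 Z = 0%E &
    forall x, cube n M x -> Z (\row_c phi c x)].
Proof.
move=> M0 cphi.
have [L L0 hL] : exists2 L : R, 0 <= L &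
    forall c i z, cube n M z -> `|partial i (phi c) z| <= L.
  have /choice[K hK] : forall ci : 'I_n.+1 * 'I_n, exists K : R, 0 <= K /\
      forall z, cube n M z -> `|partial ci.2 (phi ci.1) z| <= K.
    move=> [c i]; have [K K0 h] := bounded_on_cube M (C1_partial_continuous (i := i) (cphi c)).
    by exists K.
  exists (\sum_ci K ci); first by apply: sumr_ge0 => ci _; have [] := hK ci.
  move=> c i z zM; have [_ /(_ _ zM) h] := hK (c, i); apply: (le_trans h).
  by rewrite (bigD1 (c, i))//= lerDl sumr_ge0// => j _; have [] := hK j.
(* Ensures mesh [s m <= 1], whence [2 M + 1 + s m <= 2 M + 2 = N m * s m], the covering condition of
   [grid_cell_cover]. *)
pose N0 := Num.bound (2 * M + 2).
have N0P : 2 * M + 2 < N0%:R by apply: archi_boundP; lra.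
pose N m := (N0 + m.+1)%N.
have N0R m : 0 < (N m)%:R :> R by rewrite ltr0n /N addnS.
pose s m : R := (2 * M + 2) / (N m)%:R.
have s0 m : 0 < s m by rewrite divr_gt0//; lra.
have s1 m : s m <= 1.
  by rewrite ler_pdivrMr// mul1r (le_trans (ltW N0P))// ler_nat leq_addr.
pose d m : R := n%:R * (s m * L).
have d0 m : 0 <= d m by rewrite /d; apply: mulr_ge0 => //; apply: mulr_ge0 => //; exact: ltW.
pose cell m (J : {ffun 'I_n -> 'I_(N m)}) := grid_cell M (s m) 0 J.
(* A representative in each cell that meets the cube; the derivative bounds hold only inside the
   cube, so a corner of the cell would not do. Other cells get the dummy point 0. *)
have /choice[y hy] : forall mJ : {m : nat & {ffun 'I_n -> 'I_(N m)}}, exists y : 'rV[R]_n,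
    cube n M y /\ forall x, cube n M x -> cell (tag mJ) (tagged mJ) x ->
      cell (tag mJ) (tagged mJ) y.
  move=> [m J] /=; have [[x [xM xJ]]|/forallNP h] := pselect (exists x, cube n M x /\ cell m J x).
    by exists x.
  exists 0; split; first by move=> i; rewrite mxE normr0.
  by move=> x xM xJ; case: (h x).
pose y' m (J : {ffun 'I_n -> 'I_(N m)}) :=
  y (existT (fun m => {ffun 'I_n -> 'I_(N m)}) m J).
have {}hy m J : cube n M (y' m J) /\ forall x, cube n M x -> cell m J x -> cell m J (y' m J).
  exact: hy (existT (fun m => {ffun 'I_n -> 'I_(N m)}) m J).
pose I m (J : {ffun 'I_n -> 'I_(N m)}) c : set R := `[phi c (y' m J) - d m, phi c (y' m J) + d m]%classic.
pose B m (J : {ffun 'I_n -> 'I_(N m)}) := [set z : 'rV[R]_n.+1 | forall c, I m J c (z ord0 c)].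
have mI m J c : measurable (I m J c) by exact: measurable_itv.
have mB m J : measurable (B m J) by exact: measurable_rV_box.
have vB m J : lebesgue_rV R n.+1 (B m J) = ((2 * d m) ^+ n.+1)%:E.
  rewrite lebesgue_rV_box// (eq_bigr (fun=> (2 * d m)%:E)) => [|c _].
    by rewrite prodEFin prodr_const card_ord.
  rewrite /I; have := @lebesgue_measure_itv R `[phi c (y' m J) - d m, phi c (y' m J) + d m].
  rewrite /= lte_fin => ->; have := d0 m; rewrite le_eqVlt => /predU1P[<-|dm].
    by rewrite subr0 addr0 ltxx mulr0.
  by rewrite ifT; [rewrite -EFinD; congr (_%:E); ring|lra].
pose U m := \bigcup_J B m J.
have mU m : measurable (U m).
  by apply: fin_bigcup_measurable => //; exact: finite_finset.
pose D : R := (2 * n%:R * L * (2 * M + 2)) ^+ n.+1.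
have D0 : 0 <= D by rewrite exprn_ge0// !mulr_ge0//; lra.
have vU m : (lebesgue_rV R n.+1 (U m) <= (D / m.+1%:R)%:E)%E.
  apply: (le_trans (measure_cover_le _ (mU m) (mB m) (@subset_refl _ _))).
  rewrite (eq_bigr (fun=> ((2 * d m) ^+ n.+1)%:E)) => [|J _]; last exact: vB.
  rewrite sumEFin lee_fin sumr_const card_ffun !card_ord.
  have -> : 2 * d m = (2 * n%:R * L * (2 * M + 2)) / (N m)%:R.
    by rewrite /d /s; ring.
  rewrite expr_div_n -/D -[leLHS]mulr_natl natrX.
  have Nn : (N m)%:R ^+ n != 0 :> R by rewrite expf_neq0// gt_eqF.
  have -> : (N m)%:R ^+ n * (D / (N m)%:R ^+ n.+1) = D / (N m)%:R.
    by rewrite exprS; field; rewrite Nn gt_eqF.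
  rewrite ler_wpM2l// lef_pV2 ?posrE//.
  by rewrite ler_nat /N leq_addl.
exists (\bigcap_m U m); split.
- exact: bigcap_measurable.
- apply/eqP; rewrite eq_le measure_ge0 andbT.
  have h m : (lebesgue_rV R n.+1 (\bigcap_m U m) <= (D / m.+1%:R)%:E)%E.
    apply: le_trans (vU m); apply: le_measure; rewrite ?inE//; first exact: bigcap_measurable.
    exact: bigcap_inf.
  apply/lee_addgt0Pr => e e0; rewrite add0e.
  pose m := Num.bound (D / e).
  apply: (le_trans (h m)); rewrite lee_fin ler_pdivrMr// mulrC -ler_pdivrMr//.
  apply/ltW/(lt_le_trans (archi_boundP _)); first by rewrite divr_ge0// ltW.
  by rewrite ler_nat leqnSn.
- move=> x xM m _.
  have hN : 2 * M + 1 + s m <= (N m)%:R * s m.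
    by rewrite /s mulrCA divff ?gt_eqF// mulr1; have := s1 m; rewrite /s; lra.
  have w01 : 0 <= (0 : R) <= s m by apply/andP; split => //; exact: ltW.
  have [J xJ] := grid_cell_cover (s0 m) w01 hN xM.
  exists J => // c; rewrite mxE /I/= in_itv/= -ler_distl distrC.
  have [yM /(_ _ xM xJ) yJ] := hy m J.
  apply: (C1_lipschitz (cphi c) (hL c) (ltW (s0 m)) xM yM) => i.
  move: (xJ i) (yJ i) => /andP[h1 h2] /andP[h3 h4].
  have E : (J i).+1%:R * s m = (J i)%:R * s m + s m by rewrite -natr1 mulrDl mul1r.
  rewrite E in h2; rewrite /= E in h4; move: h3 h4 => /= h3 h4.
  by rewrite ler_norml; apply/andP; split; lra.
Qed.

End critical_values.

(** * Quadratic perturbations with almost every level regular *)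

Section perturbation.
Context {R : realType}.
Local Notation leb := (@lebesgue_measure R).

Lemma null_section n (Z : set 'rV[R]_n.+1) : measurable Z -> lebesgue_rV R n.+1 Z = 0%E ->
  {ae lebesgue_rV R n, forall a, {ae leb, forall t, ~ Z (rV_cons (t, a))}}.
Proof.
move=> mZ Z0.
pose g (a : 'rV[R]_n) := (\int[leb]_t (\1_Z (rV_cons (t, a)) : R)%:E)%E.
have mS a : measurable [set t : R | Z (rV_cons (t, a))].
  have m1 : measurable_fun setT (fun t : R => rV_cons (t, a)).
    by apply: measurableT_comp; [exact: measurable_rV_cons|exact: measurable_pair2].
  by rewrite -[X in measurable X]setTI; exact: m1.
have m2 : measurable_fun setT (fun z : R * 'rV[R]_n => (\1_Z (rV_cons z) : R)%:E).
  apply: measurable_EFin_comp; apply: measurableT_comp; first exact: measurable_indic.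
  exact: measurable_rV_cons.
have mg : measurable_fun setT g.
  by apply: (@measurable_fun_fubini_tonelli_G _ _ _ _ _ leb _ m2) => z; rewrite lee_fin.
have g0 a : (0 <= g a)%E by apply: integral_ge0 => t _; rewrite lee_fin.
have ig : (\int[lebesgue_rV R n]_a `|g a| = 0)%E.
  rewrite (eq_integral g) => [|a _]; last by rewrite gee0_abs.
  rewrite -Z0 -(integral_indicT (lebesgue_rV R n.+1) mZ) tonelli_rV2//.
  by apply: measurable_EFin_comp; exact: measurable_indic.
have := (ae_eq_integral_abs (lebesgue_rV R n) measurableT mg).1 ig.
apply: (@filterS _ _ (ae_filter_ringOfSetsType _)) => a /(_ I) ga.
exists [set t : R | Z (rV_cons (t, a))]; split; first exact: mS.
  rewrite -(integral_indicT leb (mS a)) -[RHS]ga; apply: eq_integral => t _.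
  by rewrite !indicE; congr ((nat_of_bool _)%:R%:E); apply/idP/idP => /set_mem h; exact/mem_set.
by move=> t /= /contrapT.
Qed.

Lemma ae_in_rbox n (P : 'rV[R]_n -> Prop) (x : 'rV[R]_n) (e : R) : 0 < e ->
  {ae lebesgue_rV R n, forall a, P a} -> exists2 a, rbox x e a & P a.
Proof.
move=> e0 [N [mN N0 PN]]; apply: contrapT => /forall2NP nP.
have bN : rbox x e `<=` N.
  by move=> a ax; apply: PN => Pa; have [] := nP a.
have E : rbox x e = [set a : 'rV[R]_n | forall i,
    (`](x ord0 i - e), (x ord0 i + e)[%classic : set R) (a ord0 i)].
  by apply/seteqP; split => a h i; have := h i; rewrite /= in_itv/= ltr_distl.
have mB : measurable (rbox x e).
  rewrite E; apply: (measurable_rV_box (A := fun i =>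
    `](x ord0 i - e), (x ord0 i + e)[%classic)) => i.
  exact: measurable_itv.
have : (lebesgue_rV R n (rbox x e) <= 0)%E.
  by rewrite -N0; apply: le_measure; rewrite ?inE.
rewrite leNgt => /negP; apply; rewrite E (lebesgue_rV_box (A := fun i =>
  `](x ord0 i - e), (x ord0 i + e)[%classic)); last by move=> i; exact: measurable_itv.
rewrite (eq_bigr (fun=> (2 * e)%:E)) => [|i _].
  by rewrite prodEFin prodr_const lte_fin exprn_gt0// mulr_gt0.
have := @lebesgue_measure_itv R `]x ord0 i - e, x ord0 i + e[; rewrite /= lte_fin => ->.
by rewrite ifT; [rewrite -EFinD; congr (_%:E); ring|lra].
Qed.

Lemma C1_coord_sum n (h dh : 'I_n -> R -> R) : (forall i, continuous (dh i)) ->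
  (forall i s, is_derive s (1 : R) (h i) (dh i s)) ->
  C1 (fun x : 'rV[R]_n => \sum_i h i (x ord0 i)) /\
  forall i x, partial i (fun x : 'rV[R]_n => \sum_i h i (x ord0 i)) x = dh i (x ord0 i).
Proof.
move=> cdh Hh.
have H (r : seq 'I_n) : C1 (fun x : 'rV[R]_n => \sum_(j <- r) h j (x ord0 j)) /\
  forall i x, partial i (fun x : 'rV[R]_n => \sum_(j <- r) h j (x ord0 j)) x =
    \sum_(j <- r) dh j (x ord0 j) * (j == i)%:R.
  elim: r => [|j r [IH1 IH2]].
    under eq_fun do rewrite big_nil; have [c1 c2] := C1_cst n (0 : R); split=> // i x.
    by rewrite c2 big_nil.
  under eq_fun do rewrite big_cons.
  have [c1 c2] := C1_coord_fun (n := n) j (cdh j) (Hh j).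
  have [d1 d2] := C1D c1 IH1; split=> // i x.
  by rewrite d2 c2 IH2 big_cons.
have [H1 H2] := H (index_enum _); split=> // i x.
rewrite H2 (bigD1 i)//= eqxx mulr1 big1 ?addr0// => j /negbTE ->.
by rewrite mulr0.
Qed.

(** The linear part carries the parameter [a] that makes levels regular. The concave quadratic part
    bounds the tilt above on the whole space when [e > 0], so that adding it creates no high
    superlevel set outside the support of [f]. *)
Definition tilt n (e : R) (a : 'rV[R]_n) (x : 'rV[R]_n) : R :=
  \sum_i (- e * (x ord0 i * x ord0 i) + - a ord0 i * x ord0 i).

Lemma C1_tilt n (e : R) (a : 'rV[R]_n) : C1 (tilt e a) /\
  forall i x, partial i (tilt e a) x = - (2 * e) * x ord0 i - a ord0 i.
Proof.
apply: (@C1_coord_sum n (fun i s => - e * (s * s) + - a ord0 i * s)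
  (fun i s => - (2 * e) * s - a ord0 i)) => [i|i s].
  move=> s; apply: cvgB; last exact: cvg_cst.
  by apply: cvgMr; exact: cvg_id.
apply: (@is_derive_quadratic_error _ _ _ _ (`|e| + 1)); first by rewrite ltr_pwDr.
move=> h.
have -> : - e * ((h + s) * (h + s)) + - a ord0 i * (h + s) -
   (- e * (s * s) + - a ord0 i * s) - (- (2 * e) * s - a ord0 i) * h = - e * h ^+ 2 by ring.
rewrite normrM normrN (ger0_norm (sqr_ge0 _)).
by rewrite ler_wpM2r ?sqr_ge0// lerDl.
Qed.

Lemma smooth_tilt n (e : R) (a : 'rV[R]_n) : smooth (tilt e a).
Proof.
apply: smooth_sum => i; apply: smoothD; apply: smoothM; try exact: smooth_cst.
  by apply: smoothM; exact: smooth_coord.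
exact: smooth_coord.
Qed.

(* [y] is critical for [f + tilt e a] at height [t] only if [(t, a)] is the value
   at [y] of a fixed C^1 map from R^n to R^(n+1). *)
Lemma regular_tilt n (f : 'rV[R]_n -> R) (e r M : R) : smooth f -> 0 <= M -> 0 < r ->
  exists a : 'rV[R]_n, (forall i, `|a ord0 i| < r) /\
    {ae leb, forall t, forall y, cube n M y -> f y + tilt e a y = t ->
      exists i, partial i (fun x => f x + tilt e a x) y != 0}.
Proof.
move=> sf M0 r0.
(* Criticality means that [a] is the gradient of [f] minus [2 e y]. Inserting this in [f + tilt e a]
   turns [- e y_i^2 - a_i y_i] into [e y_i^2 - y_i] times the i-th partial derivative, which depends
   on [y] alone. *)
pose phi (c : 'I_n.+1) (x : 'rV[R]_n) : R := if unlift ord0 c is Some i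
  then partial i f x + (- (2 * e)) * x ord0 i
  else f x + \sum_i (e * (x ord0 i * x ord0 i) + (-1) * (partial i f x * x ord0 i)).
have cphi c : C1 (phi c).
  apply: smooth_C1; rewrite /phi; case: (unlift ord0 c) => [i|].
    apply: smoothD; first exact: smooth_partial.
    by apply: smoothM; [exact: smooth_cst|exact: smooth_coord].
  apply: smoothD => //; apply: smooth_sum => i; apply: smoothD; apply: smoothM;
    try exact: smooth_cst; apply: smoothM; try exact: smooth_coord; exact: smooth_partial.
have [Z [mZ Z0 hZ]] := null_C1_image M0 cphi.
have [a ar aZ] := ae_in_rbox 0 r0 (null_section mZ Z0).
exists a; split; first by move=> i; have := ar i; rewrite mxE subr0.
apply: (@filterS _ _ (ae_filter_ringOfSetsType _)) aZ => t tZ y yM ft.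
apply: contrapT => /forallNP nd; apply: tZ.
suff <- : \row_c phi c y = rV_cons (t, a) by exact: hZ.
have da i : a ord0 i = partial i f y + (- (2 * e)) * y ord0 i.
  have := nd i; have [_ ->] := C1D (smooth_C1 sf) (C1_tilt e a).1.
  have [_ ->] := C1_tilt e a => /negP/negPn/eqP; lra.
apply/rowP => c; rewrite mxE /phi; case: unliftP => [i ->|->].
  by rewrite rV_consES da.
rewrite rV_consE0 -ft; congr (_ + _); apply: eq_bigr => i _; rewrite da; ring.
Qed.

End perturbation.

Section approx_cheeger.
Context {R : realType}.

Lemma approx_slow_cheeger n (Omega : set 'rV[R]_n) (f : 'rV[R]_n -> R) (M theta tau : R) :
  open Omega -> Omega `<=` cube n M -> 1 <= M -> test_function Omega f ->
  0 < theta -> (theta%:E < cheeger Omega)%E -> 0 < tau ->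
  approx_slow f Omega theta tau.
Proof.
move=> oO OM M1 [sf _ fO] th0 thO tau0.
(* On the cube, each coordinate changes the function by at most [e M^2 + e M] and the gradient by at
   most [2 e M + e]; as [M >= 1], both are below [3 e M^2]. Using [n+1] instead of n keeps the
   denominator nonzero. *)
pose e : R := tau / (3 * n.+1%:R * M ^+ 2).
have M0 : 0 < M by lra.
have e0 : 0 < e by rewrite divr_gt0// !mulr_gt0// exprn_gt0.
have eE : 3 * n.+1%:R * e * M ^+ 2 = tau.
  by rewrite /e; field; rewrite gt_eqF//= ?gt_eqF.
have nn : n%:R <= n.+1%:R :> R by rewrite ler_nat.
have neM : n%:R * (3 * e * M ^+ 2) <= tau.
  rewrite -eE; have -> : 3 * n.+1%:R * e * M ^+ 2 = n.+1%:R * (3 * e * M ^+ 2) by ring.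
  by rewrite ler_wpM2r//; apply: mulr_ge0; [lra|exact: sqr_ge0].
have MM : M <= M ^+ 2 by rewrite expr2 ler_peMr// ltW.
have eM1 : e <= e * M ^+ 2 by rewrite ler_peMr//; lra.
have eM : e * M <= e * M ^+ 2 by rewrite ler_pM2l.
have [a [ar reg]] := regular_tilt e sf (ltW M0) e0.
have sF : smooth (fun x => f x + tilt e a x) by apply: smoothD => //; exact: smooth_tilt.
have [cF dF] := C1D (smooth_C1 sf) (C1_tilt e a).1.
have bound (s : 'I_n -> R) : (forall i, `|s i| <= 3 * e * M ^+ 2) -> \sum_i `|s i| <= tau.
  move=> hs; apply: le_trans neM.
  by rewrite mulr_natl -[X in _ *+ X]card_ord -sumr_const; apply: ler_sum.
(* Valid for all [x]: with [|a_i| < e], completing the square gives at most [e / 4] per coordinate.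
   Hence [f + tilt > tau] forces [f] to be nonzero, and the point lies in [Omega]. *)
have out x : tilt e a x <= tau.
  apply: le_trans neM; rewrite mulr_natl -[X in _ *+ X]card_ord -sumr_const.
  apply: ler_sum => i _; apply: (@le_trans _ _ e); last by lra.
  have h1 : - a ord0 i * x ord0 i <= e * `|x ord0 i|.
    by rewrite (le_trans (ler_norm _))// normrM normrN ler_wpM2r// ltW.
  have h2 : x ord0 i * x ord0 i = `|x ord0 i| * `|x ord0 i|.
    by rewrite -!expr2 real_normK ?num_real.
  rewrite h2; move: h1; move: (- a ord0 i * _) `|x ord0 i| => v u h1.
  have h3 : 0 <= e * (u - 1 / 2) ^+ 2 by rewrite mulr_ge0 ?sqr_ge0// ltW.
  have h4 : e * (u - 1 / 2) ^+ 2 = e * (u * u) - e * u + e / 4 by field.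
  rewrite mulNr; lra.
have FO x : tau < f x + tilt e a x -> Omega x.
  move=> h; apply: fO; apply: subset_closure => /=; apply/eqP => fx.
  by move: h; rewrite fx add0r ltNge out.
exists (fun x => f x + tilt e a x); split => //.
- move=> x /OM xM; rewrite addrAC subrr add0r (le_trans (ler_norm_sum _ _ _))//.
  apply: bound => i; rewrite (le_trans (ler_normD _ _))// !normrM !normrN (gtr0_norm e0).
  have := ar i; have := xM i; have := normr_ge0 (x ord0 i); have := normr_ge0 (a ord0 i).
  move: `|x ord0 i| `|a ord0 i| => u v v0 u0 uM ve.
  have h1 : u * u <= M ^+ 2 by rewrite expr2 ler_pM.
  have h2 : e * (u * u) <= e * M ^+ 2 by rewrite ler_pM2l.
  have h3 : v * u <= e * M by rewrite ler_pM// ltW.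
  lra.
- move=> x /OM xM; apply: (@le_trans _ _ (\sum_i (`|partial i f x| + `|partial i (tilt e a) x|))).
    by apply: ler_sum => i _; rewrite dF ler_normD.
  rewrite big_split lerD2l; apply: bound => i.
  have [_ ->] := C1_tilt e a; rewrite (le_trans (ler_normB _ _))// normrM normrN.
  rewrite (gtr0_norm (mulr_gt0 _ e0))//.
  have := ar i; have := xM i; have := normr_ge0 (x ord0 i).
  move: `|x ord0 i| `|a ord0 i| => u v u0 uM ve.
  have h2 : e * u <= e * M by rewrite ler_pM2l.
  lra.
- apply: (@filterS _ _ (ae_filter_ringOfSetsType _)) reg => t rt tt.
  have tO : [set x | t <= f x + tilt e a x] `<=` Omega.
    by move=> x /= h; apply: FO; exact: lt_le_trans h.
  apply: (@regular_slow_levels R n _ t M cF _ _ Omega) => //.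
    by move=> x /tO/OM.
  move=> y Fy; apply: rt => //; apply/OM/FO; rewrite Fy//.
Qed.

End approx_cheeger.

(** * Lower bounds for the Rayleigh quotient *)

Section sobolev_passage.
Context {R : realType} {n : nat}.
Variables (Omega : set 'rV[R]_n) (M p theta : R).
Hypotheses (mO : measurable Omega) (OM : Omega `<=` cube n M) (p1 : 1 < p)
  (theta0 : 0 < theta).
Local Notation mu := (lebesgue_rV R n).

Let p0 : 0 <= p. Proof. exact: ltW (lt_trans ltr01 p1). Qed.

Let fO : (mu Omega < +oo)%E. Proof. exact: sub_cube_lty OM. Qed.

Let mpow (g : 'rV[R]_n -> R) : continuous g ->
  measurable_fun Omega (fun x => (g x `^ p)%:E).
Proof.
move=> cg; apply: measurable_EFin_comp; apply: measurable_powR_comp.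
by apply: measurable_funTS; exact: continuous_measurable_rV.
Qed.

Let fin_pow (g : 'rV[R]_n -> R) : continuous g -> (forall x, 0 <= g x) ->
  (\int[mu]_(x in Omega) (g x `^ p)%:E)%E \is a fin_num.
Proof.
move=> cg g0; apply: integrable_fin_num => //.
have [K K0 hK] := bounded_on_cube M cg.
apply: (bounded_integrable (K := K `^ p)) => //.
  by apply: measurable_powR_comp; exact: continuous_measurable_rV.
move=> x /OM/hK; rewrite !ger0_norm ?powR_ge0// => gK.
exact: powR_mono.
Qed.

Let continuous_posp_comp (f : 'rV[R]_n -> R) : continuous f -> continuous (fun x => posp (f x)).
Proof. by move=> cf x; apply: continuous_comp; [exact: cf|exact: continuous_posp]. Qed.

Lemma sobolev_posp (f : 'rV[R]_n -> R) : C1 f ->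
  (forall tau, 0 < tau <= 1 -> approx_slow f Omega theta tau) ->
  ((theta `^ p)%:E * \int[mu]_(x in Omega) (posp (f x) `^ p)%:E <=
   (sob_cst p)%:E * \int[mu]_(x in Omega) (l1grad f x `^ p)%:E)%E.
Proof.
move=> cf hf; have := slow_levels_sobolev cf mO OM p1 theta0 hf.
have h1 : (\int[mu]_(x in Omega) (posp (f x) `^ p)%:E)%E \is a fin_num.
  apply: fin_pow; first exact/continuous_posp_comp/C1_continuous.
  by move=> x; have [[? ->]|[? ->]] := pospP (f x).
have h2 : (\int[mu]_(x in Omega) (l1grad f x `^ p)%:E)%E \is a fin_num.
  by apply: fin_pow; [exact: continuous_l1grad|exact: l1grad_ge0].
rewrite /Rintegral -lee_fin EFinM [leRHS]EFinM.
by rewrite (fineK h1) (fineK h2).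
Qed.

Lemma test_functionN (f : 'rV[R]_n -> R) :
  test_function Omega f -> test_function Omega (fun x => -1 * f x).
Proof.
move=> [sf cf fO']; have E : supp (fun x => -1 * f x) = supp f.
  rewrite /supp; congr closure; apply/seteqP; split => x /=; by rewrite mulN1r oppr_eq0.
by split; rewrite ?E//; apply: smoothM => //; exact: smooth_cst.
Qed.

Hypothesis slow : forall f, test_function Omega f ->
  forall tau, 0 < tau <= 1 -> approx_slow f Omega theta tau.

(** Only positive levels are seen by the coarea argument. It is applied to [f] and to [- f], which
    have the same l1 gradient; this is the source of the factor 2. *)
Lemma sobolev_test (f : 'rV[R]_n -> R) : test_function Omega f ->
  ((theta `^ p)%:E * \int[mu]_(x in Omega) (`|f x| `^ p)%:E <=
   (2 * sob_cst p)%:E * \int[mu]_(x in Omega) (l1grad f x `^ p)%:E)%E.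
Proof.
move=> tf; have cf : C1 f by have [/smooth_C1] := tf.
have tg := test_functionN tf; have cg : C1 (fun x => -1 * f x) by have [/smooth_C1] := tg.
have lg x : l1grad (fun x => -1 * f x) x = l1grad f x.
  apply: eq_bigr => i _; have [_ ->] := C1M (C1_cst n (-1 : R)).1 cf.
  by have [_ ->] := C1_cst n (-1 : R); rewrite mulr0 addr0 mulN1r normrN.
have h1 := sobolev_posp cf (slow tf).
have := sobolev_posp cg (slow tg).
set V := (X in (_ <= _ * X)%E -> _).
have -> : V = (\int[mu]_(x in Omega) (l1grad f x `^ p)%:E)%E.
  by apply: eq_integral => x _; rewrite lg.
move=> h2.
rewrite (_ : (2 * sob_cst p)%:E = (sob_cst p)%:E + (sob_cst p)%:E)%E; last first.
  by rewrite -EFinD; congr (_%:E); ring.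
have s0 : 0 <= sob_cst p by rewrite !mulr_ge0 ?powR_ge0.
rewrite ge0_muleDl ?lee_fin//.
apply: le_trans (leeD h1 h2).
rewrite -ge0_muleDr; last 2 first.
- by apply: integral_ge0 => x _; rewrite lee_fin powR_ge0.
- by apply: integral_ge0 => x _; rewrite lee_fin powR_ge0.
apply: lee_wpmul2l; first by rewrite lee_fin powR_ge0.
have c1 := continuous_posp_comp (C1_continuous cf).
have c2 := continuous_posp_comp (C1_continuous cg).
rewrite -ge0_integralD//; last 4 first.
- by move=> x _; rewrite lee_fin powR_ge0.
- exact: mpow.
- by move=> x _; rewrite lee_fin powR_ge0.
- exact: mpow.
apply: ge0_le_integral => //.
- apply: mpow => x; apply: continuous_comp; [exact: C1_continuous|exact: norm_continuous].
- by apply: emeasurable_funD; exact: mpow.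
- move=> x _; rewrite -EFinD lee_fin mulN1r.
  have [[h ->]|[h ->]] := pospP (f x).
    by rewrite ger0_norm// lerDl powR_ge0.
  have -> : posp (- f x) = `|f x|.
    by rewrite ler0_norm// /posp; apply/max_idPl; rewrite oppr_ge0.
  by rewrite lerDr powR_ge0.
Qed.

(** The outer [2^p] separates [u] from its approximation; [(2 n)^p] passes from the l1 to the
    Euclidean norm of the gradient, and the inner [2^p] separates [g] from the approximating
    gradient. *)
Definition poincare_cst (p : R) : R := 2 `^ p * (2 * sob_cst p * ((2 * n%:R) `^ p * 2 `^ p)).

Lemma enorm_ge0 (v : 'rV[R]_n) : 0 <= enorm v.
Proof. exact: sqrtr_ge0. Qed.

Lemma measurable_enorm (g : 'rV[R]_n -> 'rV[R]_n) :
  (forall i, measurable_fun Omega (fun x => g x ord0 i)) ->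
  measurable_fun Omega (fun x => enorm (g x)).
Proof.
move=> mg.
rewrite (_ : (fun x => _) = fun x => (\sum_i g x ord0 i ^+ 2) `^ 2^-1); last first.
  by apply/funext => x; rewrite powR12_sqrt// sumr_ge0// => i _; exact: sqr_ge0.
apply: measurable_powR_comp.
by apply: measurable_sum => i; apply: measurable_funX; exact: mg.
Qed.

(** Density: the test functions given by [W1p0] obey [sobolev_test], and the two approximation
    errors [a j] and [b j] are made smaller than any [e / D]. *)
Lemma poincare (u : 'rV[R]_n -> R) (g : 'rV[R]_n -> 'rV[R]_n) : W1p0 p Omega u g ->
  ((theta `^ p)%:E * \int[mu]_(x in Omega) (`|u x| `^ p)%:E <=
   (poincare_cst p)%:E * \int[mu]_(x in Omega) (enorm (g x) `^ p)%:E)%E.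
Proof.
move=> [[[mu_ _] mg_ _] [f [tf fu fg]]].
have mg i : measurable_fun Omega (fun x => g x ord0 i) by have [] := mg_ i.
have cf j : C1 (f j) by have [/smooth_C1] := tf j.
pose K : R := 2 * sob_cst p * ((2 * n%:R) `^ p * 2 `^ p).
have s0 : 0 <= sob_cst p by rewrite !mulr_ge0 ?powR_ge0.
have K0 : 0 <= K by rewrite /K !mulr_ge0 ?powR_ge0.
have KE : poincare_cst p = 2 `^ p * K by [].
pose U := (\int[mu]_(x in Omega) (`|u x| `^ p)%:E)%E.
pose G := (\int[mu]_(x in Omega) (enorm (g x) `^ p)%:E)%E.
have pos (h : 'rV[R]_n -> R) : (0 <= \int[mu]_(x in Omega) (h x `^ p)%:E)%E.
  by apply: integral_ge0 => x _; rewrite lee_fin powR_ge0.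
have mfj j : measurable_fun Omega (f j).
  by apply: measurable_funTS; apply: continuous_measurable_rV; exact: C1_continuous.
have mdf j i : measurable_fun Omega (partial i (f j)).
  by apply: measurable_funTS; apply: continuous_measurable_rV; exact: C1_partial_continuous.
have mEp (h : 'rV[R]_n -> R) : measurable_fun Omega h ->
    measurable_fun Omega (fun x => (h x `^ p)%:E).
  by move=> mh; apply: measurable_EFin_comp; exact: measurable_powR_comp.
pose a j := (\int[mu]_(x in Omega) (`|u x - f j x| `^ p)%:E)%E.
pose b j := (\int[mu]_(x in Omega) (enorm (g x - grad (f j) x) `^ p)%:E)%E.
have split_u j : (U <= (2 `^ p)%:E * (a j + \int[mu]_(x in Omega) (`|f j x| `^ p)%:E))%E.
  have m1 : measurable_fun Omega (fun x => (`|u x - f j x| `^ p)%:E).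
    by apply: mEp; apply: measurableT_comp => //; exact: measurable_funB.
  have m2 : measurable_fun Omega (fun x => (`|f j x| `^ p)%:E).
    by apply: mEp; exact: measurableT_comp.
  rewrite -ge0_integralD//.
  rewrite -ge0_integralZl_EFin//; last 2 first.
  - by move=> x _; rewrite -EFinD lee_fin addr_ge0 ?powR_ge0.
  - exact: emeasurable_funD.
  apply: ge0_le_integral => //.
  - by apply: mEp; exact: measurableT_comp.
  - by apply: measurable_funeM; exact: emeasurable_funD.
  - move=> x _; rewrite -EFinD -EFinM lee_fin.
    apply: le_trans (powRD_le (normr_ge0 _) (normr_ge0 _) p0).
    by apply: powR_mono => //; rewrite -{1}(subrK (f j x) (u x)) ler_normD.
have split_g j : (\int[mu]_(x in Omega) (l1grad (f j) x `^ p)%:E <=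
    ((2 * n%:R) `^ p * 2 `^ p)%:E * (G + b j))%E.
  have m1 : measurable_fun Omega (fun x => (enorm (g x) `^ p)%:E).
    by apply: mEp; exact: measurable_enorm.
  have m2 : measurable_fun Omega (fun x => (enorm (g x - grad (f j) x) `^ p)%:E).
    apply: mEp; apply: measurable_enorm => i.
    rewrite (_ : (fun x => _) = fun x => g x ord0 i - partial i (f j) x); last first.
      by apply/funext => x; rewrite !mxE.
    exact: measurable_funB.
  rewrite -ge0_integralD//; last 2 first.
  - by move=> x _; rewrite lee_fin powR_ge0.
  - by move=> x _; rewrite lee_fin powR_ge0.
  rewrite -ge0_integralZl_EFin//; last 2 first.
  - by move=> x _; rewrite -EFinD lee_fin addr_ge0 ?powR_ge0.
  - exact: emeasurable_funD.
  apply: ge0_le_integral => //.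
  - by move=> x _; rewrite lee_fin powR_ge0.
  - by apply: mpow; exact: continuous_l1grad.
  - by apply: measurable_funeM; exact: emeasurable_funD.
  - move=> x _; rewrite -EFinD -EFinM lee_fin -mulrA.
    have e1 := enorm_ge0 (g x); have e2 := enorm_ge0 (g x - grad (f j) x).
    apply: (@le_trans _ _ ((2 * n%:R * (enorm (g x) + enorm (g x - grad (f j) x))) `^ p)).
      apply: powR_mono => //; first exact: l1grad_ge0.
      apply: (@le_trans _ _ (n%:R * (enorm (g x) + enorm (g x - grad (f j) x)))).
        rewrite mulr_natl -[X in _ *+ X]card_ord -sumr_const; apply: ler_sum => i _.
        have h1 := coord_le_enorm (g x) i.
        have h2 := coord_le_enorm (g x - grad (f j) x) i.
        apply: le_trans (lerD h1 h2); rewrite !mxE.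
        have -> : partial i (f j) x = g x ord0 i - (g x ord0 i - partial i (f j) x) by ring.
        by rewrite (le_trans (ler_normB _ _))// opprB addrCA subrr addr0.
      by rewrite -mulrA ler_peMl// ?ler1n// mulr_ge0// addr_ge0.
    rewrite powRM ?mulr_ge0 ?addr_ge0// ler_wpM2l ?powR_ge0//.
    exact: powRD_le.
have est j : ((theta `^ p)%:E * U <=
    (2 `^ p * theta `^ p)%:E * a j + (2 `^ p * K)%:E * (G + b j))%E.
  apply: (@le_trans _ _ ((theta `^ p)%:E * ((2 `^ p)%:E *
      (a j + \int[mu]_(x in Omega) (`|f j x| `^ p)%:E)))%E).
    by apply: lee_wpmul2l => //; rewrite lee_fin powR_ge0.
  rewrite muleA -EFinM (mulrC (theta `^ p)) ge0_muleDr//; last exact: pos.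
  rewrite leeD2l// EFinM -muleA [leRHS](_ : _ = (2 `^ p)%:E * (K%:E * (G + b j)))%E;
    last by rewrite EFinM muleA.
  apply: lee_wpmul2l; first by rewrite lee_fin powR_ge0.
  apply: (le_trans (sobolev_test (tf j))).
  have -> : K%:E = ((2 * sob_cst p)%:E * ((2 * n%:R) `^ p * 2 `^ p)%:E)%E by rewrite -EFinM.
  rewrite -[leRHS]muleA; apply: lee_wpmul2l; last exact: split_g.
  by rewrite lee_fin mulr_ge0.
apply/lee_addgt0Pr => e e0.
pose D : R := 2 `^ p * theta `^ p + 2 `^ p * K + 1.
have D1 : 0 <= 2 `^ p * theta `^ p by rewrite mulr_ge0 ?powR_ge0.
have D2 : 0 <= 2 `^ p * K by rewrite mulr_ge0 ?powR_ge0.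
have D0 : 0 < D by rewrite /D; lra.
have de0 : 0 < e / D by rewrite divr_gt0.
have small (c : nat -> \bar R) : c j @[j --> \oo] --> 0%E ->
    \forall j \near \oo, (c j <= (e / D)%:E)%E.
  move=> c0; have nb : nbhs (0%E : \bar R) [set x | (x < (e / D)%:E)%E].
    by apply: open_nbhs_nbhs; split; [exact: open_ereal_lt_ereal|rewrite /= lte_fin].
  have h : \forall j \near \oo, (c j < (e / D)%:E)%E := c0 _ nb.
  by apply: filterS h => j; exact: ltW.
have [j [aj bj]] := filter_ex (filterI (small a fu) (small b fg)).
have G0 : (0 <= G)%E by exact: (pos (fun x => enorm (g x))).
have b0 : (0 <= b j)%E by exact: (pos (fun x => enorm (g x - grad (f j) x))).
apply: (le_trans (est j)); rewrite (ge0_muleDr _ G0 b0).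
rewrite -/G KE addeCA leeD2l//.
apply: (@le_trans _ _ ((2 `^ p * theta `^ p)%:E * (e / D)%:E + (2 `^ p * K)%:E * (e / D)%:E)%E).
  by apply: leeD; apply: lee_wpmul2l; rewrite ?lee_fin.
rewrite -!EFinM -EFinD lee_fin -mulrDl mulrA ler_pdivrMr// mulrC ler_pM2l//.
by rewrite /D; lra.
Qed.

(** Adding 1 makes the denominator evidently positive. A function that is not almost everywhere zero
    has a nonzero p-th power integral, so the quotient of [lambda1] is a genuine one. *)
Lemma le_rayleigh : ((theta `^ p / (poincare_cst p + 1))%:E <= lambda1 p Omega)%E.
Proof.
apply: le_ereal_inf_tmp => _ [u [g [W nz ->]]].
have mu_ : measurable_fun Omega u by have [[[]]] := W.
have fin : (\int[mu]_(x in Omega) (`|u x| `^ p)%:E < +oo)%E by have [[[]]] := W.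
pose U := (\int[mu]_(x in Omega) (`|u x| `^ p)%:E)%E.
pose G := (\int[mu]_(x in Omega) (enorm (g x) `^ p)%:E)%E.
have hW : ((theta `^ p)%:E * U <= (poincare_cst p)%:E * G)%E := poincare W.
suff : ((theta `^ p / (poincare_cst p + 1))%:E <= G / U)%E by [].
have U0 : (0 <= U)%E by apply: integral_ge0 => x _; rewrite lee_fin powR_ge0.
have G0 : (0 <= G)%E by apply: integral_ge0 => x _; rewrite lee_fin powR_ge0.
have mup : measurable_fun Omega (fun x => (`|u x| `^ p)%:E).
  by apply: measurable_EFin_comp; apply: measurable_powR_comp; exact: measurableT_comp.
have Un0 : U != 0%E.
  apply/eqP => UE; apply: nz.
  have : (\int[mu]_(x in Omega) `|(`|u x| `^ p)%:E| = 0)%E.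
    by rewrite -[RHS]UE; apply: eq_integral => x _; rewrite gee0_abs// lee_fin powR_ge0.
  move=> /(ae_eq_integral_abs mu mO mup).1.
  apply: (@filterS _ _ (ae_filter_ringOfSetsType _)) => x ux xO.
  have h : `|u x| `^ p = 0 by apply: EFin_inj; exact: ux.
  by apply/eqP; rewrite -normr_eq0 (powR_eq0_eq0 h).
have [v UE] : exists v, U = v%:E by exists (fine U); rewrite fineK// ge0_fin_numE.
clearbody U G.
have v0 : 0 < v by rewrite -lte_fin -UE lt0e Un0.
have P0 : 0 <= poincare_cst p by rewrite !mulr_ge0 ?powR_ge0.
rewrite UE in hW *; rewrite inver gt_eqF// lee_pdivlMr//.
have P1 : 0 < poincare_cst p + 1 by lra.
have : ((theta `^ p * v)%:E <= (poincare_cst p + 1)%:E * G)%E.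
  by apply: (le_trans hW); apply: lee_wpmul2r => //; rewrite lee_fin lerDl.
move=> h.
have -> : ((theta `^ p / (poincare_cst p + 1))%:E * v%:E =
    ((poincare_cst p + 1)^-1)%:E * (theta `^ p * v)%:E)%E.
  by rewrite -!EFinM; congr (_%:E); ring.
have P2 : 0 <= (poincare_cst p + 1)^-1 by rewrite invr_ge0 ltW.
apply: (le_trans (lee_wpmul2l _ h)); first by rewrite lee_fin.
by rewrite muleA -EFinM mulVf ?gt_eqF// mul1e.
Qed.

End sobolev_passage.

(** * Cheeger constants against the first eigenvalue *)

Section cheeger_constants.
Context {R : realType} {n : nat}.
Local Notation mu := (lebesgue_rV R n).
Implicit Types (Omega D E : set 'rV[R]_n).

Lemma test_function_superlevel Omega (f : 'rV[R]_n -> R) (t : R) : 0 <= t ->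
  test_function Omega f -> superlevel f t `<=` Omega.
Proof.
move=> t0 [_ _ fO] x tx; apply: fO; apply: subset_closure => /=.
by rewrite gt_eqF// (le_lt_trans t0).
Qed.

(** Here [F] is [f] itself, since the pieces need only be measurable: a level that is not slow would
    give, through [grid_pieces], an admissible family below [cheeger_k]. *)
Lemma approx_slow_cheeger_k Omega (f : 'rV[R]_n -> R) (M theta tau : R) (k : nat) :
  (0 < n)%N -> (1 < k)%N -> Omega `<=` cube n M -> test_function Omega f ->
  0 < theta -> ((66 * n%:R * k%:R `^ n%:R^-1 * theta)%:E < cheeger_k k Omega)%E ->
  0 < tau -> approx_slow f Omega theta tau.
Proof.
move=> n0 k1 OM tf th0 thO tau0; have cf : C1 f by have [/smooth_C1] := tf.
exists f; split => //.
- exact: test_function_superlevel (ltW tau0) tf.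
- by move=> x _; rewrite subrr normr0 ltW.
- by move=> x _; rewrite lerDl ltW.
apply: aeW => t tt; apply: contrapT => nslow.
have SO : superlevel f t `<=` Omega.
  by apply: test_function_superlevel tf; exact: ltW (lt_trans tau0 tt).
have [|E [E1 E2 E3]] := grid_pieces (M := M) n0 (ltnW k1) cf _ th0 nslow.
  exact: subset_trans OM.
move: thO; rewrite /cheeger_k gtn_eqF// ltNge => /negP; apply.
apply: ereal_inf_lbound; exists (66 * n%:R * k%:R `^ n%:R^-1 * theta) => //; split.
  by rewrite !mulr_gt0 ?powR_gt0 ?ltr0n// ltnW.
exists E; split => // i; first by have [mE /subset_trans] := E1 i; split => //; auto.
have [m0 hP] := E3 i; have [mE ES] := E1 i.
have fE : mu (E i) \is a fin_num.
  rewrite ge0_fin_numE//; apply: (sub_cube_lty (M := M) mE).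
  exact: subset_trans (subset_trans ES SO) OM.
have [v vE] : exists v, mu (E i) = v%:E by exists (fine (mu (E i))); rewrite fineK.
rewrite /cheeger_quotient gt_eqF// vE inver; rewrite vE lte_fin in m0.
by rewrite gt_eqF// lee_pdivrMr// -vE.
Qed.

Lemma perimeter_ge0 E : (0 <= perimeter E)%E.
Proof.
have z i : (fun _ : 'rV[R]_n => (0 : 'rV[R]_n) ord0 i) = fun=> 0.
  by apply/funext => x; rewrite mxE.
apply: ereal_sup_ubound; exists (fun=> 0) => //=.
  split.
  - by move=> i; rewrite z; exact: smooth_C1 (smooth_cst 0).
  - rewrite /supp (_ : [set _ | _] = set0) ?closure0; first exact: compact0.
    by apply/seteqP; split => // x /=; rewrite eqxx.
  - by move=> x; rewrite /enorm big1 ?sqrtr0// => i _; rewrite mxE expr0n.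
rewrite (eq_integral (fun=> 0%E)) ?integral0// => x _; congr (_%:E).
rewrite /divergence big1// => i _; rewrite z.
by have [_ ->] := C1_cst n (0 : R).
Qed.

Lemma cheeger_ge0 Omega : (0 <= cheeger Omega)%E.
Proof.
apply: le_ereal_inf_tmp => _ [E _ <-]; rewrite /cheeger_quotient.
by case: ifPn => // _; rewrite mule_ge0 ?perimeter_ge0// inve_ge0.
Qed.

Lemma lambda1_ge0 (p : R) Omega : (0 <= lambda1 p Omega)%E.
Proof.
apply: le_ereal_inf_tmp => _ [u [g [_ _ ->]]].
by rewrite mule_ge0 ?inve_ge0//; apply: integral_ge0 => x _; rewrite lee_fin powR_ge0.
Qed.

(* If [cheeger Omega] were infinite, all levels of a paraboloid supported in
   Omega would be slow for every theta. *)
Lemma cheeger_lty Omega (M : R) : Omega `<=` cube n M -> open Omega -> Omega !=set0 ->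
  (cheeger Omega < +oo)%E.
Proof.
move=> OM oO [x0 x0O].
have /nbhs_rVP[r r0 rO] : nbhs x0 Omega by exact: open_nbhs_nbhs (conj oO x0O).
(* Expands [r^2 - |x - x0|^2] as a constant plus a tilt, so that smoothness and derivatives come
   from those of [tilt]. *)
pose a : 'rV[R]_n := \row_i (- (2 * x0 ord0 i)).
pose c : R := r ^+ 2 - \sum_i x0 ord0 i ^+ 2.
pose F (x : 'rV[R]_n) : R := c + tilt 1 a x.
have FE x : F x = r ^+ 2 - \sum_i (x ord0 i - x0 ord0 i) ^+ 2.
  rewrite /F /c /tilt -addrA; congr (_ + _); rewrite addrC -!sumrB.
  rewrite -sumrN; apply: eq_bigr => i _; rewrite !mxE; ring.
have sF : smooth F by apply: smoothD; [exact: smooth_cst|exact: smooth_tilt].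
have cF := smooth_C1 sF.
have dF i x : partial i F x = - (2 * (x ord0 i - x0 ord0 i)).
  have [_ ->] := C1D (C1_cst n c).1 (C1_tilt 1 a).1.
  by have [_ ->] := C1_cst n c; have [_ ->] := C1_tilt 1 a; rewrite !mxE; ring.
have F0 x : 0 < F x -> Omega x.
  rewrite FE subr_gt0 => h; apply: rO => i.
  rewrite -(@ltr_pXn2r _ 2)// ?nnegrE ?ltW// real_normK ?num_real//.
  apply: le_lt_trans h; rewrite (bigD1 i)//= lerDl.
  by apply: sumr_ge0 => j _; exact: sqr_ge0.
have Fx0 : 0 < F x0 by rewrite FE big1 ?subr0 ?exprn_gt0// => i _; rewrite subrr expr0n.
pose S := superlevel F 0.
have oS : open S by exact: superlevel_open.
have mS : measurable S by exact: open_measurable_rV.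
have SM : S `<=` cube n M by move=> x /F0/OM.
rewrite ltey; apply/eqP => hoo.
have slow theta : 0 < theta -> forall tau, 0 < tau <= 1 -> approx_slow F S theta tau.
  move=> th0 tau /andP[tau0 _]; exists F; split => //.
  - by move=> x; exact: lt_trans.
  - by move=> x _; rewrite subrr normr0 ltW.
  - by move=> x _; rewrite lerDl ltW.
  apply: aeW => t tt; have t0 := lt_trans tau0 tt.
  have tO : [set x | t <= F x] `<=` Omega by move=> x /= h; apply: F0; exact: lt_le_trans h.
  (* The only critical point is [x0], at height [r^2]: lower levels are regular, and from that
     height on the superlevel set is empty. *)
  have [tr|rt] := ltP t (r ^+ 2).
    apply: (@regular_slow_levels R n F t M cF _ _ Omega) => //.
    - by move=> x /tO/OM.
    - move=> y Fy; apply: contrapT => /forallNP nd.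
      move: tr; rewrite -Fy FE big1 ?subr0 ?ltxx// => i _.
      have /negP/negPn/eqP := nd i; rewrite dF => h.
      by rewrite (_ : _ - _ = 0) ?expr0n//; lra.
    - by rewrite hoo ltry.
  move=> b; rewrite (_ : superlevel F t = set0) ?measure0 ?mule0 => [b0|].
    exists 0%N => m _; apply: (le_trans (ltW b0)); apply: mule_ge0 => //.
    by apply: integral_ge0 => x _; rewrite lee_fin !mulr_ge0 ?l1grad_ge0.
  apply/seteqP; split => // x; rewrite /superlevel/= FE => h.
  have : 0 <= \sum_i (x ord0 i - x0 ord0 i) ^+ 2.
    by apply: sumr_ge0 => i _; exact: sqr_ge0.
  by move=> h2; exfalso; lra.
have p1 : 1 < 2 :> R by rewrite ltr1n.
pose X := (\int[mu]_(x in S) (posp (F x) `^ 2)%:E)%E.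
pose Y := (\int[mu]_(x in S) (l1grad F x `^ 2)%:E)%E.
have H theta (th0 : 0 < theta) : ((theta `^ 2)%:E * X <= (sob_cst 2)%:E * Y)%E :=
  sobolev_posp mS SM p1 th0 cF (slow _ th0).
have Yfin : Y \is a fin_num.
  apply: integrable_fin_num => //.
  have [K K0 hK] := bounded_on_cube M (continuous_l1grad cF).
  apply: (bounded_integrable (K := K `^ 2)) => //; first exact: sub_cube_lty SM.
    by apply: measurable_powR_comp; apply: continuous_measurable_rV; exact: continuous_l1grad.
  move=> x /SM/hK; rewrite !ger0_norm ?powR_ge0// ?l1grad_ge0// => gK.
  by apply: powR_mono => //; exact: l1grad_ge0.
have X0 : (0 <= X)%E by apply: integral_ge0 => x _; rewrite lee_fin powR_ge0.
have mX : measurable_fun S (fun x => (posp (F x) `^ 2)%:E).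
  apply: measurable_EFin_comp; apply: measurable_powR_comp.
  apply: measurable_funTS; apply: continuous_measurable_rV => x.
  by apply: continuous_comp; [exact: C1_continuous|exact: continuous_posp].
have Xpos : X != 0%E.
  apply/eqP => XE.
  have : (\int[mu]_(x in S) `|(posp (F x) `^ 2)%:E| = 0)%E.
    by rewrite -[RHS]XE; apply: eq_integral => x _; rewrite gee0_abs// lee_fin powR_ge0.
  move=> /(ae_eq_integral_abs mu mS mX).1 ae0.
  have /nbhs_rVP[e e0 eS] : nbhs x0 S by exact: open_nbhs_nbhs (conj oS Fx0).
  have [x /eS Sx hx] := ae_in_rbox x0 e0 ae0.
  have h : posp (F x) `^ 2 = 0 by apply: EFin_inj; exact: hx.
  have := powR_eq0_eq0 h; have [[h1 ->]|[h1 _]] := pospP (F x).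
    by move=> h2; move: Sx; rewrite /S /superlevel/= h2 ltxx.
  by move: Sx; rewrite /S /superlevel/= ltNge h1.
have [y YE] : exists y, Y = y%:E by exists (fine Y); rewrite fineK.
have [x xX x_gt0] : exists2 x : R, (x%:E <= X)%E & 0 < x.
  clearbody X; case: X X0 Xpos {H} => [x| |]; rewrite ?lee_fin ?eqe//.
    by move=> h1 h2; exists x => //; rewrite lt_def h2.
  by move=> _ _; exists 1; rewrite ?leey.
have {}H theta : 0 < theta -> theta `^ 2 * x <= sob_cst 2 * y.
  move=> th0; rewrite -lee_fin EFinM [leRHS]EFinM -YE; apply: le_trans (H _ th0).
  by apply: lee_wpmul2l => //; rewrite lee_fin powR_ge0.
pose Z := sob_cst 2 * y.
(* With [theta = w + 1] the left side exceeds [2 w x + x], or equals it when [w = 0], and so is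
   larger than [Z <= w x]. *)
pose w := `|Z| / x; have w0 : 0 <= w by rewrite divr_ge0// ltW.
have hz : Z <= w * x by rewrite /w divfK ?gt_eqF// ler_norm.
have w1 : 0 < w + 1 by lra.
have := H _ w1; rewrite -/Z powR_mulrn; last exact: ltW.
have -> : (w + 1) ^+ 2 * x = w ^+ 2 * x + 2 * (w * x) + x by ring.
have h3 : 0 <= w * x by rewrite mulr_ge0// ltW.
have h4 : 0 <= w ^+ 2 * x by rewrite mulr_ge0 ?sqr_ge0// ltW.
by clearbody w Z; move=> h5; lra.
Qed.

End cheeger_constants.

Section rayleigh_bounds.
Context {R : realType} {n : nat}.
Variables (p : R) (Omega : set 'rV[R]_n) (M l : R).
Hypotheses (n0 : (0 < n)%N) (p1 : 1 < p) (oO : open Omega) (OM : Omega `<=` cube n M)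
  (M1 : 1 <= M) (lE : lambda1 p Omega = l%:E).

Let K : R := poincare_cst (n := n) p + 1.
Let A : R := (K * l) `^ p^-1.

Let K0 : 0 < K.
Proof.
by rewrite /K ltr_pwDr// !mulr_ge0 ?powR_ge0.
Qed.

Let slow_le theta : 0 < theta -> (forall f, test_function Omega f ->
  forall tau, 0 < tau <= 1 -> approx_slow f Omega theta tau) -> theta <= A.
Proof.
move=> th0 slow; have p0 : 0 < p by exact: lt_trans ltr01 p1.
have := le_rayleigh (open_measurable_rV oO) OM p1 th0 slow.
rewrite lE lee_fin -/K ler_pdivrMr// mulrC => h.
have -> : theta = (theta `^ p) `^ p^-1 by rewrite -powRrM divff ?gt_eqF// powRr1// ltW.
by apply: powR_mono => //; rewrite ?invr_ge0 ?powR_ge0// ltW.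
Qed.

Let A0 : 0 <= A. Proof. exact: powR_ge0. Qed.

(** Every [theta] below the Cheeger constant makes all test functions approximately slow, and
    [slow_le] caps such a [theta] at [A]. With [theta = A + e] this is absurd. *)
Lemma cheeger_le_rayleigh : (cheeger Omega <= A%:E)%E.
Proof.
apply/lee_addgt0Pr => e e0; rewrite -EFinD leNgt; apply/negP => h.
have th0 : 0 < A + e by rewrite ltr_wpDl.
suff : A + e <= A by rewrite gerDl leNgt e0.
apply: slow_le => // f tf tau /andP[tau0 _].
exact: (approx_slow_cheeger oO OM M1 tf th0 h tau0).
Qed.

Lemma cheeger_k_le_rayleigh (k : nat) : (1 <= k)%N ->
  (cheeger_k k Omega <= (66 * n%:R * k%:R `^ n%:R^-1 * A)%:E)%E.
Proof.
move=> k1; have n1 : 1 <= n%:R :> R by rewrite ler1n.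
(* For [k = 1] the constant is the one over smooth subdomains, which grid pieces do not reach; the
   bound by [A] is weakened using [66 n >= 1]. *)
have [->|kn1] := eqVneq k 1%N.
  rewrite /cheeger_k eqxx powR1 mulr1; apply: le_trans cheeger_le_rayleigh _.
  by rewrite lee_fin ler_peMl//; lra.
pose c : R := 66 * n%:R * k%:R `^ n%:R^-1.
have c0 : 0 < c by rewrite !mulr_gt0 ?powR_gt0 ?ltr0n.
apply/lee_addgt0Pr => e e0; rewrite -EFinD -/c leNgt; apply/negP => h.
have ec : 0 < e / c by rewrite divr_gt0.
have th0 : 0 < A + e / c by rewrite ltr_wpDl.
suff : A + e / c <= A by rewrite gerDl leNgt ec.
apply: slow_le => // f tf tau /andP[tau0 _].
apply: (approx_slow_cheeger_k (k := k) n0 _ OM tf th0) => //.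
  by rewrite ltn_neqAle eq_sym kn1.
by rewrite -/c mulrDr [c * (e / c)]mulrC divfK ?gt_eqF.
Qed.

(** Since [r <= A] and [A^p = K l], one gets [A^(p-1) = K l / A <= K l / r]; then take the root of
    order [p - 1]. *)
Lemma rayleigh_root_le (r : R) : 0 < r -> cheeger Omega = r%:E ->
  A <= K `^ (p - 1)^-1 * (l / r) `^ (p - 1)^-1.
Proof.
move=> r0 rE; have p0 : 0 < p by exact: lt_trans ltr01 p1.
have rA : r <= A by rewrite -lee_fin -rE; exact: cheeger_le_rayleigh.
have AA : 0 < A by exact: lt_le_trans rA.
have l0 : 0 <= l by rewrite -lee_fin -lE; exact: lambda1_ge0.
have Ap : A `^ p = K * l.
  by rewrite /A -powRrM mulVf ?gt_eqF// powRr1// mulr_ge0// ltW.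
have h : A `^ (p - 1) <= K * (l / r).
  rewrite mulrA ler_pdivlMr// -Ap [leRHS]powR_pred_mul// ler_wpM2l//.
  exact: powR_ge0.
have -> : A = (A `^ (p - 1)) `^ (p - 1)^-1.
  by rewrite -powRrM divff ?powRr1 ?ltW// gt_eqF// subr_gt0.
rewrite -powRM; [|exact: ltW|by rewrite divr_ge0// ltW].
by apply: powR_mono => //; rewrite ?invr_ge0 ?powR_ge0// subr_ge0 ltW.
Qed.

End rayleigh_bounds.

Lemma conjugate_ratio (R : realType) (p q : R) : 1 < p -> p^-1 + q^-1 = 1 ->
  q / p = (p - 1)^-1.
Proof.
move=> p1 pq; have p0 : 0 < p by lra.
have p10 : p - 1 != 0 by rewrite gt_eqF// subr_gt0.
have qE : q = p / (p - 1).
  rewrite -[LHS]invrK (_ : q^-1 = (p - 1) / p) ?invf_div//.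
  have -> : q^-1 = 1 - p^-1 by lra.
  by field; rewrite gt_eqF.
by rewrite qE; field; rewrite p10 gt_eqF.
Qed.

Theorem theorem1p2 (R : realType) (c1 c2 : R) (n : nat) (p q : R)
    (c1_gt0 : 0 < c1) (c2_gt0 : 0 < c2) (n_gt0 : (0 < n)%N)
    (p_gt1 : 1 < p) (pq : p^-1 + q^-1 = 1) :
  exists C : R, forall Omega : set 'rV[R]_n,
    domain Omega -> bounded_set Omega -> comparable_box c1 c2 Omega ->
    forall k : nat, (1 <= k)%N ->
      (cheeger_k k Omega <=
        (C * k%:R `^ n%:R^-1)%:E *
        (lambda1 p Omega / cheeger_k 1 Omega) `^ (q / p)%R)%E.
Proof.
rewrite (conjugate_ratio p_gt1 pq).
set s := (p - 1)^-1; have s0 : 0 < s by rewrite invr_gt0 subr_gt0.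
pose K : R := poincare_cst (n := n) p + 1.
have K0 : 0 < K by rewrite /K ltr_pwDr// !mulr_ge0 ?powR_ge0.
(* [66 n] comes from cutting along the grid, [K^s] from [rayleigh_root_le]. *)
exists (66 * n%:R * K `^ s) => Omega [oO _ O0] [M0 [_ hM]] _ k k1.
pose M := Num.max (M0 + 1) 1.
have OM : Omega `<=` cube n M.
  move=> x xO i; apply: le_trans (coord_le_norm x i) _; apply: hM xO.
  by rewrite lt_max ltrDl ltr01.
have M1 : 1 <= M by rewrite le_max lexx orbT.
rewrite [cheeger_k 1 Omega]/cheeger_k eqxx.
have c0 : 0 < 66 * n%:R * K `^ s * k%:R `^ n%:R^-1.
  by rewrite !mulr_gt0 ?powR_gt0 ?ltr0n.
have h_fin : cheeger Omega \is a fin_num.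
  by rewrite ge0_fin_numE ?cheeger_ge0//; exact: (cheeger_lty OM oO O0).
have [r rE] : exists r, cheeger Omega = r%:E by exists (fine (cheeger Omega)); rewrite fineK.
have r0 : 0 <= r by rewrite -lee_fin -rE cheeger_ge0.
have inf_rhs : (lambda1 p Omega / cheeger Omega = +oo)%E ->
    (cheeger_k k Omega <= (66 * n%:R * K `^ s * k%:R `^ n%:R^-1)%:E *
      (lambda1 p Omega / cheeger Omega) `^ s)%E.
  by move=> ->; rewrite poweRyr ?gt_eqF// gt0_muley ?lte_fin// leey.
have := lambda1_ge0 p Omega; case lE : (lambda1 p Omega) => [l| |]// l0; last first.
  rewrite -lE; apply: inf_rhs; rewrite lE rE inver; case: eqVneq => [_|rn0]; first by rewrite mulyy.
  by rewrite gt0_mulye// lte_fin invr_gt0 lt_def rn0.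
rewrite -lE; rewrite lee_fin in l0.
have hk := cheeger_k_le_rayleigh n_gt0 p_gt1 oO OM M1 lE k1.
(* The case [r = 0] follows the conventions of the extended reals: a positive [l] divided by 0 is
   [+oo], which makes the bound trivial. For [l = 0] the quotient is [0 * +oo = 0], and the left
   side must vanish too: it does, because [hk] bounds it by a multiple of [(K l)^(1/p) = 0]. *)
have [r00|rn0] := eqVneq r 0; last first.
  have rp : 0 < r by rewrite lt_def rn0.
  apply: (le_trans hk); rewrite lE rE inver gt_eqF// -(EFinM l) poweR_EFin -EFinM lee_fin.
  have h := rayleigh_root_le p_gt1 oO OM M1 lE rp rE.
  rewrite [leRHS](_ : _ = 66 * n%:R * k%:R `^ n%:R^-1 * (K `^ s * (l / r) `^ s)); last by ring.
  by apply: ler_wpM2l h; rewrite !mulr_ge0 ?powR_ge0.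
have [l00|ln0] := eqVneq l 0; last first.
  by apply: inf_rhs; rewrite lE rE inver r00 eqxx gt0_muley// lte_fin lt_def ln0.
apply: (le_trans hk); rewrite lE l00 mul0e poweR0r ?gt_eqF// mule0 lee_fin.
by rewrite mulr0 powR0 ?mulr0// invr_neq0// gt_eqF// (lt_trans ltr01).
Qed.
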